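(* Let $\Delta\subseteq\mathbb{R}^2$ be a two-dimensional lattice polygon. Then the graded Betti table of $X_\Delta\subseteq\mathbb{P}^{N_\Delta-1}$ has the form $$ \begin{array}{r|ccccccc} & 0 & 1 & 2 & 3 & \dots & N_\Delta-4 & N_\Delta-3 \\ \hline 0 & 1 & 0 & 0 & 0 & \dots & 0 & 0 \\ 1 & 0 & b_1 & b_2 & b_3 & \dots & b_{N_\Delta-4} & b_{N_\Delta-3} \\ 2 & 0 & c_{N_\Delta-3} & c_{N_\Delta-4} & c_{N_\Delta-5} & \dots & c_2 & c_1 \end{array} $$ where the entry in column $p$ and row $q$ is $\beta_{p,p+q}$ and all omitted entries are $0$. That is, $\beta_{0,0}=1$, and every other $\beta_{p,p+q}$ vanishes except possibly those with $1\le p\le N_\Delta-3$ and $q\in\{1,2\}$, for which one writes $b_\ell=\beta_{\ell,\ell+1}$ and $c_\ell=\beta_{N_\Delta-2-\ell,\,N_\Delta-\ell}$ ($1\le \ell\le N_\Delta-3$). Moreover, $c_\ell=0$ for all $\ell\in\{1,\dots,N_\Delta-3\}$ if and only if $\Delta^{(1)}=\emptyset$.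
   Context: Let $k$ be a field of characteristic $0$. A lattice polygon is the convex hull in $\mathbb{R}^2$ of finitely many points of $\mathbb{Z}^2$. $\Delta^{(1)}$ denotes the convex hull of the lattice points in the interior of $\Delta$, and $N_\Delta=|\Delta\cap\mathbb{Z}^2|$. Let $S_\Delta=k[X_{i,j}\mid (i,j)\in\Delta\cap\mathbb{Z}^2]$, so that $\mathbb{P}^{N_\Delta-1}=\mathrm{Proj}\, S_\Delta$. The toric surface $X_\Delta\subseteq\mathbb{P}^{N_\Delta-1}$ is the Zariski closure of the image of $(k^* )^2\to\mathbb{P}^{N_\Delta-1}:(a,b)\mapsto(a^ib^j)_{(i,j)\in\Delta\cap\mathbb{Z}^2}$, and $I_\Delta\subseteq S_\Delta$ is its homogeneous ideal. The graded Betti numbers $\beta_{p,q}$ are the exponents in a minimal graded free resolution $\cdots\to\bigoplus_{q}S_\Delta(-q)^{\beta_{1,q}}\to\bigoplus_q S_\Delta(-q)^{\beta_{0,q}}\to S_\Delta/I_\Delta\to0$ of $S_\Delta/I_\Delta$ as a graded $S_\Delta$-module. The graded Betti table has $\beta_{p,p+q}$ in its $p$th column and $q$th row. *)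

(* Defs.v *)
From HB Require Import structures.
From mathcomp Require Import all_boot all_order all_algebra finmap.
From mathcomp Require Import boolp classical_sets cardinality reals topology.
From mathcomp Require Import mpoly.

Set Implicit Arguments.
Unset Strict Implicit.
Unset Printing Implicit Defensive.

Import Order.TTheory GRing.Theory Num.Theory numFieldTopology.Exports.
Local Open Scope classical_set_scope.
Local Open Scope ring_scope.

Section Polygons.
Variable R : realType.

Definition lattice_vec (z : int * int) : 'rV[R]_2 :=
  \row_j (if j == 0 then z.1 else z.2)%:~R.

Definition convex_hull (A : set 'rV[R]_2) : set 'rV[R]_2 :=
  [set x | exists (n : nat) (t : 'I_n -> R) (v : 'I_n -> 'rV[R]_2),
     [/\ forall i, A (v i), forall i, 0 <= t i,
         \sum_i t i = 1 & x = \sum_i t i *: v i]].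

Definition lattice_polygon (D : set 'rV[R]_2) : Prop :=
  exists s : seq (int * int), D = convex_hull (lattice_vec @` [set` s]).

(* The affine hull of [D] is the whole plane. *)
Definition two_dimensional (D : set 'rV[R]_2) : Prop :=
  exists x y z, [/\ D x, D y, D z & free [:: y - x; z - x]].

Definition lattice_points (D : set 'rV[R]_2) : set (int * int) :=
  [set z | D (lattice_vec z)].

Definition interior_hull (D : set 'rV[R]_2) : set 'rV[R]_2 :=
  convex_hull (lattice_vec @` lattice_points (interior D)).

(* [fset_set] is the empty finite set on infinite sets; a polygon has only
   finitely many lattice points. *)
Definition lattice_fset (D : set 'rV[R]_2) : {fset int * int} :=
  fset_set (lattice_points D).

Definition num_lattice_points (D : set 'rV[R]_2) : nat := #|` lattice_fset D|.

(* The i-th variable of the coordinate ring corresponds to the i-th lattice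
   point in the enumeration of [lattice_fset D]. *)
Definition lattice_point (D : set 'rV[R]_2) (i : 'I_(num_lattice_points D)) :
  int * int := nth (0, 0) (lattice_fset D) i.

End Polygons.

(* Subsets of projective (N-1)-space over k are represented by sets of
   homogeneous coordinate vectors 'I_N -> k. *)
Section Projective.
Variables (k : fieldType) (N : nat).
Local Notation S := {mpoly k[N]}.

Definition vanishes_on (Y : set ('I_N -> k)) (f : S) : Prop :=
  forall y, Y y -> f.@[y] = 0.

Definition zariski_closure (Y : set ('I_N -> k)) : set ('I_N -> k) :=
  [set x | (exists i, x i != 0) /\
     forall (d : nat) (f : S), f \is d.-homog -> vanishes_on Y f -> f.@[x] = 0].

(* The ideal generated by the homogeneous polynomials vanishing on [X]. *)
Definition homogeneous_ideal (X : set ('I_N -> k)) : set S :=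
  [set f | exists (m : nat) (h g : 'I_m -> S),
     (forall i, (exists d : nat, g i \is d.-homog) /\ vanishes_on X (g i)) /\
     f = \sum_i h i * g i].

End Projective.

Section Toric.
Variables (R : realType) (k : fieldType) (D : set 'rV[R]_2).

Definition torus_image : set ('I_(num_lattice_points D) -> k) :=
  [set x | exists a b : k, [/\ a != 0, b != 0 &
     x = fun i => a ^ (lattice_point i).1 * b ^ (lattice_point i).2]].

Definition toric_surface : set ('I_(num_lattice_points D) -> k) :=
  zariski_closure torus_image.

Definition toric_ideal : set {mpoly k[num_lattice_points D]} :=
  homogeneous_ideal toric_surface.

End Toric.

Arguments torus_image {R} k D.
Arguments toric_surface {R} k D.
Arguments toric_ideal {R} k D.

Section Resolutions.
Variables (k : fieldType) (N : nat).
Local Notation S := {mpoly k[N]}.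

(* Degrees are integers, so that all twists S(-e) are allowed; there is no
   nonzero homogeneous polynomial of negative degree. *)
Definition homogeneous_of_degree (e : int) (f : S) : Prop :=
  forall m, m \in msupp f -> (mdeg m)%:Z = e.

(* A minimal graded free resolution
     ... -> F_2 -> F_1 -> F_0 -> S / I -> 0
   where F_p is the direct sum of the S(- res_shift p i), i < res_rank p.
   Elements of F_p are row vectors and maps act by right multiplication.
   The map F_0 -> S / I sends the i-th basis vector to the class of the
   homogeneous polynomial [res_aug i 0]. Minimality says that the image of
   F_{p+1} lies in (X_0, ..., X_{N-1}) F_p. *)
Record min_graded_free_resolution (I : set S) := MinGradedFreeResolution {
  res_rank : nat -> nat;
  res_shift : forall p, 'I_(res_rank p) -> int;
  res_aug : 'M[S]_(res_rank 0, 1);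
  res_diff : forall p, 'M[S]_(res_rank p.+1, res_rank p);
  res_aug_homog : forall i,
    homogeneous_of_degree (res_shift i) (res_aug i 0);
  res_diff_homog : forall p i j,
    homogeneous_of_degree (res_shift i - res_shift j) (res_diff p i j);
  res_aug_surj : forall f : S,
    exists v : 'rV[S]_(res_rank 0), I (f - (v *m res_aug) 0 0);
  res_exact0 : forall v : 'rV[S]_(res_rank 0),
    I ((v *m res_aug) 0 0) <-> exists w, v = w *m res_diff 0;
  res_exact : forall p (v : 'rV[S]_(res_rank p.+1)),
    v *m res_diff p = 0 <-> exists w, v = w *m res_diff p.+1;
  res_minimal : forall p i j, (res_diff p i j)@_0%MM = 0
}.

Definition betti (I : set S) (F : min_graded_free_resolution I)
    (p : nat) (q : int) : nat :=
  #|[set i : 'I_(res_rank F p) | res_shift i == q]|.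

End Resolutions.

(* The entry in column p and row q of the table
     1  0        0        ...  0
     0  b_1      b_2      ...  b_(N-3)
     0  c_(N-3)  c_(N-4)  ...  c_1      *)
Definition betti_table (N : nat) (b c : nat -> nat) (p : nat) (q : int) : nat :=
  if (p == 0%N) && (q == 0) then 1%N
  else if (1 <= p <= N - 3)%N then
    if q == 1 then b p else if q == 2 then c (N - 2 - p)%N else 0%N
  else 0%N.

(* Main.v *)
(* The number beta_{p,q} vanishes iff the Koszul complex of S / I is exact in
   homological degree p and degree q; the Koszul complex of S itself is exact
   because, in characteristic 0, contracting with partial derivatives gives
   Euler's formula. As I is spanned by differences of monomials with the same
   degree and the same sum of exponents, the Koszul complex of S / I splits by
   degree d and weight z, and each strand is the chain complex of the simplicial
   complex of the sets W of lattice points (the cells) such that (d - #|W|, z - sum W)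
   is a sum of lattice points.

   Removing extreme lattice points one at a time, and coning over the visible
   chain when they are put back, gives a unimodular triangulation with a shelling
   in which each triangle has a restriction face R of size at most 2. The supports
   of lexicographically minimal ("standard") representations of weights are the
   faces of this triangulation. Each cell W gets the triangle that first contains
   the standard representation of its complementary weight; toggling vertices of
   that triangle is a discrete Morse matching, and in a critical cell W avoids the
   triangle, so #|W| <= N - 3, and its degree is #|W| + #|R|. This bounds the
   Betti table. Triangles with #|R| = 2 occur iff there is an interior lattice
   point, and then the N - 3 points outside such a triangle form a critical cell
   that carries a nonzero homology class. *)
Require Import Defs.
From mathcomp Require Import all_boot all_order all_algebra.
From mathcomp Require Import zify ring lra.
From mathcomp Require Import boolp.

Set Implicit Arguments.
Unset Strict Implicit.
Unset Printing Implicit Defensive.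

Import Order.TTheory GRing.Theory Num.Theory.

Local Open Scope ring_scope.

(** * Standard representations of weights *)

(** The order of the list [V] carries the geometry: its head is the extreme point added last, and a
    standard representation uses that point only as often as the others force it to. This is the
    lexicographic term order whose largest variable is the head, and the triangulation is the
    corresponding placing triangulation. Points are compared through integer determinants and
    [saturated] only, so real geometry enters no earlier than the polygon itself. The obstacle in
    the matching is acyclicity: the standard representation may change completely when a point
    leaves a cell. The function [kappa] controls this. Either the product with that point is not
    standard and the lexicographic weight drops, or it is standard and the facet can only move
    forward; toggling keeps both. Tor is not constructed. Koszul homology and the given minimal
    resolution are compared by two diagram chases, one for each direction of the vanishing
    criterion. Characteristic 0 enters twice: to divide by the total degree in the Koszul complex of
    the polynomial ring, and to have enough torus points. *)

Notation pt := (int * int)%type.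

Definition dot (l p : pt) : int := l.1 * p.1 + l.2 * p.2.

Definition lsum (V : seq pt) (m : pt -> nat) (f : pt -> int) : int :=
  \sum_(p <- V) (m p)%:Z * f p.
Definition deg (V : seq pt) (m : pt -> nat) : nat := \sum_(p <- V) m p.
Definition wt (V : seq pt) (m : pt -> nat) : pt := (lsum V m fst, lsum V m snd).

Definition addm (m1 m2 : pt -> nat) : pt -> nat := fun p => (m1 p + m2 p)%N.
Definition scalem (c : nat) (m : pt -> nat) : pt -> nat := fun p => (c * m p)%N.
Definition single (q : pt) (x : nat) : pt -> nat := fun p => if p == q then x else 0%N.

Lemma degE V m : (deg V m)%:Z = lsum V m (fun=> 1).
Proof. by rewrite /deg /lsum -natz natr_sum; apply: eq_bigr => p _; rewrite natz mulr1. Qed.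

Lemma lsum_aff V m f (a b c : int) : (forall p, f p = a * p.1 + b * p.2 + c) ->
  lsum V m f = a * (wt V m).1 + b * (wt V m).2 + c * (deg V m)%:Z.
Proof.
move=> fE; rewrite degE /wt /lsum /= !mulr_sumr -!big_split /=.
by apply: eq_bigr => p _; rewrite fE; ring.
Qed.

Lemma lsumD V m1 m2 f : lsum V (addm m1 m2) f = lsum V m1 f + lsum V m2 f.
Proof.
rewrite /lsum -big_split; apply: eq_bigr => p _ /=.
by rewrite /addm PoszD mulrDl.
Qed.

Lemma lsumZ V c m f : lsum V (scalem c m) f = c%:Z * lsum V m f.
Proof.
rewrite /lsum mulr_sumr; apply: eq_bigr => p _ /=.
by rewrite /scalem PoszM mulrA.
Qed.

Lemma lsum_single V q x f : uniq V -> q \in V -> lsum V (single q x) f = x%:Z * f q.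
Proof.
move=> Vu qV; rewrite /lsum (bigD1_seq q) //= big1 /single ?eqxx ?addr0 //.
by move=> p /negPf->; rewrite mul0r.
Qed.

Lemma lsum_eq V m m' f : {in V, m =1 m'} -> lsum V m f = lsum V m' f.
Proof. by move=> E; rewrite /lsum !big_seq; apply: eq_bigr => p /E->. Qed.

Lemma deg_eq V m m' : {in V, m =1 m'} -> deg V m = deg V m'.
Proof. by move=> E; rewrite /deg !big_seq; apply: eq_bigr => p /E->. Qed.

Lemma lsum_cons v V m f : lsum (v :: V) m f = (m v)%:Z * f v + lsum V m f.
Proof. by rewrite /lsum big_cons. Qed.

Lemma deg_cons v V m : deg (v :: V) m = (m v + deg V m)%N.
Proof. by rewrite /deg big_cons. Qed.

Lemma lsum_le V m f g : {in V, forall p, (0 < m p)%N -> f p <= g p} ->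
  lsum V m f <= lsum V m g.
Proof.
move=> fg; rewrite /lsum !big_seq; apply: ler_sum => p pV.
by case: (posnP (m p)) => [->|mp]; rewrite ?mul0r // ler_pM2l // fg.
Qed.

(* The multiset [m] on [V], of size [d], has sum [z]. *)
Definition rep V (d : nat) (z : pt) m := deg V m = d /\ wt V m = z.

Lemma repP V d z m :
  rep V d z m <-> [/\ lsum V m (fun=> 1) = d%:Z, lsum V m fst = z.1 & lsum V m snd = z.2].
Proof.
case: z => z1 z2; rewrite /rep /wt -degE; split.
  by case=> <- [<- <-].
by case=> /= -[<-] <- <-.
Qed.

Lemma rep_aff V d z m f (a b c : int) : rep V d z m ->
  (forall p, f p = a * p.1 + b * p.2 + c) -> lsum V m f = a * z.1 + b * z.2 + c * d%:Z.
Proof. by case=> <- <- fE; rewrite (lsum_aff _ _ fE). Qed.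

Lemma rep_eq V d z m m' : {in V, m =1 m'} -> rep V d z m -> rep V d z m'.
Proof. by move=> E /repP[h1 h2 h3]; apply/repP; rewrite -!(lsum_eq _ E). Qed.

Lemma rep_ext V v d z m : v \notin V -> rep V d z m ->
  rep (v :: V) d z (fun p => if p == v then 0%N else m p).
Proof.
move=> vV /repP[h1 h2 h3].
have E : {in V, m =1 fun p => if p == v then 0%N else m p}.
  by move=> p pV /=; case: eqP => // pv; rewrite -pv pV in vV.
by apply/repP; rewrite !lsum_cons -!(lsum_eq _ E) eqxx !mul0r !add0r.
Qed.

(* Every lattice point that is an average of points of [V] lies in [V]. *)
Definition saturated V := forall M z m, (0 < M)%N ->
  rep V M (z.1 * M%:Z, z.2 * M%:Z) m -> z \in V.

(* The standard representation of a weight: the multiplicity of the first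
   point is as small as possible, then that of the second point, and so on. *)
Fixpoint std V m : Prop := if V is v :: V' then
  (forall m', deg V m' = deg V m -> wt V m' = wt V m -> (m v <= m' v)%N) /\ std V' m
  else True.

Lemma std_eq V m m' : {in V, m =1 m'} -> std V m -> std V m'.
Proof.
elim: V => //= v V IH E [h1 h2]; split; last first.
  by apply: IH h2 => p pV; apply: E; rewrite inE pV orbT.
have wE : wt (v :: V) m = wt (v :: V) m' by rewrite /wt !(lsum_eq _ E).
move=> m'' ; rewrite -(deg_eq E) -wE -(E v) ?mem_head //; exact: h1.
Qed.

Lemma std_uniq V d z m m' : std V m -> std V m' -> rep V d z m -> rep V d z m' ->
  {in V, m =1 m'}.
Proof.
elim: V d z => //= v V IH d z [h1 h2] [h1' h2'] r r'.
have mv : m v = m' v.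
  apply/eqP; rewrite eqn_leq h1 ?h1' //.
  - by rewrite r.1 r'.1.
  - by rewrite r.2 r'.2.
  - by rewrite r.1 r'.1.
  - by rewrite r.2 r'.2.
move=> p; rewrite inE => /orP[/eqP-> //|pV].
move/repP: r => [r1 r2 r3]; move/repP: r' => [r1' r2' r3'].
rewrite !lsum_cons mv in r1 r1' r2 r2' r3 r3'.
apply: (IH (deg V m) (wt V m)) => //; apply/repP; split.
- by rewrite degE; apply: (addrI ((m' v)%:Z * 1)); rewrite r1 r1'.
- by rewrite /wt /=; apply: (addrI ((m' v)%:Z * v.1)); rewrite r2 r2'.
- by rewrite /wt /=; apply: (addrI ((m' v)%:Z * v.2)); rewrite r3 r3'.
Qed.

Lemma std_exists V d z m : uniq V -> rep V d z m -> exists2 m', rep V d z m' & std V m'.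
Proof.
elim: V d z m => [|v V IH] d z m /=; first by exists m.
case/andP=> vV uV r.
pose P c := `[< exists2 m', rep (v :: V) d z m' & m' v = c >].
have exP : exists c, P c by exists (m v); apply/asboolP; exists m.
case: (ex_minnP exP) => c /asboolP[m1 r1 m1v] cmin.
have r1' : rep V (deg V m1) (wt V m1) m1 by [].
have [m2 r2 s2] := IH _ _ _ uV r1'.
pose m3 p := if p == v then c else m2 p.
have E : {in V, m2 =1 m3}.
  by move=> p pV; rewrite /m3; case: eqP => // pv; rewrite -pv pV in vV.
have r3 : rep (v :: V) d z m3.
  move/repP: r1 => [a1 a2 a3]; move/repP: r2 => [b1 b2 b3]; apply/repP.
  rewrite !lsum_cons -!(lsum_eq _ E) b1 b2 b3 /m3 eqxx -m1v degE /=.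
  by rewrite !lsum_cons in a1 a2 a3.
exists m3 => //; split; last exact: std_eq s2.
move=> m' e1 e2; rewrite {1}/m3 eqxx; apply: cmin; apply/asboolP; exists m' => //.
by split; rewrite ?e1 ?e2; case: r3.
Qed.

(* The lexicographic order on multisets of size less than [B], as a number in base [B]. *)
Fixpoint wgt (B : nat) (V : seq pt) (m : pt -> nat) : nat :=
  if V is v :: V' then (m v * B ^ size V' + wgt B V' m)%N else 0%N.

Lemma wgt_lt B V m : (deg V m < B)%N -> (wgt B V m < B ^ size V)%N.
Proof.
elim: V => [|v V IH]; rewrite ?deg_cons //= => h.
have {}IH := IH (leq_ltn_trans (leq_addl _ _) h).
have h2 : ((m v).+1 * B ^ size V <= B ^ (size V).+1)%N.
  by rewrite expnS leq_mul2r (leq_ltn_trans (leq_addr _ _) h) orbT.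
apply: leq_trans h2; rewrite mulSn addnC ltn_add2r //.
Qed.

Lemma wgt_eq B V m m' : {in V, m =1 m'} -> wgt B V m = wgt B V m'.
Proof.
elim: V => //= v V IH E; rewrite (E v) ?mem_head //; congr (_ + _)%N.
by apply: IH => p pV; apply: E; rewrite inE pV orbT.
Qed.

Lemma wgtD B V m m' : wgt B V (addm m m') = (wgt B V m + wgt B V m')%N.
Proof. by elim: V => //= v V ->; rewrite /addm mulnDl; lia. Qed.

(** Standardness makes the first differing multiplicity smaller in [m]. All multiplicities are below
    [B], so this digit decides the comparison. *)
Lemma wgt_std B V d z m m' : (d < B)%N -> std V m -> rep V d z m -> rep V d z m' ->
  (wgt B V m < wgt B V m')%N \/ {in V, m =1 m'}.
Proof.
move=> dB; elim: V d z dB => [|v V IH] d z dB /=; first by right.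
case=> h1 h2 r r'.
have le : (m v <= m' v)%N by apply: h1; [rewrite r.1 r'.1 | rewrite r.2 r'.2].
move: (le); rewrite leq_eqVlt => /orP[/eqP mv|lt].
  have [|||lt|E] := IH (deg V m) (wt V m) _ h2.
  - by move: r.1 dB; rewrite deg_cons; lia.
  - by [].
  - move/repP: r => [r1 r2 r3]; move/repP: r' => [r1' r2' r3'].
    rewrite !lsum_cons mv in r1 r1' r2 r2' r3 r3'; apply/repP; split.
    + by rewrite degE; apply: (addrI ((m' v)%:Z * 1)); rewrite r1 r1'.
    + by rewrite /wt /=; apply: (addrI ((m' v)%:Z * v.1)); rewrite r2 r2'.
    + by rewrite /wt /=; apply: (addrI ((m' v)%:Z * v.2)); rewrite r3 r3'.
  - by left; rewrite mv ltn_add2l.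
  - by right=> p; rewrite inE => /orP[/eqP-> //|/E].
left; have : (wgt B V m < B ^ size V)%N.
  by apply: wgt_lt; move: r.1 dB; rewrite deg_cons; lia.
move=> lt2; apply: leq_trans (leq_addr _ _).
apply: (@leq_trans ((m v).+1 * B ^ size V)).
  by rewrite mulSn addnC ltn_add2r.
by rewrite leq_mul2r lt orbT.
Qed.

(** * Shelled unimodular triangulations *)

Definition orient (v p q : pt) : int :=
  (p.1 - v.1) * (q.2 - v.2) - (p.2 - v.2) * (q.1 - v.1).

(** The coefficients are barycentric: [f] is the average of [x] copies of [b], [y] copies of [h] and
    [Y - x - y] copies of [v], so saturation applies. The lattice points constructed around a vertex
    are found in [V] this way. *)
Lemma sat2 v V b h f (Y x y : int) : uniq (v :: V) -> saturated (v :: V) ->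
  b \in V -> h \in V -> 0 < Y -> 0 <= x -> 0 <= y -> x + y <= Y ->
  Y * (f.1 - v.1) = x * (b.1 - v.1) + y * (h.1 - v.1) ->
  Y * (f.2 - v.2) = x * (b.2 - v.2) + y * (h.2 - v.2) -> f \in v :: V.
Proof.
move=> uV sat bV hV Y0 x0 y0 xyY e1 e2.
case: Y Y0 xyY e1 e2 => // Y Y0; case: x x0 => // x _; case: y y0 => // y _ xyY e1 e2.
pose m := addm (addm (single b x) (single h y)) (single v (Y - (x + y))).
apply: (sat Y _ m) => //.
have le : (x + y <= Y)%N by lia.
apply/repP; rewrite !lsumD !lsum_single ?mem_head ?inE ?bV ?hV ?orbT //= -subzn // PoszD.
by split; [lia| |]; move: e1 e2 => /=; rewrite ?PoszD !mulrBr => e1 e2; lra.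
Qed.

(** * The chain of points visible from an extreme vertex *)

Section Vertex.
Variables (v : pt) (V : seq pt) (l : pt).
Hypothesis uV : uniq (v :: V).
Hypothesis satV : saturated (v :: V).
Hypothesis extV : forall p : pt, p \in V -> dot l p < dot l v.

Local Notation o := (orient v).
Definition hgt (p : pt) : int := dot l v - dot l p.

Lemma hgt_gt0 (p : pt) : p \in V -> 0 < hgt p.
Proof. by move/extV; rewrite /hgt; lia. Qed.

(** The three-term determinant relation. All of [V] has positive height, that is, lies in an open
    half-plane seen from [v], which makes the angular order transitive. *)
Lemma orient_hgt p q r : hgt q * o p r = hgt p * o q r + hgt r * o p q.
Proof. by rewrite /hgt /dot /orient; ring. Qed.

Lemma orient_trans_ge (p q r : pt) : p \in V -> q \in V -> r \in V ->
  0 <= o p q -> 0 <= o q r -> 0 <= o p r.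
Proof.
move=> /hgt_gt0 hp /hgt_gt0 hq /hgt_gt0 hr pq qr.
by rewrite -(pmulr_rge0 _ hq) orient_hgt addr_ge0 // mulr_ge0 // ltW.
Qed.

Lemma orient_trans_gt (p q r : pt) : p \in V -> q \in V -> r \in V ->
  0 < o p q -> 0 < o q r -> 0 < o p r.
Proof.
move=> /hgt_gt0 hp /hgt_gt0 hq /hgt_gt0 hr pq qr.
by rewrite -(pmulr_rgt0 _ hq) orient_hgt addr_gt0 // mulr_gt0.
Qed.

Definition primitive (p : pt) := exists e : pt, (p.1 - v.1) * e.2 - (p.2 - v.2) * e.1 = 1.

(** The candidates lie on one line parallel to [p - v], and the least height selects the last of
    them met when walking against that direction; this makes the edge from [p] to [q] face [v]. *)
Definition next (p q : pt) := [/\ q \in V, o p q = 1 &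
  forall r : pt, r \in V -> o p r = 1 -> hgt q <= hgt r].

Lemma orient_v p : o p v = 0. Proof. by rewrite /orient; ring. Qed.

Lemma next_exists h b : h \in V -> b \in V -> primitive h -> 0 < o h b ->
  exists q, next h q.
Proof.
move=> hV bV [e he] hb.
pose k := (b.1 - v.1) * e.2 - (b.2 - v.2) * e.1.
(* [i] is [k / o h b] rounded up. Then [o h b] times [c - v] is [b - v] plus a remainder below
   [o h b] times [h - v], so [c] lies in the triangle of [v], [b], [h]. *)
pose i := - ((- k) %/ o h b)%Z.
have dvd : o h b * i - k = ((- k) %% o h b)%Z by rewrite /modz /i; ring.
pose c : pt := (v.1 + e.1 + i * (h.1 - v.1), v.2 + e.2 + i * (h.2 - v.2)).
have hc : o h c = 1 by rewrite -he /orient /c /=; ring.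
have cV : c \in V.
  have : c \in v :: V.
    apply: (@sat2 v V b h c (o h b) 1 (o h b * i - k)) => //.
    - by rewrite dvd modz_ge0 // gt_eqF.
    - have := ltz_pmod (- k) hb; rewrite dvd; lia.
    - have E : o h b * e.1 = (b.1 - v.1) * 1 - k * (h.1 - v.1).
        by rewrite -he /k /orient; ring.
      by transitivity (o h b * e.1 + o h b * i * (h.1 - v.1)); [rewrite /c /= | rewrite E]; ring.
    - have E : o h b * e.2 = (b.2 - v.2) * 1 - k * (h.2 - v.2).
        by rewrite -he /k /orient; ring.
      by transitivity (o h b * e.2 + o h b * i * (h.2 - v.2)); [rewrite /c /= | rewrite E]; ring.
  by rewrite inE => /orP[/eqP cv|//]; rewrite cv orient_v in hc.
pose P n := `[< exists q : pt, [/\ q \in V, o h q = 1 & hgt q = n%:Z] >].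
have exP : exists n, P n.
  exists `|hgt c|%N; apply/asboolP; exists c; split => //.
  by have := hgt_gt0 cV; lia.
case: (ex_minnP exP) => n /asboolP[q [qV hq qn]] nmin.
exists q; split => // r rV hr; rewrite qn.
have rn := hgt_gt0 rV.
have : (n <= `|hgt r|)%N by apply: nmin; apply/asboolP; exists r; split => //; lia.
by lia.
Qed.

Lemma cramer1 p q r : o p q * (r.1 - v.1) = o r q * (p.1 - v.1) + o p r * (q.1 - v.1).
Proof. by rewrite /orient; ring. Qed.

Lemma cramer2 p q r : o p q * (r.2 - v.2) = o r q * (p.2 - v.2) + o p r * (q.2 - v.2).
Proof. by rewrite /orient; ring. Qed.

(* [o r q + o p r] is the linear form equal to 1 at the vectors [p - v] and [q - v]. *)
Lemma next_form_ge p q r : p \in V -> next p q -> r \in V -> 0 <= o p r ->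
  1 <= o r q + o p r.
Proof.
move=> pV [qV pq qmin] rV.
have c1 := cramer1 p q r; have c2 := cramer2 p q r; rewrite pq !mul1r in c1 c2.
have hp := hgt_gt0 pV; have hr := hgt_gt0 rV.
have hrE : hgt r = o r q * hgt p + o p r * hgt q.
  have E s : hgt s = - (l.1 * (s.1 - v.1) + l.2 * (s.2 - v.2)) by rewrite /hgt /dot; ring.
  by rewrite !E c1 c2; ring.
move: hrE c1 c2; set X := o r q; set Y := o p r => hrE c1 c2 Y0.
have [Y1|{}Y0] : Y = 0 \/ 0 < Y by lia.
  by rewrite Y1 in hrE *; rewrite mul0r addr0 in hrE; nia.
apply/negP => XY.
have {}XY : X + Y <= 0 by lia.
pose k := ((- X) %/ Y)%Z.
have kE : - X = k * Y + ((- X) %% Y)%Z by rewrite {1}(divz_eq (- X) Y).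
have m0 : 0 <= ((- X) %% Y)%Z by rewrite modz_ge0 // gt_eqF.
have m1 : ((- X) %% Y)%Z < Y := ltz_pmod _ Y0.
move: kE m0 m1; set M := ((- X) %% Y)%Z => kE m0 m1.
have k1 : 1 <= k by nia.
(* [Y (f - v) = (r - v) + M (p - v)] with [1 + M <= Y], so [f] is in the triangle of [v], [r], [p].
   It lies on the line of [q] but strictly lower, against the choice of [q]. *)
pose f : pt := (q.1 - k * (p.1 - v.1), q.2 - k * (p.2 - v.2)).
have pf : o p f = 1 by rewrite -pq /orient /f /=; ring.
have fV : f \in V.
  have : f \in v :: V.
    apply: (@sat2 v V r p f Y 1 M) => //.
    - by lia.
    - have XE : X = - (k * Y) - M by lia.
      by rewrite /f /= c1 XE; ring.
    - have XE : X = - (k * Y) - M by lia.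
      by rewrite /f /= c2 XE; ring.
  by rewrite inE => /orP[/eqP cv|//]; rewrite cv orient_v in pf.
have := qmin f fV pf.
have -> : hgt f = hgt q - k * hgt p by rewrite /hgt /dot /f /=; ring.
nia.
Qed.

(** Convexity of the chain: the form of the preceding edge is at least 1 at [q], so [o z q >= 2],
    and the three-term relation then carries the bound at a point [r] behind [p] from the edge z p
    to the edge p q. *)
Lemma form_step z p q r : o z p = 1 -> o p q = 1 -> q \in V -> r \in V ->
  (forall s : pt, s \in V -> 1 <= o s p + o z s) -> o p r < 0 ->
  1 <= o r q + o p r.
Proof.
move=> zp pq qV rV zpL pr.
have Plk : o z q * o p r = o z p * o q r + o z r * o p q by rewrite /orient; ring.
have anti s t : o s t = - o t s by rewrite /orient; ring.
have := zpL q qV; have := zpL r rV.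
rewrite zp pq !mul1r mulr1 in Plk; rewrite (anti q p) pq (anti r p) (anti r q).
nia.
Qed.

(* [chain p s]: from [p] on, the points of [V] visible from [v], in angular order. *)
Fixpoint chain (p : pt) (s : seq pt) : Prop := if s is q :: s' then
  [/\ q \in V, o p q = 1, forall r : pt, r \in V -> 1 <= o r q + o p r & chain q s']
  else forall r : pt, r \in V -> o p r <= 0.

(** The number of points ahead of [p] drops at each step. Points ahead are handled by
    [next_form_ge]. The disjunction handles those behind: at the start there are none, later the
    preceding edge controls them by [form_step]. *)
Lemma chain_exists p : p \in V -> primitive p ->
  (forall r : pt, r \in V -> 0 <= o p r) \/
  (exists z : pt, o z p = 1 /\ forall r : pt, r \in V -> 1 <= o r p + o z r) ->
  exists s, chain p s.
Proof.
have [n] := ubnP (count (fun r => 0 < o p r) V).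
elim: n p => // n IH p cn pV prim H.
have [/hasP[b bV pb]|/hasPn nob] := boolP (has (fun r => 0 < o p r) V); last first.
  by exists [::] => r /nob; rewrite -leNgt.
have [q nq] := next_exists pV bV prim pb.
have [qV pq _] := nq.
have L r : r \in V -> 1 <= o r q + o p r.
  move=> rV; have [pr|pr] := leP 0 (o p r); first exact: next_form_ge.
  case: H => [/(_ r rV)|[z [zp zL]]]; first by lia.
  exact: (form_step zp pq).
have [||||s cs] := IH q.
- rewrite -ltnS; apply: leq_trans cn; rewrite ltnS.
  have cE (s : pt) : count (fun r => 0 < o s r) V = count (fun r => (r \in V) && (0 < o s r)) V.
    by apply: eq_in_count => r /= ->.
  rewrite !cE -!size_filter.
  have uV' : uniq V by case/andP: uV.
  set A' := filter _ V; set A := filter _ V.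
  have qA : q \in A by rewrite mem_filter qV pq.
  have : (size A' <= size (rem q A))%N.
    apply: uniq_leq_size; first by rewrite filter_uniq.
    move=> r; rewrite mem_filter => /andP[/andP[_ qr] rV].
    rewrite mem_rem_uniq ?filter_uniq // inE mem_filter rV andbT /=; apply/andP; split.
      by apply: contraTneq qr => ->; rewrite /orient; lia.
    by apply: (@orient_trans_gt p q r) => //; rewrite pq.
  rewrite size_rem // => le; apply: leq_ltn_trans le _; rewrite ltn_predL.
  by case: A qA.
- by [].
- exists (v.1 - p.1, v.2 - p.2) => /=; rewrite -pq /orient; ring.
- by right; exists p.
by exists (q :: s); split.
Qed.

Lemma extreme_exists : V != [::] -> exists2 p : pt, p \in V & forall r : pt, r \in V -> 0 <= o p r.
Proof.
suff H (W : seq pt) : {subset W <= V} -> W != [::] ->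
    exists2 p : pt, p \in W & forall r : pt, r \in W -> 0 <= o p r by exact: H.
elim: W => // q W IH sub _.
have qV : q \in V by apply: sub; rewrite mem_head.
have oqq s : o s s = 0 by rewrite /orient; ring.
have [W0|W0] := eqVneq W [::].
  by exists q; rewrite ?mem_head // => r; rewrite W0 inE => /eqP->; rewrite oqq.
have [p pW pmin] : exists2 p : pt, p \in W & forall r : pt, r \in W -> 0 <= o p r.
  by apply: IH => // r rW; apply: sub; rewrite inE rW orbT.
have pV : p \in V by apply: sub; rewrite inE pW orbT.
have [pq|qp] := leP 0 (o p q).
  by exists p; rewrite ?inE ?pW ?orbT // => r; rewrite inE => /orP[/eqP->|/pmin].
exists q; first exact: mem_head.
move=> r; rewrite inE => /orP[/eqP->|rW]; first by rewrite oqq.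
apply: (@orient_trans_ge q p r) => //; last exact: pmin.
  by apply: sub; rewrite inE rW orbT.
by move: qp; rewrite /orient; lia.
Qed.

Lemma orient_primitive (a : pt) : a <> (0, 0) ->
  exists2 g : int, 0 < g & exists e : pt, a = (g * e.1, g * e.2) /\
   exists f : pt, e.1 * f.2 - e.2 * f.1 = 1.
Proof.
case: a => a b ab0.
have g0 : 0 < gcdz a b.
  rewrite lt0r gcdz_eq0 -[0 <= _]/true andbT; apply/negP => /andP[/eqP a0 /eqP b0].
  by apply: ab0; rewrite a0 b0.
have [u [w uw]] := Bezoutz a b.
exists (gcdz a b) => //; exists ((a %/ gcdz a b)%Z, (b %/ gcdz a b)%Z) => /=.
have aE : a = (a %/ gcdz a b)%Z * gcdz a b by rewrite divzK // dvdz_gcdl.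
have bE : b = (b %/ gcdz a b)%Z * gcdz a b by rewrite divzK // dvdz_gcdr.
split; first by congr pair; rewrite mulrC.
exists (- w, u) => /=; move: aE bE uw (lt0r_neq0 g0).
move: (a %/ _)%Z => e1; move: (b %/ _)%Z => e2; move: (gcdz a b) => g -> -> uw gn0.
by apply: (mulIf gn0); rewrite mul1r -[RHS]uw; ring.
Qed.

(** The extreme point [h] need not be primitive, but the primitive lattice point on its ray lies
    between [v] and [h], hence in [V]. *)
Lemma first_exists : V != [::] ->
  exists p : pt, [/\ p \in V, primitive p & forall r : pt, r \in V -> 0 <= o p r].
Proof.
move=> V0; have [h hV hmin] := extreme_exists V0.
have h0 : (h.1 - v.1, h.2 - v.2) <> (0, 0).
  move=> [h1 h2]; have := hgt_gt0 hV; rewrite /hgt /dot.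
  by rewrite (subr0_eq h1) (subr0_eq h2) subrr ltxx.
have [g g0 [e [[e1 e2] [f ef]]]] := orient_primitive h0.
pose p : pt := (v.1 + e.1, v.2 + e.2).
have pe1 : p.1 - v.1 = e.1 by rewrite /p /=; lia.
have pe2 : p.2 - v.2 = e.2 by rewrite /p /=; lia.
have pv : p != v.
  apply/eqP => pv; move: pe1 pe2 ef; rewrite pv !subrr => <- <-; rewrite !mul0r; lia.
exists p; split.
- have : p \in v :: V.
    by apply: (@sat2 v V h h p g 1 0) => //; rewrite ?pe1 ?pe2 ?e1 ?e2; first lia; ring.
  by rewrite inE (negPf pv).
- by exists f; rewrite pe1 pe2.
move=> r rV; rewrite -(pmulr_rge0 _ g0) (_ : g * o p r = o h r) ?hmin //.
by rewrite /orient pe1 pe2 e1 e2; ring.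
Qed.
End Vertex.

(** * Extending a shelled triangulation by one vertex *)

Definition facet : eqType := (seq pt * seq pt)%type.
Definition subs (s t : seq pt) : bool := all (mem t) s.
Definition supp (V : seq pt) (m : pt -> nat) := [seq p <- V | (0 < m p)%N].
(** If no facet contains [t] this is [size fs], and the default pair read there has an empty
    restriction face; so [tri_first] can be stated for every [t]. *)
Definition pick_facet (fs : seq facet) (t : seq pt) : nat := find (fun f => subs t f.1) fs.

(* A shelled unimodular triangulation of the hull of [V] whose faces are the
   supports of the standard multisets. A facet [f] is a triangle [f.1] with the
   least face [f.2] of it that lies in no earlier triangle. *)
Record triangulation (V : seq pt) (fs : seq facet) : Prop := Triangulation {
  tri_facet : forall f, f \in fs -> exists a b c : pt,
    [/\ f.1 = [:: a; b; c], `|orient a b c| = 1 & subs f.1 V];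
  tri_restr : forall f, f \in fs -> [/\ uniq f.2, subs f.2 f.1 & (size f.2 <= 2)%N];
  tri_cover : forall m, std V m -> exists2 f, f \in fs & subs (supp V m) f.1;
  tri_std : forall f m, f \in fs -> subs (supp V m) f.1 -> std V m;
  tri_first : forall t, subs (nth ([::], [::]) fs (pick_facet fs t)).2 t;
  tri_shell : pairwise (fun f g => ~~ subs g.2 f.1) fs;
  tri_normal : forall (M d : nat) (z : pt) m, (0 < M)%N ->
    rep V (M * d) (z.1 * M%:Z, z.2 * M%:Z) m -> exists m', rep V d z m' }.

Definition noncollinear (V : seq pt) :=
  exists p q r : pt, [/\ p \in V, q \in V, r \in V & orient p q r != 0].

(* The point [z - d v], with origin [v]. *)
Definition relative_wt (v : pt) (d : int) (z : pt) : pt :=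
  (z.1 - d * v.1 + v.1, z.2 - d * v.2 + v.2).

Lemma lsum_orientr v W d z m b : rep W d z m ->
  lsum W m (orient v b) = orient v b (relative_wt v d%:Z z).
Proof.
move=> r; rewrite (rep_aff (a := - (b.2 - v.2)) (b := b.1 - v.1)
  (c := (b.2 - v.2) * v.1 - (b.1 - v.1) * v.2) r).
  by rewrite /orient /=; ring.
by move=> p; rewrite /orient; ring.
Qed.

Lemma lsum_orientl v W d z m b : rep W d z m ->
  lsum W m (fun p => orient v p b) = orient v (relative_wt v d%:Z z) b.
Proof.
have E p : orient v p b = - orient v b p by rewrite /orient; ring.
move=> r; rewrite E -(lsum_orientr _ _ r) /lsum -sumrN.
by apply: eq_bigr => p _; rewrite E mulrN.
Qed.

(* The triangles joining [v] to the consecutive points of a chain; each but the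
   first shares an edge with the preceding one. *)
Fixpoint fan (v : pt) (first : bool) (p : pt) (s : seq pt) : seq facet :=
  if s is q :: s' then ([:: v; p; q], if first then [:: v] else [:: v; q]) :: fan v false q s'
  else [::].

Lemma unit_step (s t D : int) : s <= 0 -> 1 <= t -> `|t - s| * `|D| = 1 -> s = 0 /\ t = 1.
Proof.
move=> s0 t1; rewrite ger0_norm; last by lia.
have : 0 <= `|D| by []; move: `|D| => n n0 hx.
have n1 : 1 <= n by nia.
have ts : t - s <= 1 by nia.
by split; lia.
Qed.

Section Step.
Variables (v : pt) (V : seq pt) (l : pt) (fs : seq facet).
Hypothesis uV : uniq (v :: V).
Hypothesis satV : saturated (v :: V).
Hypothesis extV : forall p : pt, p \in V -> dot l p < dot l v.
Hypothesis triV : triangulation V fs.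

Local Notation o := (orient v).
Local Notation chain := (chain v V).

Let vV : v \notin V. Proof. by case/andP: uV. Qed.

Lemma orientvv p : o p p = 0. Proof. by rewrite /orient; ring. Qed.
Lemma orientC p q : o p q = - o q p. Proof. by rewrite /orient; ring. Qed.

Definition visible (b c : pt) :=
  [/\ b \in V, c \in V, o b c = 1 & forall r : pt, r \in V -> 1 <= o r c + o b r].

Lemma fanP first h s f : h \in V -> chain h s -> f \in fan v first h s ->
  exists b c : pt, [/\ f.1 = [:: v; b; c], visible b c & f.2 = [:: v] \/ f.2 = [:: v; c]].
Proof.
elim: s h first => // c s IH h first hV /= [cV hc L cs].
rewrite inE => /orP[/eqP->|]; last exact: IH.
by exists h, c; split => //=; case: first; [left|right].
Qed.

Lemma fan_cover first h s A : chain h s -> s != [::] -> 0 <= o h A ->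
  (forall q : pt, q \in V -> (forall r : pt, r \in V -> o q r <= 0) -> o q A <= 0) ->
  exists2 f, f \in fan v first h s &
    exists b c : pt, [/\ f.1 = [:: v; b; c], 0 <= o b A & 0 <= o A c].
Proof.
elim: s h first => // c s IH h first /= [cV hc L cs] _ hA lastA.
have [Ac|Ac] := leP 0 (o A c).
  by exists ([:: v; h; c], if first then [:: v] else [:: v; c]); rewrite ?mem_head //; exists h, c.
have s0 : s != [::].
  by apply/eqP => s0; rewrite s0 /= in cs; have := lastA c cV cs; rewrite orientC; lia.
have cA : 0 <= o c A by rewrite orientC; lia.
have [f ff fP] := IH c false cs s0 cA lastA.
by exists f; rewrite // inE ff orbT.
Qed.

Lemma lsum_vis_eq b c m d z : rep (v :: V) d z m ->
  lsum V m (fun p => o p c + o b p) = o (relative_wt v d%:Z z) c + o b (relative_wt v d%:Z z).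
Proof.
move=> r; rewrite -(lsum_orientl v c r) -(lsum_orientr v b r) !lsum_cons.
have -> : o v c = 0 by rewrite /orient; ring.
have -> : o b v = 0 by rewrite /orient; ring.
rewrite !mulr0 !add0r /lsum -big_split /=.
by apply: eq_bigr => p _; rewrite mulrDr.
Qed.

(* The affine form [o r c + o b r] is at least 1 on [V] and the standard
   representation [m] of [b + c] has average 1, so [m] lives on the line through [b]
   and [c]; unimodularity of its triangle forces its support to be [b], [c]. *)
Lemma edge_in_old b c : visible b c -> exists2 f, f \in fs & (b \in f.1) && (c \in f.1).
Proof.
move=> [bV cV bc L].
have uV' : uniq V by case/andP: uV.
have r0 : rep V 2 (b.1 + c.1, b.2 + c.2) (addm (single b 1) (single c 1)).
  by apply/repP; rewrite !lsumD !lsum_single //=; split; lia.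
have [m r sm] := std_exists uV' r0.
have [f ff sf] := tri_cover triV sm.
exists f => //.
have lL : lsum V m (fun p => o p c + o b p) = 2.
  rewrite (_ : lsum _ _ _ = lsum V m (fun p => o p c) + lsum V m (o b)); last first.
    by rewrite /lsum -big_split; apply: eq_bigr => p _; rewrite /= mulrDr.
  rewrite (lsum_orientl v c r) (lsum_orientr v b r).
  by transitivity (2 * o b c); [rewrite /orient /relative_wt /=; ring | rewrite bc].
have l1 : lsum V m (fun=> 1) = 2 by case/repP: r.
have onL p : p \in V -> (0 < m p)%N -> o p c + o b p = 1.
  move=> pV mp; apply/eqP; rewrite eq_le L // andbT.
  rewrite leNgt; apply/negP => Lp.
  suff : lsum V m (fun=> 1) < lsum V m (fun p => o p c + o b p) by rewrite l1 lL.
  rewrite /lsum (bigD1_seq p) //= [X in _ < X](bigD1_seq p) //=.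
  rewrite ltr_leD //; first by rewrite ltr_pM2l.
  rewrite big_seq_cond [X in _ <= X]big_seq_cond.
  by apply: ler_sum => q /andP[qV _]; rewrite ler_wpM2l // L.
have lb : lsum V m (o b) = 1.
  by rewrite (lsum_orientr v b r) -bc /orient /relative_wt /=; ring.
(* The values of [o b] on the two points of [m] are integers with sum 1, so one is at most 0 and one
   is at least 1. *)
have [p [pV mp bp]] : exists p : pt, [/\ p \in V, (0 < m p)%N & o b p <= 0].
  apply: contrapT => H.
  suff : lsum V m (fun=> 1) <= lsum V m (o b) by rewrite l1 lb.
  apply: lsum_le => p pV mp; rewrite -gtz0_ge1 ltNge; apply/negP => bp.
  by apply: H; exists p.
have [q [qV mq bq]] : exists q : pt, [/\ q \in V, (0 < m q)%N & 1 <= o b q].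
  apply: contrapT => H.
  suff : lsum V m (o b) <= lsum V m (fun=> 0).
    by rewrite lb /lsum big1 // => x _; rewrite mulr0.
  apply: lsum_le => x xV mx; rewrite -ltzD1 ltNge; apply/negP => bx.
  by apply: H; exists x.
have pf : p \in f.1 by apply: (allP sf); rewrite mem_filter mp.
have qf : q \in f.1 by apply: (allP sf); rewrite mem_filter mq.
have [x hx] : exists x : pt, `|orient x p q| = 1.
  have [a1 [a2 [a3 [fE ori _]]]] := tri_facet triV ff.
  have pq : p != q by apply/eqP => pq; have := le_trans bq (_ : o b q <= 0); rewrite -pq => /(_ bp).
  have E1 : orient a1 a3 a2 = - orient a1 a2 a3 by rewrite /orient; ring.
  have E2 : orient a2 a1 a3 = - orient a1 a2 a3 by rewrite /orient; ring.
  have E3 : orient a2 a3 a1 = orient a1 a2 a3 by rewrite /orient; ring.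
  have E4 : orient a3 a1 a2 = orient a1 a2 a3 by rewrite /orient; ring.
  have E5 : orient a3 a2 a1 = - orient a1 a2 a3 by rewrite /orient; ring.
  move: pf qf pq; rewrite fE !inE.
  case/or3P=> /eqP->; case/or3P=> /eqP->; rewrite ?eqxx // => _.
  - by exists a3; rewrite E4.
  - by exists a2; rewrite E2 normrN.
  - by exists a3; rewrite E5 normrN.
  - by exists a1.
  - by exists a2; rewrite E3.
  - by exists a1; rewrite E1 normrN.
(* On the line through [b] and [c], [q - p] is [o b q - o b p] times [c - b], so this integer
   divides a determinant equal to 1 or -1. *)
have E : orient x p q = (o b q - o b p) * orient x p (p.1 + c.1 - b.1, p.2 + c.2 - b.2).
  have ce1 r := cramer1 v b c r; have ce2 r := cramer2 v b c r.
  have pc := onL p pV mp; have qc := onL q qV mq.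
  have {}pc : o p c = 1 - o b p by rewrite -pc addrK.
  have {}qc : o q c = 1 - o b q by rewrite -qc addrK.
  have := ce1 p; have := ce2 p; have := ce1 q; have := ce2 q.
  rewrite bc pc qc !mul1r => q2 q1 p2 p1.
  have d1 : q.1 = p.1 + (o b q - o b p) * (c.1 - b.1).
    by rewrite -(subrK v.1 q.1) q1 -[in RHS](subrK v.1 p.1) p1; ring.
  have d2 : q.2 = p.2 + (o b q - o b p) * (c.2 - b.2).
    by rewrite -(subrK v.2 q.2) q2 -[in RHS](subrK v.2 p.2) p2; ring.
  rewrite /orient -/(o b q) -/(o b p) d1 d2 /=; ring.
have bp0 : o b p = 0 /\ o b q = 1.
  by apply: (unit_step (D := orient x p (p.1 + c.1 - b.1, p.2 + c.2 - b.2))); rewrite // -normrM -E.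
have eqv (s t : pt) : o b s = o b t -> o s c = o t c -> s = t.
  move=> e1 e2; have := cramer1 v b c s; have := cramer2 v b c s.
  rewrite e1 e2 -(cramer1 v b c t) -(cramer2 v b c t) bc !mul1r.
  by case: s t {e1 e2} => [s1 s2] [t1 t2] /= /addIr-> /addIr->.
have -> : b = p.
  apply: eqv; first by rewrite orientvv bp0.1.
  by have := onL p pV mp; rewrite bp0.1 bc addr0.
have -> : c = q.
  apply: eqv; first by rewrite bc bp0.2.
  by have := onL q qV mq; rewrite bp0.2 orientvv => /eqP; rewrite eq_sym -subr_eq subrr => /eqP.
by rewrite pf.
Qed.

(** The form of the edge b c is 1 at [b] and [c] and at least 1 on [V], and its sum depends on the
    weight only. So no other representation has more points in [V], that is, fewer copies of [v].
    The rest is standard because [b] and [c] lie in a common old facet. *)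
Lemma fan_std first h s f m : h \in V -> chain h s -> f \in fan v first h s ->
  subs (supp (v :: V) m) f.1 -> std (v :: V) m.
Proof.
move=> hV cs ff sub; have [b [c [fE bc _]]] := fanP hV cs ff.
have [bV cV obc L] := bc.
have sub' p : p \in V -> (0 < m p)%N -> p = b \/ p = c.
  move=> pV mp; have : p \in f.1 by apply: (allP sub); rewrite mem_filter mp inE pV orbT.
  rewrite fE !inE; case/or3P=> /eqP; [|by left|by right].
  by move=> pv; rewrite pv (negPf vV) in pV.
split.
  move=> m' e1 e2.
  have r : rep (v :: V) (deg (v :: V) m) (wt (v :: V) m) m by [].
  have r' : rep (v :: V) (deg (v :: V) m) (wt (v :: V) m) m' by [].
  have le : lsum V m' (fun=> 1) <= lsum V m (fun=> 1).
    have eqL : lsum V m (fun=> 1) = lsum V m (fun p => o p c + o b p).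
      apply/eqP; rewrite eq_le !lsum_le // => p pV mp.
        by case: (sub' p pV mp) => ->; rewrite orientvv obc.
      by rewrite L.
    rewrite eqL (lsum_vis_eq b c r) -(lsum_vis_eq b c r').
    by apply: lsum_le => p pV _; rewrite L.
  rewrite -!degE lez_nat in le.
  by move: e1; rewrite !deg_cons; move: le; lia.
have [g gf /andP[bg cg]] := edge_in_old bc.
apply: (tri_std triV gf); apply/allP => p; rewrite mem_filter => /andP[mp pV].
by case: (sub' p pV mp) => ->.
Qed.

(** Seen from [v] the weight falls in the cone of a visible edge b c. Either a nonnegative
    multiplicity is left for [v], or the weight lies beyond the edge and a multiple of it is
    represented without [v], so that normality of the old triangulation applies. The case [M = 1]
    serves for covering, general [M] for normality. *)
Lemma rep_pull h s (M d : nat) (z : pt) m : h \in V -> chain h s -> s != [::] ->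
  (forall r : pt, r \in V -> 0 <= o h r) -> (0 < M)%N ->
  rep (v :: V) (M * d) (z.1 * M%:Z, z.2 * M%:Z) m ->
  (exists2 f, f \in fan v true h s &
     exists2 m', rep (v :: V) d z m' & subs (supp (v :: V) m') f.1) \/
  exists m', rep V d z m'.
Proof.
move=> hV cs s0 hmin M0 r; pose A := relative_wt v d%:Z z.
have MA1 b : lsum V m (o b) = M%:Z * o b A.
  have -> : lsum V m (o b) = lsum (v :: V) m (o b).
    by rewrite lsum_cons (_ : o b v = 0) ?mulr0 ?add0r //; rewrite /orient; ring.
  by rewrite (lsum_orientr v b r) PoszM /relative_wt /A /orient /=; ring.
have hA : 0 <= o h A.
  rewrite -(pmulr_rge0 _ (_ : 0 < M%:Z)) // -MA1.
  rewrite (_ : 0 = lsum V m (fun=> 0)); last by rewrite /lsum big1 // => *; rewrite mulr0.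
  by apply: lsum_le => p pV _; apply: hmin.
have lA q : q \in V -> (forall r : pt, r \in V -> o q r <= 0) -> o q A <= 0.
  move=> qV qlast; rewrite -(pmulr_rle0 _ (_ : 0 < M%:Z)) // -MA1.
  rewrite (_ : 0 = lsum V m (fun=> 0)); last by rewrite /lsum big1 // => *; rewrite mulr0.
  by apply: lsum_le => p pV _; apply: qlast.
have [f ff [b [c [fE bA Ac]]]] := fan_cover true cs s0 hA lA.
have [b' [c' [fE' bc _]]] := fanP hV cs ff.
rewrite fE in fE'; case: fE' => eb ec; rewrite -{}eb -{}ec {b' c'} in bc.
have [bV cV obc L] := bc.
have bv : b != v by apply: contraNneq vV => <-.
have cv : c != v by apply: contraNneq vV => <-.
have A1 := cramer1 v b c A; have A2 := cramer2 v b c A.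
move: bA Ac A1 A2; rewrite obc !mul1r.
case: (o b A) => // y _; case: (o A c) => // x _ A1 A2.
have z1 : z.1 = x%:Z * (b.1 - v.1) + y%:Z * (c.1 - v.1) + d%:Z * v.1.
  by rewrite -A1 /A /relative_wt /=; ring.
have z2 : z.2 = x%:Z * (b.2 - v.2) + y%:Z * (c.2 - v.2) + d%:Z * v.2.
  by rewrite -A2 /A /relative_wt /=; ring.
have uV' : uniq V by case/andP: uV.
have [sd|ds] := leqP (x + y) d.
  left; exists f => //; exists (addm (addm (single b x) (single c y)) (single v (d - (x + y)))).
    apply/repP; rewrite !lsumD !lsum_single ?mem_head ?inE ?bV ?cV ?orbT //.
    by rewrite -subzn // z1 z2 PoszD; split; ring.
  apply/allP => p; rewrite mem_filter => /andP[mp _].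
  move: mp; rewrite fE !inE /addm /single.
  by do 3 case: eqP => //=.
right.
have e1 f' : lsum V m f' = lsum (v :: V) m f' - (m v)%:Z * f' v.
  by rewrite lsum_cons addrC addKr.
(* This multiplier eliminates [v] between the given relation, which contains [m v] copies of [v],
   and [z + (x + y - d) v = x b + y c]. *)
apply: (tri_normal triV (M := (x + y - d) * M + m v)
  (m := addm (scalem (x + y - d) m) (scalem (m v) (addm (single b x) (single c y))))).
  by rewrite addn_gt0 muln_gt0 M0 andbT subn_gt0 ds.
case/repP: r => r1 r2 r3; apply/repP.
rewrite !lsumD !lsumZ !lsumD !lsum_single // !e1 r1 r2 r3 /= !PoszM !PoszD PoszM.
rewrite -!subzn ?PoszD //; last exact: ltnW.
by rewrite z1 z2; split; ring.
Qed.

(** The two hypotheses say that [t] lies in no earlier triangle: not in the edge shared with the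
    preceding triangle of the fan, and not in an edge opposite to [v], which belongs to the old
    part. *)
Lemma fan_first first h s t : h \in V -> chain h s ->
  (~~ first -> ~~ subs t [:: v; h]) ->
  (forall f, f \in fan v first h s -> subs t f.1 -> v \in t) ->
  subs (nth ([::], [::]) (fan v first h s) (pick_facet (fan v first h s) t)).2 t.
Proof.
elim: s h first => //= c s IH h first hV [cV hc L cs] H1 H2.
rewrite /pick_facet /=; case: (boolP (subs t [:: v; h; c])) => /= [sub|nsub].
  have vt : v \in t by apply: (H2 ([:: v; h; c], if first then [:: v] else [:: v; c])); rewrite ?mem_head.
  case: first {IH H2} H1 => /= [_|/(_ isT) H1]; first by rewrite /subs /= vt.
  rewrite /subs /= vt andbT /=; apply: contraNT H1 => ct.
  apply/allP => p pt; have := allP sub p pt; rewrite !inE.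
  case/or3P=> /eqP pE; [by rewrite pE eqxx | by rewrite pE eqxx orbT |].
  by rewrite -pE pt in ct.
apply: IH => // [_|f ff]; last by apply: H2; rewrite inE ff orbT.
apply: contra nsub => /allP sub; apply/allP => p /sub; rewrite !inE.
by case/orP=> ->; rewrite ?orbT.
Qed.

Lemma chain_mem h s c : chain h s -> c \in s -> c \in V.
Proof.
elim: s h => //= q s IH h [qV _ _ cs]; rewrite inE => /orP[/eqP->|] //; exact: IH cs.
Qed.

Lemma chain_after h s c : h \in V -> chain h s -> c \in s -> 0 < o h c.
Proof.
elim: s h => //= q s IH h hV [qV hq L cs]; rewrite inE => /orP[/eqP->|cs'].
  by rewrite hq.
have cV := chain_mem cs cs'.
by apply: (orient_trans_gt uV extV hV qV cV) => //; [rewrite hq | apply: IH].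
Qed.

Lemma fan_restr_tail h s g : g \in fan v false h s -> exists2 c, c \in s & g.2 = [:: v; c].
Proof.
elim: s h => //= q s IH h; rewrite inE => /orP[/eqP->|/IH[c cs gE]].
  by exists q; rewrite ?mem_head.
by exists c; rewrite // inE cs orbT.
Qed.

Lemma fan_shell first h s : h \in V -> chain h s ->
  pairwise (fun f g : facet => ~~ subs g.2 f.1) (fan v first h s).
Proof.
elim: s h first => //= q s IH h first hV [qV hq L cs].
rewrite IH // andbT; apply/allP => g /fan_restr_tail[c cs' ->] /=.
rewrite /subs /= !inE !andbT eqxx /= !negb_or.
have qc := chain_after qV cs cs'.
have hc : 0 < o h c.
  by apply: (@chain_after h (q :: s)) => //; rewrite inE cs' orbT.
have ne (p : pt) : 0 < o p c -> c != p.
  by apply: contraTneq => ->; rewrite orientvv.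
apply/and3P; split; [|exact: ne|exact: ne].
by apply: contraTneq qc => ->; rewrite (_ : o q v = 0) // /orient; ring.
Qed.

Lemma fan_triangulation h s : h \in V -> chain h s -> s != [::] ->
  (forall r : pt, r \in V -> 0 <= o h r) -> triangulation (v :: V) (fs ++ fan v true h s).
Proof.
move=> hV cs s0 hmin.
have old f : f \in fs -> v \notin f.1.
  move=> ff; have [a [b [c [_ _ sub]]]] := tri_facet triV ff.
  by apply: contra vV => vf; apply: (allP sub).
have ffacet f : f \in fan v true h s -> exists a b c : pt,
    [/\ f.1 = [:: a; b; c], `|orient a b c| = 1 & subs f.1 (v :: V)].
  move=> ff; have [b [c [fE [bV cV bc _] _]]] := fanP hV cs ff.
  exists v, b, c; split => //; first by rewrite bc.
  by rewrite fE /subs /= !inE eqxx bV cV !orbT.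
have stdl : forall f m, f \in fs ++ fan v true h s -> subs (supp (v :: V) m) f.1 -> std (v :: V) m.
  move=> f m; rewrite mem_cat => /orP[ff sub|ff]; last exact: fan_std hV cs ff.
  have mv : m v = 0%N.
    apply/eqP; rewrite -leqn0 leqNgt; apply: contra (old f ff) => mv.
    by apply: (allP sub); rewrite mem_filter mv mem_head.
  split; first by rewrite mv.
  by apply: (tri_std triV ff); move: sub; rewrite /supp /= mv.
split => //.
- move=> f; rewrite mem_cat => /orP[ff|]; last exact: ffacet.
  have [a [b [c [fE fo sub]]]] := tri_facet triV ff; exists a, b, c; split => //.
  by apply: sub_all sub => p /=; rewrite inE => ->; rewrite orbT.
- move=> f; rewrite mem_cat => /orP[|ff]; first exact: (tri_restr triV).
  have [b [c [fE [bV cV bc _] f2]]] := fanP hV cs ff.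
  have vc : v != c by apply: contraNneq vV => ->.
  by rewrite fE; case: f2 => ->; rewrite /subs /= !inE ?eqxx ?vc ?orbT.
- move=> m sm; case: (posnP (m v)) => [mv|mv].
    have [f ff sub] := tri_cover triV sm.2.
    by exists f; rewrite ?mem_cat ?ff // /supp /= mv.
  have r : rep (v :: V) (1 * deg (v :: V) m)
    ((wt (v :: V) m).1 * 1%:Z, (wt (v :: V) m).2 * 1%:Z) m by rewrite mul1n !mulr1.
  have [[f ff [m' r' sub]]|[m' r']] := rep_pull hV cs s0 hmin (ltn0Sn 0) r.
    have ff' : f \in fs ++ fan v true h s by rewrite mem_cat ff orbT.
    exists f => //; have E := std_uniq (stdl f m' ff' sub) sm r' (conj erefl erefl).
    by rewrite /supp (eq_in_filter (a2 := fun p => (0 < m' p)%N)) // => p pV; rewrite E.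
  (* A representation without [v] contradicts the minimality of [m v]. *)
  have := sm.1 _ (rep_ext vV r').1 (rep_ext vV r').2.
  by rewrite eqxx leqNgt mv.
- move=> t; rewrite /pick_facet find_cat.
  have [hs|hs] := boolP (has (fun f : facet => subs t f.1) fs).
    by rewrite nth_cat -has_find hs; apply: (tri_first triV).
  rewrite nth_cat ltnNge leq_addr /= addKn; apply: fan_first => // f ff sub.
  have [b [c [fE bc _]]] := fanP hV cs ff.
  have [g gf /andP[bg cg]] := edge_in_old bc.
  apply: contraNT hs => vt; apply/hasP; exists g => //.
  apply/allP => p pt; have := allP sub p pt; rewrite fE !inE.
  by case/or3P=> /eqP pE; rewrite pE // in pt *; rewrite pt in vt.
- rewrite pairwise_cat (tri_shell triV) fan_shell // andbT; apply/andP; split => //.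
  apply/allrelP => f g ff gg; apply: contra (old f ff) => sub.
  have [b [c [_ _ g2]]] := fanP hV cs gg.
  by apply: (allP sub); case: g2 => ->; rewrite mem_head.
- move=> M d z m M0 r.
  have [[f _ [m' r' _]]|[m' r']] := rep_pull hV cs s0 hmin M0 r; first by exists m'.
  by exists (fun p => if p == v then 0%N else m' p); apply: rep_ext.
Qed.
End Step.

(** * The base case: a unimodular triangle *)

Section Triangle.
Variables a b c : pt.
Hypothesis uT : uniq [:: a; b; c].
Hypothesis satT : saturated [:: a; b; c].

(** Seen from [a], [next_exists] yields a point at orientation 1 from [b]. The only candidates are
    [b], at orientation 0, and [c]. *)
Lemma triangle_unimodular : 0 < orient a b c -> orient a b c = 1.
Proof.
move=> abc.
have bab : orient a b b = 0 by rewrite /orient; ring.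
have ext (p : pt) : p \in [:: b; c] -> dot (b.2 - c.2, c.1 - b.1) p < dot (b.2 - c.2, c.1 - b.1) a.
  rewrite !inE -subr_gt0 => /orP[]/eqP->; rewrite /dot /=;
  by rewrite (_ : _ - _ = orient a b c) // /orient; ring.
have bV : b \in [:: b; c] by rewrite mem_head.
have cV : c \in [:: b; c] by rewrite !inE eqxx orbT.
have prim : primitive a b.
  have b0 : (b.1 - a.1, b.2 - a.2) <> (0, 0).
    by case=> b1 b2; move: abc; rewrite /orient b1 b2 !mul0r subrr.
  have [g g0 [e [[e1 e2] [f ef]]]] := orient_primitive b0.
  pose p : pt := (a.1 + e.1, a.2 + e.2).
  have p1 : p.1 - a.1 = e.1 by rewrite /p /=; lia.
  have p2 : p.2 - a.2 = e.2 by rewrite /p /=; lia.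
  have : p \in [:: a; b; c].
    apply: (@sat2 a [:: b; c] b b p g 1 0) => //; rewrite ?p1 ?p2 ?e1 ?e2; ring.
  rewrite !inE; case/or3P=> /eqP pE.
  - by move: p1 p2 ef; rewrite pE !subrr => <- <-; rewrite !mul0r.
  - by exists f; rewrite -pE p1 p2.
  - move: abc; rewrite -pE /orient p1 p2 e1 e2.
    by rewrite (_ : _ - _ = 0) ?ltxx //; ring.
have [q [qV qo _]] := next_exists uT satT ext bV cV prim abc.
by move: qV; rewrite !inE => /orP[]/eqP qE; rewrite qE ?bab in qo.
Qed.
End Triangle.

Lemma lsum_perm V V' m f : perm_eq V V' -> lsum V m f = lsum V' m f.
Proof. by move=> p; rewrite /lsum (perm_big _ p). Qed.

Lemma rep_perm V V' d z m : perm_eq V V' -> rep V d z m -> rep V' d z m.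
Proof. by move=> p /repP[h1 h2 h3]; apply/repP; rewrite -!(lsum_perm _ _ p). Qed.

Lemma saturated_perm V V' : perm_eq V V' -> saturated V -> saturated V'.
Proof.
move=> p sat M z m M0 r; rewrite -(perm_mem p).
by apply: (sat M z m M0); apply: rep_perm r; rewrite perm_sym.
Qed.

Lemma orient_rot a b c : orient b c a = orient a b c.
Proof. by rewrite /orient; ring. Qed.

Lemma triangle_unimodular_abs a b c : uniq [:: a; b; c] -> saturated [:: a; b; c] ->
  orient a b c != 0 -> `|orient a b c| = 1.
Proof.
move=> u sat; case: ltgtP => // s _; last by rewrite gtr0_norm // triangle_unimodular.
have acb : orient a c b = - orient a b c by rewrite /orient; ring.
have p : perm_eq [:: a; b; c] [:: a; c; b].
  by rewrite perm_cons -cat1s perm_catC.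
have := @triangle_unimodular a c b; rewrite -(perm_uniq p) acb ltr0_norm //.
by rewrite oppr_gt0; apply => //; exact: saturated_perm sat.
Qed.

(* Twice the area of [p b c] extended to the pair [(d, z)] standing for [d] points of sum [z]. *)
Definition area (b c : pt) (d : int) (z : pt) : int :=
  d * (b.1 * c.2 - b.2 * c.1) + z.1 * (b.2 - c.2) + z.2 * (c.1 - b.1).

Lemma lsum_area V d z m b c : rep V d z m ->
  lsum V m (fun p => orient p b c) = area b c d%:Z z.
Proof.
move=> r; rewrite (rep_aff (a := b.2 - c.2) (b := c.1 - b.1)
  (c := b.1 * c.2 - b.2 * c.1) r); first by rewrite /area; ring.
by move=> p; rewrite /orient; ring.
Qed.

(** Affinely independent points represent a weight in at most one way, so every multiset is
    standard. The coordinates of a weight are areas up to the sign of the triangle, integers by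
    unimodularity; they are nonnegative as soon as a positive multiple is represented, which gives
    normality. *)
Lemma triangle_triangulation a b c : uniq [:: a; b; c] -> saturated [:: a; b; c] ->
  orient a b c != 0 -> triangulation [:: a; b; c] [:: ([:: a; b; c], [::])].
Proof.
move=> u sat abc; have abs1 := triangle_unimodular_abs u sat abc.
have o1 p q : orient p p q = 0 by rewrite /orient; ring.
have o2 p q : orient p q p = 0 by rewrite /orient; ring.
have la m : lsum [:: a; b; c] m (fun p => orient p b c) = (m a)%:Z * orient a b c.
  by rewrite !lsum_cons /lsum big_nil o1 o2 !mulr0 !addr0.
have lb m : lsum [:: a; b; c] m (fun p => orient p c a) = (m b)%:Z * orient a b c.
  by rewrite !lsum_cons /lsum big_nil o1 o2 orient_rot !mulr0 !addr0 add0r.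
have lc m : lsum [:: a; b; c] m (fun p => orient p a b) = (m c)%:Z * orient a b c.
  by rewrite !lsum_cons /lsum big_nil o1 o2 -orient_rot !mulr0 !addr0 !add0r.
have inj m m' d z : rep [:: a; b; c] d z m -> rep [:: a; b; c] d z m' ->
    [/\ m a = m' a, m b = m' b & m c = m' c].
  move=> r r'.
  have E1 := la m; rewrite (lsum_area b c r) -(lsum_area b c r') la in E1.
  have E2 := lb m; rewrite (lsum_area c a r) -(lsum_area c a r') lb in E2.
  have E3 := lc m; rewrite (lsum_area a b r) -(lsum_area a b r') lc in E3.
  by split; apply/eqP; rewrite -eqz_nat -(inj_eq (mulIf abc)) ?E1 ?E2 ?E3.
have stdT m : std [:: a; b; c] m.
  split => [m' e1 e2|].
    by have [<- _ _] := inj m m' _ _ (conj erefl erefl) (conj e1 e2).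
  split => [m' e1 e2|]; last first.
    by split=> // m' e1 _; move: e1; rewrite /deg !big_seq1 => ->.
  case/andP: (u) => aT _.
  have r1 := rep_ext aT (conj (erefl (deg [:: b; c] m)) (erefl (wt [:: b; c] m))).
  have r2 := rep_ext aT (conj e1 e2).
  have [_ + _] := inj _ _ _ _ r1 r2.
  by move: aT; rewrite !inE negb_or eq_sym => /andP[/negPf-> _] ->.
split => //.
- move=> f; rewrite inE => /eqP->; exists a, b, c; split => //.
  by apply/allP.
- by move=> f; rewrite inE => /eqP->.
- move=> m _; exists ([:: a; b; c], [::]); rewrite ?mem_head //.
  by apply/allP => p; rewrite mem_filter => /andP[].
- by move=> t; rewrite /pick_facet /=; case: ifP.
move=> M d z m M0 r.
have M0' : 0 < M%:Z by [].
have sc p q : area p q (M * d)%:Z (z.1 * M%:Z, z.2 * M%:Z) = M%:Z * area p q d%:Z z.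
  by rewrite PoszM /area /=; ring.
pose s := orient a b c.
have s2 : s * s = 1.
  by move: abs1; rewrite -/s => h; have [->|->] : s = 1 \/ s = -1 by lia.
have nonneg n p q : (n : nat)%:Z * s = M%:Z * area p q d%:Z z -> `|area p q d%:Z z| = area p q d%:Z z * s.
  move=> E; have : 0 <= M%:Z * (area p q d%:Z z * s) by rewrite mulrA -E -mulrA s2 mulr1.
  rewrite pmulr_rge0 // => h; rewrite -[RHS]ger0_norm // normrM (_ : `|s| = 1) ?mulr1 //.
have na := la m; rewrite (lsum_area b c r) sc in na; have {}na := nonneg _ _ _ (esym na).
have nb := lb m; rewrite (lsum_area c a r) sc in nb; have {}nb := nonneg _ _ _ (esym nb).
have nc := lc m; rewrite (lsum_area a b r) sc in nc; have {}nc := nonneg _ _ _ (esym nc).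
exists (addm (addm (single a `|area b c d%:Z z|) (single b `|area c a d%:Z z|))
  (single c `|area a b d%:Z z|)).
apply/repP; rewrite !lsumD !lsum_single ?inE ?eqxx ?orbT // !abszE na nb nc.
split; [transitivity (d%:Z * (s * s)) | transitivity (z.1 * (s * s)) | transitivity (z.2 * (s * s))];
  by [rewrite /s /area /orient; ring | rewrite s2 mulr1].
Qed.

(* [x] is a positive combination of points of [V] spanning the plane. *)
Definition interior_witness (V : seq pt) := exists (x y0 y1 y2 : pt) (M : nat) m,
  [/\ (0 < M)%N, rep V M (x.1 * M%:Z, x.2 * M%:Z) m, orient y0 y1 y2 != 0 &
      [/\ x \in V, y0 \in V, y1 \in V & y2 \in V] /\ [/\ (0 < m y0)%N, (0 < m y1)%N & (0 < m y2)%N]].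

(** For a point of the hull: no supporting line passes through it, the lattice version of being
    interior. *)
Definition unsupported (V : seq pt) (z : pt) := forall a : pt, a <> (0, 0) ->
  exists2 p : pt, p \in V & dot a z < dot a p.

Lemma iw_perm V V' : perm_eq V V' -> interior_witness V -> interior_witness V'.
Proof.
move=> p [x [y0 [y1 [y2 [M [m [M0 r o [h h']]]]]]]].
exists x, y0, y1, y2, M, m; rewrite -!(perm_mem p); split => //.
exact: rep_perm r.
Qed.

(** Meant for [p - v = al (h - v) + be (b - v)] and [c - v = 2 (b - v) - (h - v)]: the weights 1,
    [Z], [C], [E] at [p], [v], [h], [c] then average to [b]. [E] is taken large enough to make [C]
    positive. *)
Lemma interior_weights (al be : int) : 2 <= al + be -> exists C E Z : nat,
  [/\ C%:Z = E%:Z - al, Z%:Z = al + be - 1, (0 < C)%N, (0 < E)%N & (0 < Z)%N].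
Proof.
move=> h; exists (absz (Posz (absz al).+1 - al)%R), (absz al).+1, (absz (al + be - 1)%R).
by split; lia.
Qed.

(** * Interior points and two-element restriction faces *)

Section StepInterior.
Variables (v : pt) (V : seq pt) (l : pt).
Hypothesis uV : uniq (v :: V).
Hypothesis extV : forall p : pt, p \in V -> dot l p < dot l v.
Local Notation o := (orient v).

Let vV : v \notin V. Proof. by case/andP: uV. Qed.

Lemma iw_tail : interior_witness V -> interior_witness (v :: V).
Proof.
case=> [x [y0 [y1 [y2 [M [m [M0 r oy [[xV y0V y1V y2V] [m0 m1 m2]]]]]]]]].
exists x, y0, y1, y2, M, (fun p => if p == v then 0%N else m p).
have ne (p : pt) : p \in V -> (p == v) = false by move=> pV; apply: contraNF vV => /eqP<-.
rewrite !inE !ne // xV y0V y1V y2V; split => //; exact: rep_ext.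
Qed.

Lemma noncollinear_form b c : b \in V -> c \in V -> o b c = 1 -> noncollinear V ->
  (forall r : pt, r \in V -> 1 <= o r c + o b r) ->
  exists2 p : pt, p \in V & 2 <= o p c + o b p.
Proof.
move=> bV cV bc [p [q [r [pV qV rV pqr]]]] L; apply: contrapT => H.
have L1 s : s \in V -> o s c = 1 - o b s.
  move=> sV; have := L s sV; have [|] := leP 2 (o s c + o b s); last by lia.
  by move=> h; case: H; exists s.
have E1 (s : pt) : s \in V -> s.1 = b.1 + o b s * (c.1 - b.1).
  move=> sV; have := cramer1 v b c s; rewrite bc mul1r L1 // => e.
  by rewrite -(subrK v.1 s.1) e; ring.
have E2 (s : pt) : s \in V -> s.2 = b.2 + o b s * (c.2 - b.2).
  move=> sV; have := cramer2 v b c s; rewrite bc mul1r L1 // => e.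
  by rewrite -(subrK v.2 s.2) e; ring.
move: pqr; rewrite /(orient p) (E1 p) // (E2 p) // (E1 q) // (E2 q) // (E1 r) // (E2 r) //.
by move=> /negP; apply; apply/eqP; ring.
Qed.

(** Two consecutive visible edges h b and b c make [b] interior. With [A = o h c] one has
    [A (b - v) = (h - v) + (c - v)]. If [A >= 3], then [b] is an average of [h], [c] and [A - 2]
    copies of [v]. If [A = 2], then [b] is only the midpoint of [h] and [c], and a point [p] of [V]
    beyond the line h b is needed to balance copies of [v]. *)
Lemma fan_interior h s : noncollinear V -> h \in V -> chain v V h s ->
  (exists2 f, f \in fan v true h s & size f.2 = 2%N) -> interior_witness (v :: V).
Proof.
move=> nc hV; case: s => [|b [|c s]] /=; first by move=> _ [].
  by move=> _ [f]; rewrite inE => /eqP->.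
move=> [bV hb L [cV bc L' _]] _.
have c1 := cramer1 v h c b; have c2 := cramer2 v h c b.
have A2 : 2 <= o h c by have := L c cV; rewrite orientC bc; lia.
rewrite bc hb !mul1r in c1 c2.
have hcn : orient v h c != 0 by apply/eqP => h0; rewrite h0 in A2.
have [iv [ih [ib ic]]] : v \in v :: V /\ h \in v :: V /\ b \in v :: V /\ c \in v :: V.
  by rewrite !inE hV bV cV eqxx !orbT.
have [A3|Ale] := leP 3 (o h c).
  case E : (o h c) A3 => [A|] // A3; have A3n : (2 < A)%N by rewrite -lez_nat.
  exists b, v, h, c, A, (addm (addm (single h 1) (single c 1)) (single v (A - 2))); split => //.
  - by lia.
  - apply/repP; rewrite !lsumD !lsum_single //= -subzn; last by lia.
    rewrite E in c1 c2; split; [by lia | |].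
      have -> : b.1 * A%:Z = A%:Z * (b.1 - v.1) + v.1 * A%:Z by ring.
      by rewrite c1; ring.
    have -> : b.2 * A%:Z = A%:Z * (b.2 - v.2) + v.2 * A%:Z by ring.
    by rewrite c2; ring.
  - by split => //; rewrite /addm /single !eqxx; split;
      rewrite !addn_gt0 ?subn_gt0 ?(A3n : (2 < A)%N) ?orbT.
have {A2 Ale} A2 : o h c = 2 by lia.
have [p pV Lp] := noncollinear_form hV bV hb nc L.
have d1 := cramer1 v h b p; have d2 := cramer2 v h b p.
rewrite hb A2 !mul1r in c1 c2 d1 d2.
set al := o p b in d1 d2 Lp; set be := o h p in d1 d2 Lp.
have [C [E [Z [CE ZE C0 E0 Z0]]]] := interior_weights Lp.
have ip : p \in v :: V by rewrite inE pV orbT.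
exists b, v, h, c, (1 + Z + (C + E))%N,
  (addm (addm (single p 1) (single v Z)) (addm (single h C) (single c E))); split => //.
- apply/repP; rewrite !lsumD !lsum_single // !PoszD ZE CE; split; [by ring| |].
    have -> : 1%:Z * p.1 = (p.1 - v.1) + v.1 by ring.
    have -> : E%:Z * c.1 = E%:Z * (2 * (b.1 - v.1) - (h.1 - v.1) + v.1) by rewrite c1; ring.
    by rewrite d1 /=; ring.
  have -> : 1%:Z * p.2 = (p.2 - v.2) + v.2 by ring.
  have -> : E%:Z * c.2 = E%:Z * (2 * (b.2 - v.2) - (h.2 - v.2) + v.2) by rewrite c2; ring.
  by rewrite d2 /=; ring.
- by split => //; rewrite /addm /single !eqxx; split; rewrite !addn_gt0 ?C0 ?E0 ?Z0 ?orbT.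
Qed.

(** With a single visible edge the new point creates no interior point. An unsupported [z] lies
    strictly inside the angle at [v], so [z - v] has positive integer coefficients on [h - v] and
    [c - v]. A form maximal on [V] at [z] but larger at [v] would then be smaller at [z] than at
    [h]. *)
Lemma unsupported_tail h c z : h \in V -> chain v V h [:: c] ->
  (forall r : pt, r \in V -> 0 <= o h r) -> z \in v :: V -> unsupported (v :: V) z ->
  z \in V /\ unsupported V z.
Proof.
move=> hV [cV hc L last] hmin zV un.
have zV' : z \in V.
  move: zV; rewrite inE => /orP[/eqP zv|//].
  have l0 : l <> (0, 0).
    by move=> l0; have := extV hV; rewrite l0 /dot /= !mul0r ltxx.
  have [p] := un l l0; rewrite inE zv => /orP[/eqP->|/extV]; first by rewrite ltxx.
  by move=> h1 h2; have := lt_trans h1 h2; rewrite ltxx.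
split=> // a a0; have [p] := un a a0.
rewrite inE => /orP[/eqP->{p} av|pV ap]; last by exists p.
have tech (b : pt) : b \in V -> (forall r : pt, r \in V -> 0 <= - o b r) \/
    (forall r : pt, r \in V -> 0 <= o b r) -> 0 != o b z.
  move=> bV H; apply/eqP => bz.
  have [s [s1 H']] : exists s : int, s * s = 1 /\ forall r : pt, r \in V -> 0 <= s * o b r.
    case: H => H; [exists (-1)|exists 1]; split => // r /H; by rewrite ?mulN1r ?mul1r.
  have n0 : (s * (b.2 - v.2), - (s * (b.1 - v.1))) <> (0, 0).
    case=> h1 h2; have := extV bV; rewrite /dot.
    have -> : b.2 = v.2.
      by apply/eqP; rewrite -subr_eq0 -[_ - _]mul1r -s1 -mulrA h1 mulr0.
    have -> : b.1 = v.1.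
      apply/eqP; rewrite -subr_eq0 -[_ - _]mul1r -s1 -mulrA.
      by move/eqP: h2; rewrite oppr_eq0 => /eqP->; rewrite mulr0.
    by rewrite ltxx.
  have [p pv] := un _ n0.
  have E (q : pt) : dot (s * (b.2 - v.2), - (s * (b.1 - v.1))) q =
     - (s * o b q) + dot (s * (b.2 - v.2), - (s * (b.1 - v.1))) v.
    by rewrite /dot /orient /=; ring.
  rewrite (E z) (E p) -bz mulr0 oppr0 add0r.
  move: pv; rewrite inE => /orP[/eqP->|/H']; last by lia.
  by rewrite (_ : o b v = 0) ?mulr0 ?oppr0 ?add0r ?ltxx //; rewrite /orient; ring.
have y0 : 0 < o h z by rewrite lt_neqAle hmin // tech //; right.
have x0 : 0 < o z c.
  have := last z zV'; rewrite orientC oppr_le0 => h0; rewrite lt_neqAle h0 andbT.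
  rewrite orientC eq_sym oppr_eq0 eq_sym; apply: tech => //; left => r rV.
  by rewrite oppr_ge0 last.
apply: contrapT => H.
have le (p : pt) : p \in V -> dot a p <= dot a z.
  by move=> pV; rewrite leNgt; apply/negP => ?; apply: H; exists p.
have ah := le h hV; have ac := le c cV.
have c1 := cramer1 v h c z; have c2 := cramer2 v h c z.
rewrite hc !mul1r in c1 c2.
pose A0 := dot a h - dot a v; pose A1 := dot a c - dot a v.
have zE : dot a z - dot a v = o z c * A0 + o h z * A1.
  transitivity (a.1 * (z.1 - v.1) + a.2 * (z.2 - v.2)); first by rewrite /dot; ring.
  by rewrite c1 c2 /A0 /A1 /dot; ring.
have : A0 <= o z c * A0 + o h z * A1 by rewrite -zE /A0; lia.
have : A1 <= o z c * A0 + o h z * A1 by rewrite -zE /A1; lia.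
have : o z c * A0 + o h z * A1 < 0 by rewrite -zE; lia.
clear zE c1 c2; move: A0 A1 (o z c) (o h z) x0 y0 => A0 A1 x y x0 y0 h1 h2 h3.
have : (x - 1) * A0 <= 0 by rewrite mulr_ge0_le0 //; lia.
have : (y - 1) * A1 <= 0 by rewrite mulr_ge0_le0 //; lia.
by rewrite !mulrBl !mul1r; lia.
Qed.
End StepInterior.

(** * Order of removal and existence of the shelling *)

Lemma separating_form (V : seq pt) : exists l : pt, forall p q : pt,
  p \in V -> q \in V -> dot l p = dot l q -> p = q.
Proof.
have [S S0 leS] : exists2 S : int, 0 <= S & forall p : pt, p \in V -> `|p.2| <= S.
  exists (\sum_(p <- V) `|p.2|); first by apply: sumr_ge0.
  move=> p pV; rewrite (perm_big _ (perm_to_rem pV)) big_cons /=.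
  by rewrite lerDl sumr_ge0.
(* The coefficient exceeds every difference of second coordinates, so equal values force equal first
   coordinates. *)
exists (2 * S + 1, 1) => p q /leS pS /leS qS; rewrite /dot /= => E.
have h : (2 * S + 1) * (p.1 - q.1) = q.2 - p.2 by move: E; rewrite mulrBr; lia.
have d : p.1 - q.1 = 0.
  have [|[|//]] : 1 <= p.1 - q.1 \/ p.1 - q.1 <= -1 \/ p.1 - q.1 = 0 by lia.
    by move=> d1; have : 2 * S + 1 <= (2 * S + 1) * (p.1 - q.1); [nia | lia].
  by move=> d1; have : (2 * S + 1) * (p.1 - q.1) <= - (2 * S + 1); [nia | lia].
have e1 : p.1 = q.1 by lia.
move: h; rewrite d mulr0 => h; have e2 : p.2 = q.2 by lia.
by rewrite [p]surjective_pairing [q]surjective_pairing e1 e2.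
Qed.

Lemma seq_max (V : seq pt) (f : pt -> int) : V != [::] ->
  exists2 v, v \in V & forall p, p \in V -> f p <= f v.
Proof.
elim: V => // q W IH _; have [->|W0] := eqVneq W [::].
  by exists q; rewrite ?mem_head // => p; rewrite inE => /eqP->.
have [v vW vmax] := IH W0; have [qv|vq] := leP (f q) (f v).
  exists v; first by rewrite inE vW orbT.
  by move=> p; rewrite inE => /orP[/eqP->|/vmax].
exists q; first exact: mem_head.
move=> p; rewrite inE => /orP[/eqP->//|/vmax h]; exact: le_trans h (ltW vq).
Qed.

Lemma saturated_tail v V l : uniq (v :: V) -> saturated (v :: V) ->
  (forall p : pt, p \in V -> dot l p < dot l v) -> saturated V.
Proof.
case/andP=> vV uV sat ext M z m M0 r.
have : z \in v :: V by apply: (sat M z _ M0 (rep_ext vV r)).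
rewrite inE => /orP[/eqP zv|//].
have E : dot l v * M%:Z = lsum V m (dot l).
  rewrite (rep_aff (a := l.1) (b := l.2) (c := 0) r); first by rewrite zv /dot /=; ring.
  by move=> p; rewrite /dot; ring.
suff : lsum V m (dot l) <= lsum V m (fun=> dot l v - 1).
  rewrite -E (rep_aff (a := 0) (b := 0) (c := dot l v - 1) r); last by move=> p; ring.
  rewrite mulrBl; lia.
by apply: lsum_le => p pV _; have := ext p pV; lia.
Qed.

Lemma collinear_all p q (V : seq pt) : p != q -> (forall r : pt, r \in V -> orient p q r = 0) ->
  ~ noncollinear V.
Proof.
move=> pq col [x [y [z [/col xV /col yV /col zV /negP]]]]; apply.
move: xV yV zV; rewrite /orient => hx hy hz.
have [d1|d2] : q.1 - p.1 != 0 \/ q.2 - p.2 != 0.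
- apply/orP; rewrite -negb_and; apply: contra pq => /andP[/eqP e1 /eqP e2].
  by rewrite [p]surjective_pairing [q]surjective_pairing (subr0_eq e1) (subr0_eq e2).
- apply/eqP/(mulfI d1); rewrite mulr0.
  transitivity ((y.1 - x.1) * (orient p q z - orient p q x) -
    (z.1 - x.1) * (orient p q y - orient p q x)); first by rewrite /orient; ring.
  by rewrite /orient hx hy hz !subrr !mulr0 subrr.
apply/eqP/(mulfI d2); rewrite mulr0.
transitivity ((y.2 - x.2) * (orient p q z - orient p q x) -
  (z.2 - x.2) * (orient p q y - orient p q x)); first by rewrite /orient; ring.
by rewrite /orient hx hy hz !subrr !mulr0 subrr.
Qed.

(** If removing [v] leaves collinear points only, then [v] is off their line, and two of them other
    than [u] still span the plane together with [v]. *)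
Lemma noncollinear_rem (V : seq pt) u v : uniq V -> noncollinear V -> (3 < size V)%N ->
  u \in V -> v \in V -> u != v -> noncollinear (rem u V) \/ noncollinear (rem v V).
Proof.
move=> uV nc s4 uin vin uv; have [|ncv] := pselect (noncollinear (rem v V)); first by right.
left; have col p q r : p \in rem v V -> q \in rem v V -> r \in rem v V -> orient p q r = 0.
  move=> pV qV rV; apply/eqP; apply: contrapT => /negP h; apply: ncv.
  by exists p, q, r.
have uW : u \in rem v V by rewrite mem_rem_uniq // inE uv.
have [p [q [pq pW qW]]] : exists p q : pt, [/\ p != q, p \in rem u (rem v V) & q \in rem u (rem v V)].
  have : (1 < size (rem u (rem v V)))%N by rewrite !size_rem //; case: (size V) s4 => [|[|[|[|k]]]].
  have : uniq (rem u (rem v V)) by rewrite !rem_uniq.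
  case: (rem u _) => [|p [|q W]] //= /andP[pq _] _; exists p, q; rewrite !inE !eqxx ?orbT.
  by split => //; apply: contraNneq pq => ->; rewrite mem_head.
have sub (x : pt) : x \in rem u (rem v V) -> [/\ x \in rem v V, x \in rem u V & x != u].
  rewrite mem_rem_uniq ?rem_uniq // inE => /andP[xu xV]; split => //.
  by rewrite mem_rem_uniq // inE xu (mem_rem xV).
have [pV pU _] := sub p pW; have [qV qU _] := sub q qW.
have vU : v \in rem u V by rewrite mem_rem_uniq // inE eq_sym uv.
exists p, q, v; split => //; apply/eqP => pqv.
apply: (collinear_all pq) nc => r rV; have [->//|rv] := eqVneq r v.
by apply: col => //; rewrite mem_rem_uniq // inE rv.
Qed.

(** Reordering lets the list record the order of insertion. The last two clauses are the halves of
    the interior point criterion in forms suited to induction: a positive combination survives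
    enlarging [V], and [unsupported] descends to the old points when only one edge is visible. *)
Definition shelled (V : seq pt) := exists (V' : seq pt) fs, [/\ perm_eq V' V,
  triangulation V' fs,
  (exists2 f, f \in fs & size f.2 = 2%N) -> interior_witness V' &
  forall z, z \in V' -> unsupported V' z -> exists2 f, f \in fs & size f.2 = 2%N].

Lemma shelled_step v V l : uniq (v :: V) -> saturated (v :: V) -> noncollinear V ->
  (forall p : pt, p \in V -> dot l p < dot l v) -> shelled V -> shelled (v :: V).
Proof.
move=> u sat nc ext [V' [fs [pe tri iw un]]].
have pe' : perm_eq (v :: V') (v :: V) by rewrite perm_cons.
have u' : uniq (v :: V') by rewrite (perm_uniq pe').
have sat' : saturated (v :: V') by apply: saturated_perm sat; rewrite perm_sym.
have ext' (p : pt) : p \in V' -> dot l p < dot l v by rewrite (perm_mem pe); apply: ext.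
have nc' : noncollinear V'.
  by case: nc => p [q [r [? ? ? ?]]]; exists p, q, r; rewrite !(perm_mem pe).
have V0 : V' != [::] by case: nc' => p [q [r []]]; case: (V').
have [h [hV prim hmin]] := first_exists u' sat' ext' V0.
have [s cs] := chain_exists u' sat' ext' hV prim (or_introl hmin).
have s0 : s != [::].
  apply/eqP => s0; rewrite s0 /= in cs; apply: (@collinear_all h v) nc' => [|x xV].
    by apply: contraTneq hV => ->; case/andP: u'.
  have -> : orient h v x = - orient v h x by rewrite /orient; ring.
  by have := cs x xV; have := hmin x xV; lia.
exists (v :: V'), (fs ++ fan v true h s); split => //.
- exact: (fan_triangulation u' ext' tri hV cs s0 hmin).
- case=> f; rewrite mem_cat => /orP[ff f2|ff f2].
    by apply: (iw_tail u'); apply: iw; exists f.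
  by apply: (fan_interior u' nc' hV cs); exists f.
move=> z zV uz; case: s s0 cs => // c [|d s] _ cs.
  have [zV' uz'] := unsupported_tail u' ext' hV cs hmin zV uz.
  by have [f ff f2] := un z zV' uz'; exists f; rewrite ?mem_cat ?ff.
exists ([:: v; c; d], [:: v; d]) => //.
by rewrite mem_cat /= !inE eqxx !orbT.
Qed.

Lemma shelled_triangle a b c : uniq [:: a; b; c] -> saturated [:: a; b; c] ->
  orient a b c != 0 -> shelled [:: a; b; c].
Proof.
move=> u sat abc; exists [:: a; b; c], [:: ([:: a; b; c], [::])]; split => //.
- exact: triangle_triangulation.
- by case=> f; rewrite inE => /eqP->.
have sq : 0 < orient a b c * orient a b c by nia.
(* The form is constant on the edge q r, and the factor [orient a b c] makes it larger at [p] for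
   either orientation of the triangle. *)
have key (p q r : pt) : orient p q r = orient a b c -> ~ exists2 x : pt, x \in [:: p; q; r] &
    dot (orient a b c * (q.2 - r.2), orient a b c * (r.1 - q.1)) p <
    dot (orient a b c * (q.2 - r.2), orient a b c * (r.1 - q.1)) x.
  move=> E [x]; rewrite !inE.
  have Eq : dot (orient a b c * (q.2 - r.2), orient a b c * (r.1 - q.1)) p =
    dot (orient a b c * (q.2 - r.2), orient a b c * (r.1 - q.1)) q + orient a b c * orient p q r.
    by rewrite /dot /orient /=; ring.
  have Er : dot (orient a b c * (q.2 - r.2), orient a b c * (r.1 - q.1)) q =
    dot (orient a b c * (q.2 - r.2), orient a b c * (r.1 - q.1)) r.
    by rewrite /dot /=; ring.
  by rewrite E in Eq; case/or3P=> /eqP->; lia.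
have key0 (p q r : pt) : orient p q r = orient a b c ->
    (orient a b c * (q.2 - r.2), orient a b c * (r.1 - q.1)) <> (0, 0).
  move=> E [h1 h2]; have : orient a b c * orient p q r =
     (orient a b c * (q.2 - r.2)) * (p.1 - q.1) + (orient a b c * (r.1 - q.1)) * (p.2 - q.2).
    by rewrite /orient; ring.
  by rewrite h1 h2 E !mul0r addr0 => h; rewrite h ltxx in sq.
have rot (p q r : pt) : [:: p; q; r] =i [:: a; b; c] -> orient p q r = orient a b c ->
    ~ unsupported [:: a; b; c] p.
  move=> e E un; have [x xV h] := un _ (key0 p q r E).
  by apply: (key p q r E); exists x; rewrite // e.
move=> z zT un; exfalso; move: zT un; rewrite !inE => /or3P[]/eqP->.
- exact: rot.
- apply: (rot b c a) => [x|]; last exact: orient_rot.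
  by rewrite !inE; case: (x == a); case: (x == b); case: (x == c).
- apply: (rot c a b) => [x|]; last by rewrite -orient_rot.
  by rewrite !inE; case: (x == a); case: (x == b); case: (x == c).
Qed.

(** A separating form has a unique maximum and a unique minimum on [V]; one of these two points can
    be removed without making the rest collinear. *)
Lemma shelled_exists V : uniq V -> saturated V -> noncollinear V -> shelled V.
Proof.
have [n] := ubnP (size V); elim: n V => // n IH V sn uV sat nc.
have [s3|s4] := leqP (size V) 3.
  have [p [q [r [pV qV rV pqr]]]] := nc.
  have pq : p != q by apply: contraNneq pqr => ->; rewrite /orient !subrr !mul0r.
  have pr : p != r by apply: contraNneq pqr => ->; rewrite /orient !subrr !mulr0.
  have qr : q != r by apply: contraNneq pqr => ->; rewrite /orient mulrC subrr.
  have u3 : uniq [:: p; q; r] by rewrite /= !inE negb_or pq pr qr.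
  have sub : {subset [:: p; q; r] <= V} by move=> x; rewrite !inE => /or3P[]/eqP->.
  have [s3' e] := uniq_min_size u3 sub s3.
  have pe : perm_eq V [:: p; q; r] by apply: uniq_perm.
  have [V' [fs [pe' h1 h2 h3]]] := shelled_triangle u3 (saturated_perm pe sat) pqr.
  by exists V', fs; split => //; apply: perm_trans pe' _; rewrite perm_sym.
have V0 : V != [::] by case: (V) s4.
have [l linj] := separating_form V.
have [v vV vmax] := seq_max (dot l) V0.
have [u uin umin] := seq_max (fun p => - dot l p) V0.
have main w k : w \in V -> (forall p : pt, p \in V -> p != w -> dot k p < dot k w) ->
    noncollinear (rem w V) -> shelled V.
  move=> wV kext ncw; have pe := perm_to_rem wV.
  have u' : uniq (w :: rem w V) by rewrite -(perm_uniq pe).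
  have sat' := saturated_perm pe sat.
  have ext' (p : pt) : p \in rem w V -> dot k p < dot k w.
    by rewrite mem_rem_uniq // inE => /andP[pw pV]; apply: kext.
  have [|V' [fs [pe' h1 h2 h3]]] := shelled_step u' sat' ncw ext' _.
    apply: IH => //; last exact: saturated_tail ext'.
      by rewrite size_rem //; case: (V) V0 sn.
    by rewrite rem_uniq.
  by exists V', fs; split => //; apply: perm_trans pe' _; rewrite perm_sym.
have uv : u != v.
  have [p pV pv] : exists2 p : pt, p \in V & p != v.
    case: (V) uV s4 => [|a [|b W]] //= /andP[ab _] _.
    have [av|av] := eqVneq a v; last by exists a; rewrite ?mem_head.
    exists b; first by rewrite !inE eqxx orbT.
    by apply: contraNneq ab => ->; rewrite av mem_head.
  apply: contraNneq pv => uv; apply/eqP/linj => //.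
  by apply/eqP; rewrite eq_le vmax // -[dot l v]opprK lerNl -uv umin.
have [ncu|ncv] := noncollinear_rem uV nc s4 uin vV uv.
  apply: (main u (- l.1, - l.2)) => // p pV pu.
  have -> q : dot (- l.1, - l.2) q = - dot l q by rewrite /dot /=; ring.
  have -> q : dot (- l.1, - l.2) q = - dot l q by rewrite /dot /=; ring.
  by rewrite lt_neqAle umin // andbT (inj_eq oppr_inj); apply: contra pu => /eqP/linj->.
apply: (main v l) => // p pV pv.
by rewrite lt_neqAle vmax // andbT; apply: contra pv => /eqP/linj->.
Qed.

(** * Discrete Morse theory on families of sets *)

Section Koszul.
Variables (N : nat) (A : comNzRingType).

Definition sgn (W : {set 'I_N}) (x : 'I_N) : A := (-1) ^+ #|[set y in W | (y < x)%N]|.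

Lemma sgnK W x : sgn W x * sgn W x = 1.
Proof. by rewrite /sgn -expr2 sqrr_sign. Qed.

Lemma sgnU1 (W : {set 'I_N}) (x y : 'I_N) : x \notin W -> sgn (x |: W) y = (-1) ^+ (x < y)%N * sgn W y.
Proof.
move=> xW; rewrite /sgn -exprD; congr (_ ^+ _).
case: (ltnP x y) => xy.
  rewrite (_ : [set z in x |: W | (z < y)%N] = x |: [set z in W | (z < y)%N]).
    by rewrite cardsU1 inE (negPf xW).
  by apply/setP => z; rewrite !inE; case: eqP => [->|].
rewrite add0n; congr #|pred_of_set _|; apply/setP => z; rewrite !inE.
by case: eqP => [->|//]; rewrite ltnNge xy (negPf xW).
Qed.

Lemma sgn_anti (W : {set 'I_N}) (x y : 'I_N) : x \notin W -> y \notin W -> x != y ->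
  sgn (x |: W) y * sgn (y |: W) x = - (sgn W x * sgn W y).
Proof.
move=> xW yW xy; rewrite !sgnU1 // mulrACA -exprD.
have -> : ((x < y) + (y < x))%N = 1%N.
  by move: xy; rewrite -val_eqE /=; case: ltngtP.
by rewrite expr1 mulN1r mulrC.
Qed.

Variables (M : lmodType A) (a : 'I_N -> A).

(** One formula for two differentials: the simplicial boundary when [a] is constantly 1, the Koszul
    differential when [a x] is the variable of index [x]. *)
Definition kos (z : {set 'I_N} -> M) : {set 'I_N} -> M :=
  fun W => \sum_(x | x \notin W) (sgn W x * a x) *: z (x |: W).

(** Splitting along [r] matches each term with its opposite, without dividing by 2. *)
Lemma sum_antisym (I : finType) (B : zmodType) (r : rel I) (P : pred I) (g : I -> I -> B) :
  (forall x y, x != y -> r x y = ~~ r y x) ->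
  (forall x y, P x -> P y -> x != y -> g x y = - g y x) ->
  \sum_(x | P x) \sum_(y | P y && (y != x)) g x y = 0.
Proof.
move=> rP gP.
have -> : \sum_(x | P x) \sum_(y | P y && (y != x)) g x y =
  \sum_(x | P x) \sum_(y | [&& P y, y != x & r x y]) g x y +
  \sum_(x | P x) \sum_(y | [&& P y, y != x & ~~ r x y]) g x y.
  rewrite -big_split; apply: eq_bigr => x _; rewrite (bigID (r x)) /=.
  by congr (_ + _); apply: eq_bigl => y; rewrite -andbA.
rewrite [X in _ + X](exchange_big_dep P) //=; last by move=> x y _ /and3P[].
rewrite -big_split big1 // => x Px /=.
rewrite [X in _ + X](eq_bigl (fun y => [&& P y, y != x & r x y])); last first.
  move=> y; rewrite Px /= eq_sym.
  by case: (eqVneq x y) => [_|xy] /=; [rewrite !andbF | rewrite (rP x y) // negbK andbT].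
rewrite -big_split big1 // => y /and3P[Py yx _] /=.
by rewrite gP ?addNr // eq_sym.
Qed.

Lemma kos_kos z W : kos (kos z) W = 0.
Proof.
rewrite /kos; under eq_bigr do rewrite scaler_sumr.
rewrite (eq_bigr (fun x => \sum_(y | (y \notin W) && (y != x))
   (sgn W x * a x) *: ((sgn (x |: W) y * a y) *: z (y |: (x |: W))))); last first.
  by move=> x _; apply: eq_bigl => y; rewrite in_setU1 negb_or andbC.
apply: (@sum_antisym _ _ (fun x y : 'I_N => (x < y)%N) (fun x => x \notin W)).
  by move=> x y; rewrite -val_eqE /=; case: ltngtP.
move=> x y xW yW xy; rewrite !scalerA setUCA -scaleNr; congr (_ *: _).
have -> : sgn W x * a x * (sgn (x |: W) y * a y) = sgn W x * sgn (x |: W) y * (a x * a y) by ring.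
have -> : sgn W y * a y * (sgn (y |: W) x * a x) = sgn W y * sgn (y |: W) x * (a x * a y) by ring.
rewrite -mulNr; congr (_ * _); rewrite !sgnU1 //.
have : (-1) ^+ (y < x)%N = - (-1) ^+ (x < y)%N :> A.
  by move: xy; rewrite -val_eqE /=; case: ltngtP; rewrite // ?expr0 ?expr1 ?opprK.
move=> ->; ring.
Qed.

Lemma kosD z1 z2 W : kos (fun U => z1 U + z2 U) W = kos z1 W + kos z2 W.
Proof. by rewrite /kos -big_split; apply: eq_bigr => x _; rewrite scalerDr. Qed.

Lemma kosN z W : kos (fun U => - z U) W = - kos z W.
Proof. by rewrite /kos -sumrN; apply: eq_bigr => x _; rewrite scalerN. Qed.

Lemma kosB z1 z2 W : kos (fun U => z1 U - z2 U) W = kos z1 W - kos z2 W.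
Proof. by rewrite kosD kosN. Qed.

Lemma kos0 z W : (forall U, z U = 0) -> kos z W = 0.
Proof. by move=> z0; rewrite /kos big1 // => x _; rewrite z0 scaler0. Qed.

Lemma eq_kos z1 z2 W : z1 =1 z2 -> kos z1 W = kos z2 W.
Proof. by move=> e; apply: eq_bigr => x _; rewrite e. Qed.

End Koszul.

(** * The flow of a discrete Morse matching *)

Section Morse.
Variables (k : fieldType) (N : nat) (X : pred {set 'I_N}).
Variables (kappa : {set 'I_N} -> nat) (tog : {set 'I_N} -> option 'I_N).
Hypothesis X_down : forall W x, X W -> x \in W -> X (W :\ x).
Hypothesis kappa_down : forall W x, X W -> x \in W -> (kappa (W :\ x) <= kappa W)%N.
Hypothesis tog_in : forall W x, X W -> tog W = Some x -> x \in W -> kappa (W :\ x) = kappa W.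
Hypothesis tog_out : forall W x, X W -> tog W = Some x -> x \notin W ->
  X (x |: W) /\ kappa (x |: W) = kappa W.
Hypothesis tog_class : forall W x, X W -> x \in W -> kappa (W :\ x) = kappa W ->
  tog (W :\ x) = tog W.

Local Notation chain := ({set 'I_N} -> k^o).
Local Notation sg := (sgn k).

Definition bd : chain -> chain := kos (M := k^o) (fun=> 1).

Lemma bdE f W : bd f W = \sum_(x | x \notin W) sg W x * f (x |: W).
Proof. by apply: eq_bigr => x _; rewrite mulr1. Qed.

Definition on_cells (p : nat) (f : chain) := forall W, ~~ (X W && (#|W| == p)) -> f W = 0.

(* [tog W = Some x] matches [W] with the set obtained by adding or removing [x];
   cells with [tog W = None] are critical. On a matched cell [flow f] depends only
   on the values of [f] at cells of larger [kappa], so enough iterations of this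
   chain map vanish on matched cells. *)
Definition homotopy (f : chain) : chain := fun W =>
  if X W then if tog W is Some x then if x \in W then sg (W :\ x) x * f (W :\ x) else 0 else 0
  else 0.

Definition flow (f : chain) : chain := fun W => f W - bd (homotopy f) W - homotopy (bd f) W.

Lemma homotopy0 f W : (forall U, f U = 0) -> homotopy f W = 0.
Proof.
move=> f0; rewrite /homotopy; case: ifP => // _; case: (tog W) => // x.
by case: ifP => // _; rewrite f0 mulr0.
Qed.

Lemma X_out W x : X (x |: W) -> X W.
Proof.
have [xW|xW] := boolP (x \in W); first by rewrite (setUidPr _) // sub1set.
by move=> /(X_down (x := x)); rewrite setU11 setU1K // => ->.
Qed.

(** Values at cells of larger [kappa] vanish by assumption. If [tog W = Some x] with [x] outside
    [W], the term of [bd (homotopy f)] at [x |: W] cancels [f W]. If [x] is in [W],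
    [homotopy (bd f)] returns [f W], and the remaining terms cancel in pairs by [sgn_anti]. *)
Lemma flow_val (f : chain) W : X W -> (forall U, ~~ X U -> f U = 0) ->
  (forall U, X U -> #|U| = #|W| -> (kappa W < kappa U)%N -> f U = 0) ->
  flow f W = if tog W is Some _ then 0 else f W.
Proof.
move=> XW f0 fup.
have hup y : y \notin W -> ~~ (X (y |: W) && (kappa (y |: W) == kappa W)) ->
    homotopy f (y |: W) = 0.
  move=> yW; rewrite /homotopy; case: ifP => //= XyW ne.
  case E : (tog _) => [x|//]; case: ifP => // xin.
  rewrite fup ?mulr0 //; first exact: X_down.
    have := cardsD1 x (y |: W); rewrite xin cardsU1 yW !add1n.
    by move/succn_inj.
  rewrite (tog_in XyW E xin) ltn_neqAle eq_sym ne.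
  by have := kappa_down XyW (setU11 y W); rewrite setU1K.
have htog y : y \notin W -> X (y |: W) -> kappa (y |: W) = kappa W -> tog (y |: W) = tog W.
  by move=> yW XyW e; have := tog_class XyW (setU11 y W); rewrite setU1K // => ->.
rewrite /flow bdE; case E : (tog W) => [x|]; last first.
  rewrite big1 ?subr0; first by rewrite /homotopy XW E subr0.
  move=> y yW; have [/andP[XyW /eqP e]|ne] := boolP (X (y |: W) && (kappa (y |: W) == kappa W)).
    by rewrite /homotopy XyW htog // E mulr0.
  by rewrite hup // mulr0.
have [xW|xW] := boolP (x \in W); last first.
  have [XxW kx] := tog_out XW E xW.
  rewrite [X in _ - X]/homotopy XW E (negPf xW) subr0 (bigD1 x) //= big1 ?addr0 => [|y /andP[yW yx]].
    by rewrite /homotopy XxW htog // E setU11 setU1K // mulrA sgnK mul1r subrr.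
  have [/andP[XyW /eqP e]|ne] := boolP (X (y |: W) && (kappa (y |: W) == kappa W)).
    by rewrite /homotopy XyW htog // E in_setU1 (negPf xW) orbF eq_sym (negPf yx) mulr0.
  by rewrite hup // mulr0.
have XW' := X_down XW xW; have kW' := tog_in XW E xW.
have tW' := tog_class XW xW kW'.
have xW' : x \notin W :\ x by rewrite setD11.
have bE : bd f (W :\ x) = sg (W :\ x) x * f W +
    \sum_(y | y \notin W) sg (W :\ x) y * f (y |: W :\ x).
  rewrite bdE (bigD1 x) //= setD1K //; congr (_ + _); apply: eq_bigl => y.
  by rewrite in_setD1 negb_and negbK; case: eqVneq => //= [->|]; rewrite ?xW ?andbT.
rewrite [X in _ - X]/homotopy XW E xW bE mulrDr mulrA sgnK mul1r.
rewrite addrAC opprD addrA subrr add0r -opprD mulr_sumr addrC.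
apply/eqP; rewrite oppr_eq0 -big_split /=; apply/eqP/big1 => y yW.
have yx : y != x by apply: contraNneq yW => ->.
have yW' : y \notin W :\ x by rewrite in_setD1 (negPf yW) andbF.
have eW : (y |: W) :\ x = y |: (W :\ x).
  by apply/setP => z; rewrite !inE; case: (eqVneq z y) => [->|//]; rewrite yx.
have [/andP[XyW /eqP e]|ne] := boolP (X (y |: W) && (kappa (y |: W) == kappa W)).
  rewrite /homotopy XyW htog // E in_setU1 xW orbT eW !mulrA.
  have := sgn_anti k xW' yW'; rewrite setD1K // eq_sym => /(_ yx) ->.
  by rewrite mulNr ?addrN ?addNr.
rewrite hup // mulr0 ?addr0 ?add0r.
have [Xy|/f0->] := boolP (X (y |: W :\ x)); last by rewrite !mulr0.
suff -> : f (y |: W :\ x) = 0 by rewrite !mulr0.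
apply: fup => //; first by rewrite cardsU1 yW' (cardsD1 x W) xW.
have le := kappa_down Xy (setU11 y _); rewrite setU1K // kW' in le.
rewrite ltn_neqAle le andbT; apply: contra ne => /eqP ke.
have te : tog (y |: W :\ x) = Some x.
  by have := tog_class Xy (setU11 y _); rewrite setU1K // kW' tW' E => <-.
have xn : x \notin y |: W :\ x by rewrite in_setU1 negb_or eq_sym yx.
have := tog_out Xy te xn; rewrite setUCA setD1K // -ke => -[-> ->].
by rewrite eqxx.
Qed.

Lemma bd_on p f : on_cells p.+1 f -> on_cells p (bd f).
Proof.
move=> fp W nW; rewrite bdE big1 // => x xW; rewrite fp ?mulr0 //.
rewrite cardsU1 xW eqSS; apply: contra nW => /andP[/X_out-> ->] //.
Qed.

Lemma bd_on0 f : on_cells 0 f -> forall W, bd f W = 0.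
Proof.
by move=> f0 W; rewrite bdE big1 // => x xW; rewrite f0 ?mulr0 // cardsU1 xW andbF.
Qed.

Lemma homotopy_on p f : on_cells p f -> on_cells p.+1 (homotopy f).
Proof.
move=> fp W nW; rewrite /homotopy; case: ifP => // XW; case: (tog W) => // x.
case: ifP => // xW; rewrite fp ?mulr0 //; apply: contra nW => /andP[_ /eqP pE].
by rewrite XW (cardsD1 x W) xW pE add1n eqxx.
Qed.

Lemma on_X p f : on_cells p f -> forall U, ~~ X U -> f U = 0.
Proof. by move=> fp U nU; apply: fp; rewrite (negPf nU). Qed.

Lemma flow_on p f : on_cells p f -> on_cells p (flow f).
Proof.
move=> fp W nW; rewrite /flow fp // (bd_on (homotopy_on fp)) // subr0 sub0r.
apply/eqP; rewrite oppr_eq0; apply/eqP; case: p fp nW => [|p] fp nW.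
  exact: homotopy0 (bd_on0 fp).
exact: (homotopy_on (bd_on fp)).
Qed.

Lemma flow_bd f : bd (flow f) = flow (bd f).
Proof.
apply/funext => W; rewrite /flow /bd.
rewrite (kosB _ (fun U => f U - kos (fun=> 1) (homotopy f) U)) kosB kos_kos subr0.
by rewrite (homotopy0 _ (kos_kos _ _)) subr0.
Qed.

Lemma iter_flow_bd n f : bd (iter n flow f) = iter n flow (bd f).
Proof. by elim: n => //= n IH; rewrite flow_bd IH. Qed.

Lemma iter_flow_on n p f : on_cells p f -> on_cells p (iter n flow f).
Proof. by move=> fp; elim: n => //= n; apply: flow_on. Qed.

Definition kbound := (\max_(W : {set 'I_N}) kappa W).+1.

(** Without critical cells of size [p] each application of [flow] kills one more level of [kappa],
    from the top down. *)
Lemma iter_flow0 p f : (forall W, X W -> #|W| = p -> tog W <> None) -> on_cells p f ->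
  forall W, iter kbound flow f W = 0.
Proof.
move=> nc fp.
suff H n W : (kbound <= kappa W + n)%N -> iter n flow f W = 0.
  by move=> W; apply: H; rewrite leq_addl.
elim: n W => [|n IH] W hn.
  by move: hn; rewrite addn0 /kbound ltnNge (leq_bigmax W).
have [/andP[XW /eqP Wp]|nW] := boolP (X W && (#|W| == p)); last exact: (iter_flow_on _ fp).
rewrite /= flow_val //; last 1 first.
- by move=> U XU UW lt; apply: IH; apply: leq_trans hn _; rewrite addnS -addSn leq_add2r.
- by case: (tog W) (nc W XW Wp).
- exact: on_X (iter_flow_on _ fp).
Qed.

(** On a cycle, [f] and [flow f] differ by the boundary of [homotopy f]. The homotopies of the
    successive iterates add up to a chain bounding [f] minus an iterate that vanishes. *)
Lemma morse_exact p f : (forall W, X W -> #|W| = p -> tog W <> None) -> on_cells p f ->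
  (forall W, bd f W = 0) -> exists2 g, on_cells p.+1 g & forall W, bd g W = f W.
Proof.
move=> nc fp bf.
suff H n : exists2 g, on_cells p.+1 g & forall W, bd g W = f W - iter n flow f W.
  by have [g gp gE] := H kbound; exists g => // W; rewrite gE (iter_flow0 nc fp) subr0.
elim: n => [|n [g gp gE]].
  by exists (fun=> 0) => // W; rewrite /= subrr; apply: kos0.
exists (fun W => g W + homotopy (iter n flow f) W).
  by move=> W nW; rewrite gp // (homotopy_on (iter_flow_on n fp)) // addr0.
move=> W; rewrite /bd kosD -/(bd g) -/(bd (homotopy _)) gE /= /flow.
have bi U : bd (iter n flow f) U = 0.
  have -> : iter n flow f = (fun U => f U - bd g U) by apply/funext => V; rewrite gE subKr.
  by rewrite /bd kosB kos_kos -/(bd f) bf subr0.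
by rewrite (homotopy0 _ bi) subr0; ring.
Qed.

(** The cycle is the iterated flow of the indicator of [W0]. It keeps the value 1 at [W0]; its
    boundary flows to 0 because no critical cell is one size smaller. *)
Lemma morse_nonexact p W0 : X W0 -> #|W0| = p -> tog W0 = None ->
  (forall W, X W -> #|W| = p.+1 \/ #|W|.+1 = p -> tog W <> None) ->
  exists f, [/\ on_cells p f, forall W, bd f W = 0 &
    ~ exists2 g, on_cells p.+1 g & forall W, bd g W = f W].
Proof.
move=> X0 W0p t0 nc; pose d : chain := fun W => (W == W0)%:R.
have dp : on_cells p d.
  by move=> W; rewrite /d; case: (eqVneq W W0) => [->|//]; rewrite X0 W0p eqxx.
have coef (f : chain) n : on_cells p f -> f W0 = 1 ->
    (forall U, X U -> (kappa W0 < kappa U)%N -> f U = 0) ->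
    on_cells p (iter n flow f) /\ iter n flow f W0 = 1 /\
    (forall U, X U -> (kappa W0 < kappa U)%N -> iter n flow f U = 0).
  move=> fp f1 fup; elim: n => //= n [ip [i1 iup]]; split; first exact: flow_on.
  split.
    rewrite flow_val //; first by rewrite t0.
      exact: on_X ip.
    by move=> U XU _; apply: iup.
  move=> U XU lt; rewrite flow_val //.
  - by case: (tog U) => //; rewrite iup.
  - exact: on_X ip.
  - by move=> V XV _ lt'; apply: iup => //; apply: ltn_trans lt'.
have [||fp [f1 fup]] := coef d kbound dp; first by rewrite /d eqxx.
  by move=> U _; rewrite /d; case: eqP => // ->; rewrite ltnn.
exists (iter kbound flow d); split => //.
  move=> W; rewrite iter_flow_bd; case: p W0p nc dp {coef fp f1 fup} => [|p] W0p nc dp.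
    have -> : bd d = (fun=> 0) by apply/funext => U; apply: bd_on0.
    elim: kbound W => //= n IH W.
    rewrite /flow IH sub0r (_ : bd _ W = 0) ?oppr0 ?add0r; last first.
      by apply: kos0 => U; apply: homotopy0.
    by rewrite homotopy0 ?oppr0 // => U; apply: kos0.
  by apply: (@iter_flow0 p); [move=> U XU Up; apply: nc => //; right; rewrite Up | exact: bd_on].
case=> g gp gE.
have E : bd g = iter kbound flow d by apply/funext.
(* Flowing once more keeps the value 1 at [W0], whereas the bounding chain [g] flows to 0, no
   critical cell being one size larger. *)
have [_ [h1 _]] := coef _ kbound fp f1 fup.
have := oner_neq0 k; rewrite -h1 -E -iter_flow_bd => /eqP; apply.
suff b0 : bd (iter kbound flow g) W0 = 0 by exact: b0.
apply: kos0 => U; apply: (@iter_flow0 p.+1) => // V XV Vp.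
by apply: nc => //; left.
Qed.

End Morse.

(** * Cells *)

Section Cells.
Variables (N : nat) (pos : 'I_N -> pt) (V : seq pt) (fs : seq facet).
Hypothesis posI : injective pos.
Hypothesis posV : perm_eq V [seq pos i | i <- enum 'I_N].
Hypothesis triV : triangulation V fs.

Implicit Types (W : {set 'I_N}) (m : pt -> nat) (x i : 'I_N) (p : pt).

Definition cinc (W : {set 'I_N}) : pt -> nat := fun p => [exists i in W, pos i == p].

(* [W] is a cell when the multidegree [(d, z)] minus the sum of [W] is represented by [m]. *)
Definition cell_rep (d : nat) (z : pt) (W : {set 'I_N}) m := rep V d z (addm m (cinc W)).
Definition cell d z W := `[< exists m, cell_rep d z W m >].

Let uV : uniq V.
Proof. by rewrite (perm_uniq posV) map_inj_uniq // enum_uniq. Qed.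

Lemma pos_in i : pos i \in V.
Proof. by rewrite (perm_mem posV) map_f // mem_enum. Qed.

Lemma size_V : size V = N.
Proof. by rewrite (perm_size posV) size_map size_enum_ord. Qed.

Lemma cinc_pos W i : cinc W (pos i) = (i \in W).
Proof.
rewrite /cinc; congr nat_of_bool; apply/existsP/idP => [[j /andP[jW /eqP/posI<-]]//|iW].
by exists i; rewrite iW eqxx.
Qed.

Lemma in_posP p : p \in V -> exists i, p = pos i.
Proof. by rewrite (perm_mem posV) => /mapP[i _ ->]; exists i. Qed.

Lemma cincD1 W x : x \in W -> {in V, cinc W =1 addm (cinc (W :\ x)) (single (pos x) 1)}.
Proof.
move=> xW p /in_posP[i ->]; rewrite /addm /single !cinc_pos in_setD1 (inj_eq posI).
by case: eqVneq => [->|_]; rewrite ?xW ?addn0.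
Qed.

Lemma deg_cinc W : deg V (cinc W) = #|W|.
Proof.
rewrite /deg (perm_big _ posV) big_map big_enum -sum1_card [RHS]big_mkcond /=.
by apply: eq_bigr => i _; rewrite cinc_pos; case: (i \in W).
Qed.

Lemma cell_card d z W m : cell_rep d z W m -> (deg V m + #|W|)%N = d.
Proof. by case=> <- _; rewrite -deg_cinc /deg /addm big_split. Qed.

Lemma cell_repD1 d z W x m : x \in W -> cell_rep d z W m ->
  cell_rep d z (W :\ x) (addm m (single (pos x) 1)).
Proof.
move=> xW; apply: rep_eq => p pV; rewrite /addm (cincD1 xW) // /addm; lia.
Qed.

Lemma cell_repU1 d z W x m : x \notin W -> (0 < m (pos x))%N -> cell_rep d z W m ->
  cell_rep d z (x |: W) (fun p => m p - single (pos x) 1 p)%N.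
Proof.
move=> xW mx; apply: rep_eq => p pV.
rewrite /addm (cincD1 (setU11 x W)) // setU1K // /addm /single.
by case: eqP => [->|_]; lia.
Qed.

Lemma cell_down d z W x : cell d z W -> x \in W -> cell d z (W :\ x).
Proof.
move=> /asboolP[m r] xW; apply/asboolP; exists (addm m (single (pos x) 1)).
exact: cell_repD1.
Qed.

Lemma rep_sub d z m1 m2 m : rep V d z (addm m1 m) -> rep V d z (addm m2 m) ->
  rep V (deg V m1) (wt V m1) m2.
Proof.
move=> /repP[a1 a2 a3] /repP[b1 b2 b3]; rewrite !lsumD in a1 a2 a3 b1 b2 b3.
apply/repP; rewrite degE /wt /=; split.
- by apply: (addIr (lsum V m (fun=> 1))); rewrite /= b1 a1.
- by apply: (addIr (lsum V m fst)); rewrite /= b2 a2.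
- by apply: (addIr (lsum V m snd)); rewrite /= b3 a3.
Qed.

(** * The matching on the cells of one multidegree *)

Section Degree.
Variables (d : nat) (z : pt).

Lemma cell_std_exists W : exists m, cell d z W -> cell_rep d z W m /\ std V m.
Proof.
have [/asboolP[m r]|nW] := boolP (cell d z W); last by exists (fun=> 0%N).
have r0 : rep V (deg V m) (wt V m) m by [].
have [m' r' sm'] := std_exists uV r0; exists m' => _; split=> //.
case/repP: r => r1 r2 r3; case/repP: r' => a1 a2 a3.
rewrite !lsumD in r1 r2 r3.
by apply/repP; rewrite !lsumD a1 a2 a3 -r1 -r2 -r3 degE.
Qed.

Definition cstd W : pt -> nat := projT1 (cid (cell_std_exists W)).

Lemma cstd_rep W : cell d z W -> cell_rep d z W (cstd W).
Proof. by move=> /(projT2 (cid (cell_std_exists W)))[]. Qed.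

Lemma cstd_std W : cell d z W -> std V (cstd W).
Proof. by move=> /(projT2 (cid (cell_std_exists W)))[]. Qed.

Lemma cstd_uniq W m : cell_rep d z W m -> std V m -> {in V, m =1 cstd W}.
Proof.
move=> r sm; have cW : cell d z W by apply/asboolP; exists m.
have r' := cstd_rep cW; apply: (std_uniq sm (cstd_std cW)); first by [].
exact: rep_sub r r'.
Qed.

Definition alpha W := addm (cstd W) (cinc W).
Definition facet_of W := pick_facet fs (supp V (cstd W)).
(** A lexicographic pair written as one number: first the weight of [alpha W], then the reversed
    facet index, which is at most [size fs]. The index is reversed because removing a point of [W]
    moves the facet forward. The base [d.+1] exceeds all multiplicities in degree [d]. *)
Definition kappa W :=
  (wgt d.+1 V (alpha W) * (size fs).+1 + (size fs - facet_of W))%N.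
Definition the_facet W := nth ([::], [::]) fs (facet_of W).
(* A cell is critical for [tog] when [alpha] agrees on its facet with the indicator
   of the restriction face; such a cell is disjoint from the facet. *)
Definition tog W : option 'I_N := [pick x | (pos x \in (the_facet W).1) &&
   ((pos x \in (the_facet W).2) < alpha W (pos x))%N].

Lemma supp_eq m m' : {in V, m =1 m'} -> supp V m = supp V m'.
Proof. by move=> e; apply: eq_in_filter => p pV; rewrite e. Qed.

Lemma facet_of_has W : cell d z W -> has (fun f : facet => subs (supp V (cstd W)) f.1) fs.
Proof. by move=> cW; have [f ff sub] := tri_cover triV (cstd_std cW); apply/hasP; exists f. Qed.

Lemma facet_of_lt W : cell d z W -> (facet_of W < size fs)%N.
Proof. by move/facet_of_has; rewrite has_find. Qed.

Lemma the_facet_in W : cell d z W -> the_facet W \in fs.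
Proof. by move=> cW; rewrite mem_nth // facet_of_lt. Qed.

Lemma the_facet_sub W : cell d z W -> subs (supp V (cstd W)) (the_facet W).1.
Proof. by move/facet_of_has/(nth_find ([::], [::])). Qed.

Lemma supp_mono m m' : {in V, forall p, (m p <= m' p)%N} -> {subset supp V m <= supp V m'}.
Proof.
by move=> le p; rewrite !mem_filter => /andP[mp pV]; rewrite pV (leq_trans mp) // le.
Qed.

(* Comparison of a cell with its boundary: either the weight drops, or the
   standard monomials multiply and the facet can only move forward. *)
Lemma cell_compare W x : cell d z W -> x \in W ->
  (wgt d.+1 V (alpha (W :\ x)) < wgt d.+1 V (alpha W))%N \/
  [/\ {in V, cstd (W :\ x) =1 addm (cstd W) (single (pos x) 1)},
     {in V, alpha (W :\ x) =1 alpha W} & (facet_of W <= facet_of (W :\ x))%N].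
Proof.
move=> cW xW; have cD := cell_down cW xW.
have r1 := cell_repD1 xW (cstd_rep cW); have r2 := cstd_rep cD.
have lt : (deg V (cstd (W :\ x)) < d.+1)%N.
  by rewrite ltnS -(cell_card r2) leq_addr.
have aE : {in V, alpha W =1 addm (addm (cstd W) (single (pos x) 1)) (cinc (W :\ x))}.
  by move=> p pV; rewrite /alpha /addm (cincD1 xW) // /addm; lia.
have [w|e] := wgt_std lt (cstd_std cD) (conj erefl erefl) (rep_sub r2 r1).
  left; rewrite (wgt_eq _ aE) !wgtD ltn_add2r; apply: leq_trans w _.
  by rewrite wgtD.
right; split => //.
  by move=> p pV; rewrite aE // /alpha {1}/addm e.
rewrite /facet_of /pick_facet; apply: sub_find => f /allP sub; apply/allP => p ps.
by apply: sub; apply: supp_mono ps => q qV; rewrite e // /addm leq_addr.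
Qed.

Lemma kappa_down W x : cell d z W -> x \in W -> (kappa (W :\ x) <= kappa W)%N.
Proof.
move=> cW xW; rewrite /kappa; have [lt|[_ e le]] := cell_compare cW xW.
  apply: leq_trans (leq_addr _ _); apply: leq_trans (leq_mul lt (leqnn _)).
  by rewrite mulSn addnC leq_add2r; apply: leq_trans (leq_subr _ _) _.
by rewrite (wgt_eq _ e) leq_add2l leq_sub2l.
Qed.

Lemma kappa_same W x : cell d z W -> x \in W -> kappa (W :\ x) = kappa W ->
  {in V, alpha (W :\ x) =1 alpha W} /\ facet_of (W :\ x) = facet_of W.
Proof.
move=> cW xW; have cD := cell_down cW xW.
rewrite /kappa; have [lt|[_ e le]] := cell_compare cW xW.
  have : ((wgt d.+1 V (alpha (W :\ x))).+1 * (size fs).+1 <=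
     wgt d.+1 V (alpha W) * (size fs).+1)%N by rewrite leq_mul2r lt orbT.
  by rewrite mulSn; have := leq_subr (facet_of (W :\ x)) (size fs); lia.
rewrite (wgt_eq _ e) => /addnI k; split => //.
by have := facet_of_lt cW; have := facet_of_lt cD; move: k; lia.
Qed.

Lemma tog_class W x : cell d z W -> x \in W -> kappa (W :\ x) = kappa W ->
  tog (W :\ x) = tog W.
Proof.
move=> cW xW k; have [e f] := kappa_same cW xW k.
by apply: eq_pick => y; rewrite /the_facet f e ?pos_in.
Qed.

Lemma togP W x : tog W = Some x -> pos x \in (the_facet W).1 /\
  ((pos x \in (the_facet W).2) < alpha W (pos x))%N.
Proof. by rewrite /tog; case: pickP => // y /andP[h1 h2] [<-]. Qed.

(** As [x] belongs to the facet, adding it to the standard complement keeps the support inside that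
    facet, so the sum is again standard and the facet stays the same. *)
Lemma tog_in W x : cell d z W -> tog W = Some x -> x \in W -> kappa (W :\ x) = kappa W.
Proof.
move=> cW /togP[xf _] xW; have cD := cell_down cW xW.
have r1 := cell_repD1 xW (cstd_rep cW).
have sub : subs (supp V (addm (cstd W) (single (pos x) 1))) (the_facet W).1.
  apply/allP => p; rewrite mem_filter /addm /single; case: eqP => [->//|_].
  rewrite addn0 => /andP[mp pV]; apply: (allP (the_facet_sub cW)).
  by rewrite mem_filter mp.
have e := cstd_uniq r1 (tri_std triV (the_facet_in cW) sub).
have [lt|[_ ea le]] := cell_compare cW xW.
  have aE : {in V, alpha W =1 alpha (W :\ x)}.
    move=> p pV; rewrite /alpha /addm -e // (cincD1 xW) // /addm; lia.
  by rewrite (wgt_eq _ aE) ltnn in lt.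
rewrite /kappa (wgt_eq _ ea); congr (_ + (_ - _))%N; apply/eqP; rewrite eqn_leq le andbT.
rewrite leqNgt; apply/negP => /(before_find ([::], [::])).
by rewrite -/(the_facet W) -(supp_eq e) sub.
Qed.

Lemma restr_sub W : cell d z W -> subs (the_facet W).2 (supp V (cstd W)).
Proof. by move=> _; apply: (tri_first triV). Qed.

(** The strict inequality in [tog] keeps the restriction face in the support after [x] has moved
    into the cell. An earlier facet containing this support would contain the restriction face,
    against the shelling. *)
Lemma tog_out W x : cell d z W -> tog W = Some x -> x \notin W ->
  cell d z (x |: W) /\ kappa (x |: W) = kappa W.
Proof.
move=> cW /togP[xf ax] xW.
have mx : ((pos x \in (the_facet W).2) < cstd W (pos x))%N.
  by move: ax; rewrite /alpha /addm cinc_pos (negPf xW) addn0.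
have r1 := cell_repU1 xW (leq_ltn_trans (leq0n _) mx) (cstd_rep cW).
set m := fun p : pt => _ in r1.
have cU : cell d z (x |: W) by apply/asboolP; exists m.
have sub : subs (supp V m) (the_facet W).1.
  apply/allP => p ps; apply: (allP (the_facet_sub cW)).
  by apply: supp_mono ps => q _; rewrite /m leq_subr.
have e := cstd_uniq r1 (tri_std triV (the_facet_in cW) sub).
split => //.
have := cell_compare cU (setU11 x W); rewrite setU1K // => -[lt|[_ ea le]].
  have aE : {in V, alpha (x |: W) =1 alpha W}.
    move=> p pV; rewrite /alpha /addm -e // (cincD1 (setU11 x W)) // setU1K // /addm /m /single.
    by case: eqP => [->|_]; move: mx; lia.
  by rewrite (wgt_eq _ aE) ltnn in lt.
rewrite /kappa (wgt_eq _ ea); congr (_ + (_ - _))%N; apply/eqP; rewrite eqn_leq le /=.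
have subU := the_facet_sub cU; rewrite -(supp_eq e) in subU.
have : subs (the_facet W).2 (the_facet (x |: W)).1.
  apply/allP => p pR; apply: (allP subU).
  have : p \in supp V (cstd W) := allP (restr_sub cW) p pR.
  rewrite !mem_filter => /andP[mp pV]; rewrite pV andbT /m /single.
  by case: eqP mp => [px|_]; [move: mx; rewrite -px pR; lia | rewrite subn0].
apply: contraTT; rewrite -ltnNge => lt.
have := tri_shell triV; move/(pairwiseP ([::], [::])); apply => //.
- exact: facet_of_lt.
- exact: facet_of_lt.
Qed.

Lemma critical_card W : cell d z W -> tog W = None ->
  [/\ (#|W| <= N - 3)%N, d = (#|W| + size (the_facet W).2)%N & the_facet W \in fs].
Proof.
move=> cW tN; have ff := the_facet_in cW; have sub := the_facet_sub cW.
have [a [b [c [fE abc sV]]]] := tri_facet triV ff.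
have [uR Rf R2] := tri_restr triV ff.
have no x : pos x \in (the_facet W).1 ->
    (alpha W (pos x) <= (pos x \in (the_facet W).2))%N.
  move=> xf; rewrite leqNgt; apply/negP => h; move: tN; rewrite /tog.
  by case: pickP => // /(_ x); rewrite xf h.
(* On the facet, criticality bounds [cstd W] above by the indicator of the restriction face and
   [tri_first] bounds it below; off the facet both vanish. *)
have mE : {in V, cstd W =1 fun p => (p \in (the_facet W).2)}.
  move=> p pV; have [i pi] := in_posP pV; have [pf|pf] := boolP (p \in (the_facet W).1).
    apply/eqP; rewrite eqn_leq; apply/andP; split.
      apply: leq_trans (leq_addr (cinc W p) _) _.
      by rewrite pi; apply: no; rewrite -pi.
    have [pR|//] := boolP (p \in (the_facet W).2).
    have : p \in supp V (cstd W) := allP (restr_sub cW) p pR.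
    by rewrite mem_filter => /andP[].
  have -> : (p \in (the_facet W).2) = false.
    by apply: contraNF pf => /(allP Rf).
  apply/eqP; rewrite -leqn0 leqNgt; apply: contra pf => mp.
  by apply: (allP sub); rewrite mem_filter mp.
have disj i : pos i \in (the_facet W).1 -> i \notin W.
  move=> xf; have := no i xf; rewrite /alpha /addm mE ?pos_in // cinc_pos.
  by case: (i \in W) => //; rewrite addn1 ltnn.
split => //.
  have u3 : uniq (the_facet W).1.
    have o1 p q : orient p p q = 0 by rewrite /orient; ring.
    have o2 p q : orient p q p = 0 by rewrite /orient; ring.
    have o3 p q : orient p q q = 0 by rewrite /orient; ring.
    rewrite fE /= !inE negb_or !andbT; move: abc.
    case: eqP => [->|_]; first by rewrite o1.
    case: eqP => [->|_]; first by rewrite o2.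
    by case: eqP => [->|_]; rewrite ?o3.
  have : uniq ((the_facet W).1 ++ [seq pos i | i <- enum W]).
    rewrite cat_uniq u3 map_inj_uniq // enum_uniq andbT /=.
    by apply/hasPn => p /mapP[i]; rewrite mem_enum => iW ->; apply: contraL iW; apply: disj.
  move/uniq_leq_size => /(_ V); rewrite size_cat size_map -cardE.
  rewrite (_ : size _.1 = 3%N) ?size_V; last by rewrite fE.
  have sub' : {subset (the_facet W).1 ++ [seq pos i | i <- enum W] <= V}.
    move=> p; rewrite mem_cat => /orP[|/mapP[i _ ->]]; last exact: pos_in.
    by move/(allP sV).
  move=> /(_ sub') le; rewrite leq_subRL //; exact: leq_trans (leq_addr _ _) le.
rewrite -(cell_card (cstd_rep cW)) addnC; congr (_ + _)%N.
rewrite (deg_eq mE) /deg -big_mkcond /= sum1_count -size_filter.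
apply/perm_size/uniq_perm => //; first by rewrite filter_uniq.
move=> p; rewrite mem_filter andb_idr // => /(allP Rf).
by move/(allP sV).
Qed.

(** If the facet of [W] came before [f], it would contain the restriction face of [f], against the
    shelling. On [f] itself [alpha W] is the indicator of that face, so nothing can be toggled. *)
Lemma critical_facet f W : f \in fs -> W = [set i | pos i \notin f.1] ->
  cell_rep d z W (fun p => (p \in f.2)) -> tog W = None.
Proof.
move=> ff WE r; have cW : cell d z W by apply/asboolP; exists (fun p => (p \in f.2)).
have [_ Rf _] := tri_restr triV ff.
have sub : subs (supp V (fun p => (p \in f.2))) f.1.
  by apply/allP => p; rewrite mem_filter; case: (boolP (p \in f.2)) => // /(allP Rf).
have e := cstd_uniq r (tri_std triV ff sub).
have fE : the_facet W = f.
  have lt : (index f fs < size fs)%N by rewrite index_mem.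
  have le : (facet_of W <= index f fs)%N.
    rewrite leqNgt; apply/negP => /(before_find ([::], [::])).
    by rewrite nth_index // -(supp_eq e) sub.
  rewrite /the_facet; move: le; rewrite leq_eqVlt => /orP[/eqP->|lt']; first by rewrite nth_index.
  have := tri_shell triV; move/(pairwiseP ([::], [::])) => /(_ _ _ (facet_of_lt cW) lt lt').
  rewrite nth_index // => /negP; case; apply/allP => p pR.
  apply: (allP (the_facet_sub cW)); rewrite -(supp_eq e) mem_filter pR.
  have [a [b [c [_ _ sV]]]] := tri_facet triV ff.
  by apply: (allP sV); apply: (allP Rf).
rewrite /tog; case: pickP => // x /andP[]; rewrite fE => xf.
by rewrite /alpha /addm -e ?pos_in // cinc_pos WE inE xf addn0 ltnn.
Qed.

End Degree.
End Cells.

(** * Homology of the complexes of cells *)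

Section CellHomology.
Variables (k : fieldType) (N : nat) (pos : 'I_N -> pt) (V : seq pt) (fs : seq facet).
Hypothesis posI : injective pos.
Hypothesis posV : perm_eq V [seq pos i | i <- enum 'I_N].
Hypothesis triV : triangulation V fs.

Definition exact_at (d : nat) (z : pt) (p : nat) := forall f : {set 'I_N} -> k^o,
  on_cells (cell pos V d z) p f -> (forall W, bd f W = 0) ->
  exists2 g, on_cells (cell pos V d z) p.+1 g & forall W, bd g W = f W.

Lemma exact_noncritical d z p :
  (forall W, cell pos V d z W -> #|W| = p -> tog fs posI posV d z W <> None) -> exact_at d z p.
Proof.
move=> nc f; apply: (@morse_exact _ _ _ (kappa fs posI posV d z) (tog fs posI posV d z)) => //.
- by move=> W x; apply: cell_down.
- by move=> W x; apply: kappa_down.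
- by move=> W x; apply: tog_in.
- by move=> W x; apply: tog_out.
- by move=> W x; apply: tog_class.
Qed.

Lemma exact_large_p d z p : (N - 3 < p)%N -> exact_at d z p.
Proof.
move=> pN; apply: exact_noncritical => W cW Wp /(critical_card triV cW)[le _ _].
by move: pN; rewrite ltnNge -Wp le.
Qed.

Lemma exact_large_q d z p : (p + 2 < d)%N -> exact_at d z p.
Proof.
move=> pd; apply: exact_noncritical => W cW Wp /(critical_card triV cW)[_ dE ff].
by have [_ _ le] := tri_restr triV ff; move: pd; rewrite dE Wp ltn_add2l ltnNge le.
Qed.

Lemma exact_row2 p z : (forall f, f \in fs -> size f.2 <> 2%N) -> exact_at (p + 2) z p.
Proof.
move=> ns; apply: exact_noncritical => W cW Wp /(critical_card triV cW)[_ dE ff].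
by case: (ns _ ff); apply/esym; move: dE; rewrite Wp => /addnI.
Qed.

Lemma lsum_cincD1 (W : {set 'I_N}) x f : x \in W ->
  lsum V (cinc pos W) f = lsum V (cinc pos (W :\ x)) f + f (pos x).
Proof.
move=> xW; have uV : uniq V by rewrite (perm_uniq posV) map_inj_uniq // enum_uniq.
by rewrite (lsum_eq _ (cincD1 posI posV xW)) lsumD lsum_single ?mul1r // (pos_in posV).
Qed.

(** The bounds on critical cells do not settle this row. A cell whose size is its degree has empty
    complement, so its sum is [z]. Two such cells cannot differ in one point, hence the boundary at
    [W :\ x] sees [f W] alone. *)
Lemma exact_diag z p : (0 < p)%N -> exact_at p z p.
Proof.
move=> p0 f fp bf; suff f0 W : f W = 0.
  by exists (fun=> 0) => // W; rewrite f0 bdE big1 // => x _; apply: mulr0.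
have [/andP[cW /eqP Wp]|/fp//] := boolP (cell pos V p z W && (#|W| == p)).
have [x xW] : exists x, x \in W by apply/set0Pn; rewrite -card_gt0 Wp.
have cellE (U : {set 'I_N}) : cell pos V p z U -> #|U| = p ->
    lsum V (cinc pos U) fst = z.1 /\ lsum V (cinc pos U) snd = z.2.
  move=> /asboolP[m r] Up; have := cell_card posI posV r; rewrite Up => /eqP.
  rewrite -{2}[p]add0n eqn_add2r => /eqP m0.
  have mV : {in V, m =1 fun=> 0%N}.
    by move=> q qV; move: m0; rewrite /deg (big_rem q) //= => /eqP; rewrite addn_eq0 => /andP[/eqP].
  have ms g : lsum V m g = 0.
    by rewrite (lsum_eq _ mV) /lsum big1 // => q _; rewrite mul0r.
  by case/repP: r => _; rewrite !lsumD !ms !add0r.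
have := bf (W :\ x); rewrite bdE (bigD1 x) ?setD11 //= setD1K // big1 ?addr0 => [/eqP|y /andP[yW yx]].
  rewrite mulf_eq0 => /orP[/eqP s0|/eqP//].
  by have := sgnK k (W :\ x) x; rewrite s0 mul0r => /esym/eqP; rewrite oner_eq0.
rewrite fp ?mulr0 //; apply/negP => /andP[cU /eqP Up].
have [u1 u2] := cellE _ cU Up; have [w1 w2] := cellE _ cW Wp.
rewrite (lsum_cincD1 _ xW) in w1; rewrite (lsum_cincD1 _ xW) in w2.
rewrite (lsum_cincD1 _ (setU11 y _)) setU1K // -w1 in u1.
rewrite (lsum_cincD1 _ (setU11 y _)) setU1K // -w2 in u2.
have /posI yxE : pos y = pos x.
  by rewrite [pos y]surjective_pairing [pos x]surjective_pairing (addrI _ u1) (addrI _ u2).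
by rewrite yxE eqxx in yx.
Qed.

(** In positive degree the complement of the empty cell contains a point, whose singleton is a cell
    with the empty cell as boundary up to sign. *)
Lemma exact_p0 d z : (0 < d)%N -> exact_at d z 0.
Proof.
move=> d0 f fp bf.
have [c0|nc0] := boolP (cell pos V d z set0); last first.
  have f0 W : f W = 0.
    by apply: fp; apply: contra nc0 => /andP[cW]; rewrite cards_eq0 => /eqP<-.
  by exists (fun=> 0) => // W; rewrite f0 bdE big1 // => x _; apply: mulr0.
have [x cx] : exists x, cell pos V d z [set x].
  case/asboolP: (c0) => m r; have := cell_card posI posV r; rewrite cards0 addn0 => md.
  have [p pV mp] : exists2 p, p \in V & (0 < m p)%N.
    apply: contrapT => H; move: d0; rewrite -md lt0n => /negP; apply.
    rewrite /deg big_seq big1 // => p pV; apply/eqP; rewrite -leqn0 leqNgt; apply/negP => mp.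
    by apply: H; exists p.
  have [x px] := in_posP posV pV; exists x; apply/asboolP.
  by rewrite -[[set x]]setU0; eexists; apply: (cell_repU1 posI posV _ _ r); rewrite ?inE // -px.
pose g : {set 'I_N} -> k^o := fun W => if W == [set x] then sgn k set0 x * f set0 else 0.
exists g.
  move=> W; apply: contraNeq; rewrite /g; case: (eqVneq W [set x]) => [-> _|_]; last by rewrite eqxx.
  by rewrite cx cards1.
move=> W; rewrite bdE; have [->|W0] := eqVneq W set0.
  rewrite (bigD1 x) ?inE //= big1 ?addr0; first by rewrite setU0 /g eqxx mulrA sgnK mul1r.
  move=> y /andP[_ yx]; rewrite setU0 /g; case: eqP => [/set1_inj yxE|_]; last exact: mulr0.
  by rewrite yxE eqxx in yx.
rewrite big1 => [|y yW]; last first.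
  rewrite /g; case: eqP => [E|_]; last exact: mulr0.
  have : #|y |: W| = 1%N by rewrite E cards1.
  by rewrite cardsU1 yW add1n => -[/eqP]; rewrite cards_eq0 (negPf W0).
by apply/esym/fp; apply: contra W0 => /andP[_]; rewrite cards_eq0.
Qed.

(** In degree N - 1 a critical cell of size N - 2 would be too large, and one of size N - 4 would
    need a restriction face with three points. So the critical cell of size N - 3 has no critical
    neighbour. *)
Lemma nonexact_interior : (exists2 f, f \in fs & size f.2 = 2%N) ->
  exists z, exists f : {set 'I_N} -> k^o, [/\ on_cells (cell pos V (N - 1) z) (N - 3) f,
    forall W, bd f W = 0 &
    ~ exists2 g, on_cells (cell pos V (N - 1) z) (N - 3).+1 g & forall W, bd g W = f W].
Proof.
case=> f ff f2; pose W := [set i | pos i \notin f.1].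
have uV : uniq V by rewrite (perm_uniq posV) map_inj_uniq // enum_uniq.
have [a [b [c [fE abc sV]]]] := tri_facet triV ff.
have [uR Rf _] := tri_restr triV ff.
pose m := addm (fun p => (p \in f.2) : nat) (cinc pos W).
have u3 : uniq f.1.
  have o1 p q : orient p p q = 0 by rewrite /orient; ring.
  have o2 p q : orient p q p = 0 by rewrite /orient; ring.
  have o3 p q : orient p q q = 0 by rewrite /orient; ring.
  rewrite fE /= !inE negb_or !andbT; move: abc.
  case: eqP => [->|_]; first by rewrite o1.
  case: eqP => [->|_]; first by rewrite o2.
  by case: eqP => [->|_]; rewrite ?o3.
have cW : (#|W| = N - 3)%N.
  have -> : W = ~: [set i | pos i \in f.1] by apply/setP => i; rewrite !inE.
  rewrite cardsCs setCK card_ord; congr (_ - _)%N.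
  have <- : size f.1 = 3%N by rewrite fE.
  rewrite cardE -(size_map pos); apply/perm_size/uniq_perm => //.
    by rewrite map_inj_uniq ?enum_uniq.
  move=> p; apply/mapP/idP => [[i]|pf]; first by rewrite mem_enum inE => ? ->.
  have [i pi] := in_posP posV (allP sV _ pf).
  by exists i; rewrite // mem_enum inE -pi.
have N3 : (3 <= N)%N.
  have <- : size f.1 = 3%N by rewrite fE.
  rewrite -(size_V posV); apply: uniq_leq_size => // p.
  exact: (allP sV).
have dm : deg V m = (N - 1)%N.
  rewrite /m /deg big_split /= -/(deg V (cinc pos W)) (deg_cinc posI posV) cW.
  rewrite -big_mkcond /= sum1_count -size_filter (_ : size _ = 2%N); first by lia.
  rewrite -f2; apply/perm_size/uniq_perm; rewrite ?filter_uniq // => p.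
  by rewrite mem_filter andb_idr // => /(allP Rf)/(allP sV).
have r : cell_rep pos V (N - 1) (wt V m) W (fun p => (p \in f.2) : nat) by split.
exists (wt V m).
have tN := critical_facet posI posV triV ff (erefl W) r.
apply: (@morse_nonexact k N _ (kappa fs posI posV (N - 1) (wt V m)) (tog fs posI posV (N - 1) (wt V m))
  _ _ _ _ _ (N - 3) W) => //.
- by move=> U x; apply: cell_down.
- by move=> U x; apply: kappa_down.
- by move=> U x; apply: tog_in.
- by move=> U x; apply: tog_out.
- by move=> U x; apply: tog_class.
- by apply/asboolP; exists (fun p => (p \in f.2) : nat).
move=> U cU Up tU; have [le dE gf] := critical_card triV cU tU.
have [_ _ R2] := tri_restr triV gf; case: Up => Up; first by move: le; rewrite Up ltnn.
suff e (n u s : nat) : (n - 1 = u + s -> u.+1 = n - 3 -> s <= 2 -> ~ 3 <= n)%N.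
  exact: e dE Up R2 N3.
by lia.
Qed.

End CellHomology.

(** * Koszul complexes and Betti numbers *)

From mathcomp Require Import mpoly.

Section Homogeneous.
Variables (k : fieldType) (N : nat).
Local Notation S := {mpoly k[N]}.
Implicit Types (e : int) (f g : S) (m : 'X_{1..N}).

Lemma homogP e f : homogeneous_of_degree e f <-> forall m, (mdeg m)%:Z != e -> f@_m = 0.
Proof.
split=> h m; first by apply: contraNeq => /eqP fm; apply/eqP/h; rewrite mcoeff_msupp; apply/eqP.
by rewrite mcoeff_msupp => fm; apply/eqP; apply: contraNT fm => /h->.
Qed.

Lemma homog0 e : homogeneous_of_degree e (0 : S).
Proof. by apply/homogP => m _; rewrite mcoeff0. Qed.

Lemma homogD e f g : homogeneous_of_degree e f -> homogeneous_of_degree e g ->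
  homogeneous_of_degree e (f + g).
Proof.
by move=> /homogP hf /homogP hg; apply/homogP => m me; rewrite mcoeffD hf // hg // addr0.
Qed.

Lemma homogN e f : homogeneous_of_degree e f -> homogeneous_of_degree e (- f).
Proof. by move=> /homogP hf; apply/homogP => m me; rewrite mcoeffN hf ?oppr0. Qed.

Lemma homog_sum e (J : Type) (r : seq J) (P : pred J) (F : J -> S) :
  (forall j, P j -> homogeneous_of_degree e (F j)) ->
  homogeneous_of_degree e (\sum_(j <- r | P j) F j).
Proof. by move=> h; apply: big_ind => //; [apply: homog0 | apply: homogD]. Qed.

Lemma homogM a b f g : homogeneous_of_degree a f -> homogeneous_of_degree b g ->
  homogeneous_of_degree (a + b) (f * g).
Proof.
move=> /homogP hf /homogP hg; apply/homogP => m me; rewrite mcoeffM big1 // => -[m1 m2] /= /eqP mE.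
have [a1|a1] := eqVneq (mdeg m1)%:Z a; last by rewrite hf ?mul0r.
by rewrite hg ?mulr0 //; apply: contra me => /eqP b1; rewrite mE mdegD PoszD a1 b1.
Qed.

Lemma homogX (i : 'I_N) : homogeneous_of_degree 1 ('X_i : S).
Proof.
apply/homogP => m me; rewrite mcoeffX; move: me.
by case: (eqVneq U_(i)%MM m) => // <-; rewrite mdeg1.
Qed.

Lemma homogC (c : k) : homogeneous_of_degree 0 (c%:MP : S).
Proof.
apply/homogP => m; rewrite mcoeffC.
by case: (eqVneq m 0%MM) => [->|_ _]; [rewrite mdeg0 | rewrite mulr0].
Qed.

Lemma homog_sgn (W : {set 'I_N}) x : homogeneous_of_degree 0 (sgn S W x).
Proof.
have -> : sgn S W x = (((-1) ^+ #|[set y in W | (y < x)%N]|) : k)%:MP.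
  by rewrite /sgn rmorphXn rmorphN1.
exact: homogC.
Qed.

Lemma homog_neg e f : e < 0 -> homogeneous_of_degree e f -> f = 0.
Proof.
move=> e0 /homogP h; apply/mpolyP => m; rewrite mcoeff0; apply: h.
by apply: contraTneq e0 => <-.
Qed.

Definition hproj e f : S := \sum_(m <- msupp f | (mdeg m)%:Z == e) f@_m *: 'X_[m].

Lemma mcoeff_hproj e f m : (hproj e f)@_m = if (mdeg m)%:Z == e then f@_m else 0.
Proof.
rewrite /hproj raddf_sum /= (eq_bigr (fun m' => f@_m' * (m' == m)%:R)); last first.
  by move=> m' _; rewrite mcoeffZ mcoeffX.
have [ms|ms] := boolP (m \in msupp f); last first.
  rewrite big_seq_cond big1 => [|m' /andP[m's _]]; last first.
    by case: (eqVneq m' m) => [E|_]; [rewrite -E m's in ms | rewrite mulr0].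
  by move: ms; rewrite -mcoeff_eq0 => /eqP->; case: ifP.
rewrite big_mkcond (bigD1_seq m) //= big1 => [|m' /negPf->]; last by rewrite mulr0; case: ifP.
by rewrite eqxx mulr1 addr0.
Qed.

Lemma hproj_homog e f : homogeneous_of_degree e (hproj e f).
Proof. by apply/homogP => m /negPf me; rewrite mcoeff_hproj me. Qed.

Lemma hproj_id e f : homogeneous_of_degree e f -> hproj e f = f.
Proof.
move=> /homogP h; apply/mpolyP => m; rewrite mcoeff_hproj.
by case: eqP => // /eqP me; rewrite h.
Qed.

Lemma hprojD e f g : hproj e (f + g) = hproj e f + hproj e g.
Proof.
by apply/mpolyP => m; rewrite !(mcoeffD, mcoeff_hproj); case: ifP; rewrite ?addr0.
Qed.

Lemma hproj0 e : hproj e 0 = 0.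
Proof. by apply/mpolyP => m; rewrite mcoeff_hproj mcoeff0; case: ifP. Qed.

Lemma hprojN e f : hproj e (- f) = - hproj e f.
Proof. by apply/mpolyP => m; rewrite !(mcoeffN, mcoeff_hproj); case: ifP; rewrite ?oppr0. Qed.

Lemma hproj_sum e (J : Type) (r : seq J) (F : J -> S) :
  hproj e (\sum_(j <- r) F j) = \sum_(j <- r) hproj e (F j).
Proof. exact: (big_morph _ (hprojD e) (hproj0 e)). Qed.

Lemma hprojM e a f g : homogeneous_of_degree a f -> hproj e (g * f) = hproj (e - a) g * f.
Proof.
move=> hf; have {1}-> : g = hproj (e - a) g + (g - hproj (e - a) g) by rewrite addrC subrK.
rewrite mulrDl hprojD hproj_id; last first.
  by have := homogM (@hproj_homog (e - a) g) hf; rewrite subrK.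
rewrite -[RHS]addr0; congr (_ + _); apply/mpolyP => m; rewrite mcoeff_hproj mcoeff0.
case: eqP => // me; rewrite mcoeffM big1 // => -[m1 m2] /= /eqP mE.
have [a2|a2] := eqVneq (mdeg m2)%:Z a; last by move/homogP: hf => ->; rewrite ?mulr0.
have e1 : (mdeg m1)%:Z = e - a.
  by rewrite -me; apply: (addIr a); rewrite subrK -[in LHS]a2 -PoszD -mdegD -mE.
by rewrite mcoeffB mcoeff_hproj e1 eqxx subrr mul0r.
Qed.

Lemma const_coefM f g : (f * g)@_0%MM = f@_0%MM * g@_0%MM.
Proof. exact: (mcoeff0_is_multiplicative N k).1. Qed.

Lemma homog_deriv e f i : homogeneous_of_degree e f -> homogeneous_of_degree (e - 1) f^`M(i).
Proof.
move=> /homogP h; apply/homogP => m me; rewrite mcoeff_deriv h ?mul0rn //.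
by apply: contra me; rewrite mdegD mdeg1 PoszD => /eqP<-; rewrite addrK.
Qed.

Lemma euler_formula e f : homogeneous_of_degree e f ->
  \sum_(i < N) 'X_i * f^`M(i) = e%:~R *: f.
Proof.
move=> /homogP h; rewrite [f in RHS]mpolyE scaler_sumr.
rewrite (eq_bigr (fun i => \sum_(m <- msupp f) f@_m *: ((m i)%:R *: 'X_[m]))).
  rewrite exchange_big /= !big_seq; apply: eq_bigr => m ms.
  rewrite -scaler_sumr -scaler_suml [RHS]scalerA [in RHS]mulrC -[RHS]scalerA; congr (_ *: _).
  rewrite -natr_sum -mdegE; congr (_ *: _).
  by have [<-|/h f0] := eqVneq (mdeg m)%:Z e; rewrite ?pmulrn // mcoeff_msupp f0 eqxx in ms *.
move=> i _; rewrite {1}[f]mpolyE raddf_sum mulr_sumr /=; apply: eq_bigr => m _.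
rewrite mderivZ mderivX -!scalerAr; congr (_ *: _).
case: (posnP (m i)) => [->|mi]; first by rewrite !scale0r.
congr (_ *: _); rewrite -mpolyXD addmC submK //.
by apply/mnm_lepP => j; rewrite mnm1E; case: eqP => // <-.
Qed.

End Homogeneous.

(** * Exactness of the Koszul complex of the polynomial ring *)

Section KoszulExact.
Variables (k : fieldType) (N : nat).
Implicit Types W : {set 'I_N}.
Hypothesis hk : [pchar k] =i pred0.
Local Notation S := {mpoly k[N]}.
Local Notation sg := (sgn S).

Definition kosz r (z : {set 'I_N} -> 'rV[S]_r) : {set 'I_N} -> 'rV[S]_r :=
  kos (fun x => 'X_x) z.

Definition degree_card (l : nat) r (z : {set 'I_N} -> 'rV[S]_r) :=
  forall W : {set 'I_N}, #|W| != l -> z W = 0.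

(* The entries of [z] have total degree [q], where the generator [W] has degree
   [#|W|] and the [i]-th basis vector has degree [s i]. *)
Definition total_degree (q : int) r (s : 'I_r -> int) (z : {set 'I_N} -> 'rV[S]_r) :=
  forall (W : {set 'I_N}) i, homogeneous_of_degree (q - #|W|%:Z - s i) (z W 0 i).

Definition koss (f : {set 'I_N} -> S) : {set 'I_N} -> S :=
  fun W => \sum_(x | x \notin W) sg W x * 'X_x * f (x |: W).

Lemma kosz_entry r (z : {set 'I_N} -> 'rV[S]_r) W i :
  kosz z W 0 i = koss (fun U => z U 0 i) W.
Proof. by rewrite /kosz /kos summxE; apply: eq_bigr => x _; rewrite mxE. Qed.

Definition contraction (f : {set 'I_N} -> S) : {set 'I_N} -> S :=
  fun W => \sum_(x | x \in W) sg (W :\ x) x * (f (W :\ x))^`M(x).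

Lemma deriv_sgn W x (y : 'I_N) (f : S) : (sg W x * f)^`M(y) = sg W x * f^`M(y).
Proof.
rewrite /sgn -signr_odd; case: (odd _); rewrite ?expr0 ?expr1 ?mul1r //.
by rewrite !mulN1r mderivN.
Qed.

(** Cartan's formula: [contraction] is the exterior derivative of differential forms, [koss] the
    interior product with the Euler field, and the right side the Lie derivative along it. *)
Lemma kos_contraction f W :
  koss (contraction f) W + contraction (koss f) W =
  \sum_(x < N) 'X_x * (f W)^`M(x) + #|W|%:R * f W.
Proof.
pose g x y := sg W x * sg ((x |: W) :\ y) y * ('X_x * (f (x |: (W :\ y)))^`M(y)).
have E1 : koss (contraction f) W = \sum_(x | x \notin W) 'X_x * (f W)^`M(x) +
    \sum_(x | x \notin W) \sum_(y | y \in W) g x y.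
  rewrite -big_split; apply: eq_bigr => x xW /=.
  rewrite /contraction (bigD1 x) ?setU11 //= setU1K // mulrDr; congr (_ + _).
    by rewrite mulrCA !mulrA sgnK mul1r.
  rewrite mulr_sumr; apply: eq_big => [y|y /andP[yU yx]].
    by rewrite in_setU1; case: (eqVneq y x) => [->|] /=; rewrite ?(negPf xW) ?andbF ?andbT.
  rewrite /g -!mulrA; congr (_ * _); rewrite mulrCA; congr (_ * (_ * _)).
  by congr (f _)^`M(y); apply/setP => u; rewrite !inE; case: (eqVneq u x) => // ->; rewrite eq_sym yx.
have E2 : contraction (koss f) W = \sum_(x | x \in W) ('X_x * (f W)^`M(x) + f W) -
    \sum_(y | y \in W) \sum_(x | x \notin W) g x y.
  rewrite -sumrB; apply: eq_bigr => y yW; rewrite /koss.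
  rewrite (bigD1 y) ?setD11 //= setD1K // mderivD mulrDr; congr (_ + _).
    rewrite -mulrA deriv_sgn mulrA sgnK mul1r mderivM mderivX mnm1E eqxx scale1r.
    rewrite (_ : (U_(y) - U_(y))%MM = 0%MM) ?mpolyX0; last by apply/mnmP => j; rewrite mnmBE subnn mnm0E.
    by rewrite mul1r addrC.
  rewrite raddf_sum mulr_sumr -sumrN /=; apply: eq_big => [x|x /andP[xW xy]].
    by rewrite in_setD1 negb_and negbK; case: (eqVneq x y) => [->|] /=; rewrite ?yW ?andbT.
  rewrite -mulrA deriv_sgn mderivM mderivX mnm1E.
  rewrite (negPf xy) scale0r mul0r add0r.
  have xW' : x \notin W by move: xW; rewrite in_setD1 xy.
  have := sgn_anti S (negbT (setD11 y W)) xW.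
  rewrite setD1K // eq_sym => /(_ xy); rewrite /g.
  have -> : (x |: W) :\ y = x |: W :\ y.
    by apply/setP => u; rewrite !inE; case: (eqVneq u x) => // ->; rewrite xy.
  by move=> ->; rewrite mulNr opprK mulrA.
rewrite E1 E2 [X in _ + (_ - X)]exchange_big /= addrACA subrr addr0 big_split /=.
rewrite sumr_const addrA; congr (_ + _); last by rewrite mulr_natl.
by rewrite addrC [RHS](bigID (fun x => x \in W)).
Qed.

Lemma int_neq0 (c : int) : c != 0 -> c%:~R != 0 :> k.
Proof.
have h n : ((n%:R : k) == 0) = (n == 0%N) by apply: (pcharf0P _).1.
by case: c => n; rewrite ?NegzE ?mulrNz ?oppr_eq0 -pmulrn h.
Qed.

(** By Euler's formula the right side of [kos_contraction] is [c] times [f], and a nonzero [c] is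
    invertible in characteristic 0. For [c = 0] only a constant at [set0] could survive, and the
    hypothesis excludes it. *)
Lemma koss_exact (f : {set 'I_N} -> S) (c : int) :
  (forall W : {set 'I_N}, homogeneous_of_degree (c - #|W|%:Z) (f W)) -> (f set0)@_0%MM = 0 ->
  (forall W, koss f W = 0) ->
  exists g, [/\ forall W : {set 'I_N}, homogeneous_of_degree (c - #|W|%:Z) (g W), forall W, koss g W = f W &
    forall l, (forall W : {set 'I_N}, #|W| != l -> f W = 0) ->
      forall W : {set 'I_N}, #|W| != l.+1 -> g W = 0].
Proof.
move=> hf f0 kf; exists (fun W => (c%:~R^-1 : k)%:MP * contraction f W); split.
- move=> W; rewrite -[X in homogeneous_of_degree X]add0r; apply: homogM; first exact: homogC.
  apply: homog_sum => x xW; rewrite -[X in homogeneous_of_degree X]add0r.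
  apply: homogM; first exact: homog_sgn.
  have := homog_deriv (i := x) (hf (W :\ x)).
  by rewrite (cardsD1 x W) xW PoszD opprD addrA addrAC.
- move=> W; have -> : koss (fun U => (c%:~R^-1 : k)%:MP * contraction f U) W =
    (c%:~R^-1 : k)%:MP * koss (contraction f) W.
    by rewrite /koss mulr_sumr; apply: eq_bigr => x _; rewrite mulrCA.
  have := kos_contraction f W.
  have -> : contraction (koss f) W = 0.
    by rewrite /contraction big1 // => x _; rewrite kf raddf0 mulr0.
  rewrite addr0 (euler_formula (hf W)) => ->.
  have -> : (c - #|W|%:Z)%:~R *: f W + #|W|%:R * f W = (c%:~R : k)%:MP * f W.
    rewrite mulr_natl -scaler_nat -scalerDl mul_mpolyC; congr (_ *: _).
    by rewrite intrB -pmulrn subrK.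
  rewrite mulrA -mpolyCM; have [c0|c0] := eqVneq c 0; last first.
    by rewrite mulVf ?mul1r // int_neq0.
  have -> : f W = 0; last by rewrite mulr0.
  have := hf W; rewrite c0 sub0r; have [->|W0] := eqVneq W set0; last first.
    by apply: homog_neg; rewrite oppr_lt0 ltz_nat card_gt0.
  rewrite cards0 oppr0 => /homogP h; apply/mpolyP => m; rewrite mcoeff0.
  by have [->//|m0] := eqVneq m 0%MM; apply: h; rewrite eqz_nat mdeg_eq0.
move=> l fl W Wl; rewrite /contraction big1 ?mulr0 // => x xW.
rewrite fl ?raddf0 ?mulr0 //; apply: contra Wl => /eqP<-.
by rewrite (cardsD1 x W) xW.
Qed.

Lemma kosz_exact q r (s : 'I_r -> int) l (z : {set 'I_N} -> 'rV[S]_r) :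
  total_degree q s z -> degree_card l z -> (forall i, (z set0 0 i)@_0%MM = 0) ->
  (forall W, kosz z W = 0) ->
  exists y, [/\ total_degree q s y, degree_card l.+1 y & forall W, kosz y W = z W].
Proof.
move=> hz zl z0 kz.
have [i|g gP] := fin_all_exists (P := fun i (g : {set 'I_N} -> S) =>
  [/\ forall W : {set 'I_N}, homogeneous_of_degree (q - s i - #|W|%:Z) (g W), forall W, koss g W = z W 0 i &
    forall W : {set 'I_N}, #|W| != l.+1 -> g W = 0]).
  have [W||W|g [g1 g2 g3]] := @koss_exact (fun W => z W 0 i) (q - s i).
  - by rewrite addrAC; apply: hz.
  - exact: z0.
  - by rewrite -kosz_entry kz mxE.
  by exists g; split => //; apply: g3 => W /zl->; rewrite mxE.
exists (fun W => \row_i g i W); split.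
- by move=> W i; rewrite mxE addrAC; have [h _ _] := gP i; apply: h.
- by move=> W Wl; apply/rowP => i; rewrite !mxE; have [_ _ h] := gP i; apply: h.
move=> W; apply/rowP => i; rewrite kosz_entry; have [_ <- _] := gP i.
by apply: eq_bigr => x _; rewrite mxE.
Qed.

Lemma kosz_mulmx r r' (z : {set 'I_N} -> 'rV[S]_r) (d : 'M[S]_(r, r')) W :
  kosz (fun U => z U *m d) W = kosz z W *m d.
Proof. by rewrite /kosz /kos mulmx_suml; apply: eq_bigr => x _; rewrite scalemxAl. Qed.

Lemma kosz_card l r (z : {set 'I_N} -> 'rV[S]_r) : degree_card l.+1 z -> degree_card l (kosz z).
Proof.
move=> zl W Wl; rewrite /kosz /kos big1 // => x xW; rewrite zl ?scaler0 //.
by rewrite cardsU1 xW eqSS.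
Qed.

Lemma kosz_total q r (s : 'I_r -> int) (z : {set 'I_N} -> 'rV[S]_r) :
  total_degree q s z -> total_degree q s (kosz z).
Proof.
move=> hz W i; rewrite kosz_entry; apply: homog_sum => x xW.
have := homogM (homogM (@homog_sgn k N W x) (@homogX k N x)) (hz (x |: W) i).
by rewrite cardsU1 xW add0r add1n intS; congr homogeneous_of_degree; ring.
Qed.

Lemma total_mulmx q r r' (s : 'I_r -> int) (s' : 'I_r' -> int) (d : 'M[S]_(r, r'))
  (z : {set 'I_N} -> 'rV[S]_r) :
  (forall i j, homogeneous_of_degree (s i - s' j) (d i j)) -> total_degree q s z ->
  total_degree q s' (fun W => z W *m d).
Proof.
move=> hd hz W j; rewrite mxE; apply: homog_sum => i _.
by have := homogM (hz W i) (hd i j); congr homogeneous_of_degree; ring.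
Qed.

End KoszulExact.

(** * Betti numbers from Koszul homology *)

Section Zigzag.
Variables (k : fieldType) (N : nat).
Hypothesis hk : [pchar k] =i pred0.
Local Notation S := {mpoly k[N]}.
Variable I : classical_sets.set S.
Hypothesis I0 : I 0.
Hypothesis ID : forall f g, I f -> I g -> I (f + g).
Hypothesis IM : forall f g : S, I g -> I (f * g).
Hypothesis I_hproj : forall e f, I f -> I (hproj e f).
Implicit Types W : {set 'I_N}.

Lemma IN f : I f -> I (- f).
Proof. by rewrite -mulN1r; apply: IM. Qed.

Lemma I_kosz r (z : {set 'I_N} -> 'rV[S]_r) i W :
  (forall U, I (z U 0 i)) -> I (kosz z W 0 i).
Proof.
by move=> h; rewrite kosz_entry; apply: big_ind => // x _; apply: IM.
Qed.

(* Every cycle of degree [q] of the Koszul complex of [S / I] in homological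
   degree [p] is a boundary. *)
Definition koszul_exact (p : nat) (q : int) := forall z : {set 'I_N} -> 'rV[S]_1,
  degree_card p z -> total_degree q (fun=> 0) z -> (forall W, I (kosz z W 0 0)) ->
  exists2 y : {set 'I_N} -> 'rV[S]_1, degree_card p.+1 y & forall W, I ((z W - kosz y W) 0 0).

Variable F : min_graded_free_resolution I.
Local Notation sh p := (@res_shift _ _ _ F p).
Local Notation d p := (res_diff F p).

(** By exactness of the resolution this says that [kosz z W] lies in the image of [d p]. *)
Definition aug_cycle p : ({set 'I_N} -> 'rV[S]_(res_rank F p)) -> Prop :=
  if p is p'.+1 return ({set 'I_N} -> 'rV[S]_(res_rank F p)) -> Prop then
    fun z => forall W, kosz z W *m d p' = 0
  else fun z => forall W, I ((kosz z W *m res_aug F) 0 0).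

Lemma aug_cycle_lift p (z : {set 'I_N} -> 'rV[S]_(res_rank F p)) W :
  aug_cycle z -> exists w, kosz z W = w *m d p.
Proof.
case: p z => [|p] z /(_ W) h; first exact/res_exact0.
exact/res_exact.
Qed.

Lemma aug_cycle_diff p (z : {set 'I_N} -> 'rV[S]_(res_rank F p)) :
  (forall W, exists w, kosz z W = w *m d p) -> aug_cycle z.
Proof.
case: p z => [|p] z h W; have [w wE] := h W; first by apply/res_exact0; exists w.
by rewrite wE; apply/(res_exact (p := p)); exists w.
Qed.

Lemma diff_const p (v : 'rV[S]_(res_rank F p.+1)) j : ((v *m d p) 0 j)@_0%MM = 0.
Proof.
rewrite mxE raddf_sum big1 // => i _ /=.
by rewrite const_coefM res_minimal mulr0.
Qed.

Lemma aug_total q (z : {set 'I_N} -> 'rV[S]_(res_rank F 0)) :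
  total_degree q (sh 0) z -> total_degree q (fun=> 0) (fun W => z W *m res_aug F).
Proof.
by apply: total_mulmx => i j; rewrite subr0 (ord1 j); apply: res_aug_homog.
Qed.

Lemma degree_card_mulmx l r r' (z : {set 'I_N} -> 'rV[S]_r) (e : 'M[S]_(r, r')) :
  degree_card l z -> degree_card l (fun W => z W *m e).
Proof. by move=> zl W Wl; rewrite zl ?mul0mx. Qed.

Lemma kosz_kosz r (z : {set 'I_N} -> 'rV[S]_r) W : kosz (kosz z) W = 0.
Proof. exact: kos_kos. Qed.

Lemma kosz_sub r (z y : {set 'I_N} -> 'rV[S]_r) W :
  kosz (fun U => z U - y U) W = kosz z W - kosz y W.
Proof. exact: kosB. Qed.

Lemma kosz_add r (z y : {set 'I_N} -> 'rV[S]_r) W :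
  kosz (fun U => z U + y U) W = kosz z W + kosz y W.
Proof. exact: kosD. Qed.

Lemma eq_kosz r (z y : {set 'I_N} -> 'rV[S]_r) W : z =1 y -> kosz z W = kosz y W.
Proof. exact: eq_kos. Qed.

(* A diagram chase in the double complex of the resolution tensored with the
   Koszul complex, whose Koszul direction is exact by [kosz_exact]. *)
Lemma zigzag_up q p l (z : {set 'I_N} -> 'rV[S]_(res_rank F p)) :
  koszul_exact (p + l) q -> degree_card l z -> total_degree q (sh p) z -> aug_cycle z ->
  exists (y : {set 'I_N} -> 'rV[S]_(res_rank F p)) (x : {set 'I_N} -> 'rV[S]_(res_rank F p.+1)),
    forall W, z W = kosz y W + x W *m d p.
Proof.
elim: p l z => [|p IH] l z Kex zl hz cz.
  have [y0 _ y0P] := Kex _ (degree_card_mulmx (res_aug F) zl) (aug_total hz)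
    (fun W => eq_ind_r (fun u : 'rV__ => I (u 0 0)) (cz W) (kosz_mulmx z (res_aug F) W)).
  have lift W : exists v, I ((y0 W - v *m res_aug F) 0 0).
    by have [v hv] := res_aug_surj F (y0 W 0 0); exists v; rewrite !mxE in hv *.
  have [y yP] := choice lift.
  suff H W : exists x, z W - kosz y W = x *m d 0.
    have [x xP] := choice H; exists y, x => W.
    by rewrite -xP addrC subrK.
  apply/res_exact0; rewrite mulmxBl -kosz_mulmx.
  have -> : (z W *m res_aug F - kosz (fun U => y U *m res_aug F) W) =
    (z W *m res_aug F - kosz y0 W) + kosz (fun U => y0 U - y U *m res_aug F) W.
    by rewrite kosz_sub addrA subrK.
  by rewrite mxE; apply: ID; [apply: y0P | apply: I_kosz => U; apply: yP].
have [||||z' [hz' zl' kz']] := @kosz_exact k N hk q _ (sh p) l (fun W => z W *m d p).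
- exact: total_mulmx (@res_diff_homog _ _ _ F p) hz.
- exact: degree_card_mulmx.
- by move=> i; apply: diff_const.
- by move=> W; rewrite kosz_mulmx; apply: cz.
have cz' : aug_cycle z' by apply: aug_cycle_diff => W; exists (z W); rewrite kz'.
have Kex' : koszul_exact (p + l.+1) q by rewrite addnS.
have [y [x zE]] := IH _ z' Kex' zl' hz' cz'.
suff H W : exists w, z W - kosz x W = w *m d p.+1.
  have [w wP] := choice H; exists x, w => W.
  by rewrite -wP addrC subrK.
apply/res_exact; rewrite mulmxBl -kz' (eq_kosz W zE) kosz_add kosz_kosz add0r kosz_mulmx subrr //.
Qed.

Definition no_generator q n := forall i, sh n i <> q.

Lemma homog_const0 (e : int) (f : S) : homogeneous_of_degree e f -> e != 0 -> f@_0%MM = 0.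
Proof. by move=> /homogP h e0; apply: h; rewrite mdeg0 eq_sym. Qed.

(** Lifting through the resolution trades Koszul degree for resolution degree until a vector at
    [set0] in the module of index [l + p] remains. No generator there has degree [q], so its entries
    have no constant term and [kosz_exact] applies. *)
Lemma zigzag_down q l p (z : {set 'I_N} -> 'rV[S]_(res_rank F p)) :
  no_generator q (l + p) -> degree_card l z -> total_degree q (sh p) z -> aug_cycle z ->
  exists (y : {set 'I_N} -> 'rV[S]_(res_rank F p)) (x : {set 'I_N} -> 'rV[S]_(res_rank F p.+1)),
    [/\ degree_card l.+1 y, total_degree q (sh p) y & forall W, z W = kosz y W + x W *m d p].
Proof.
elim: l p z => [|l IH] p z ng zl hz cz.
  have [||y [hy yl ky]] := kosz_exact hk hz zl.
  - move=> i; apply: homog_const0 (hz set0 i) _.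
    by rewrite cards0 subr0 subr_eq0 eq_sym; apply/eqP/ng.
  - move=> W; rewrite /kosz /kos big1 // => x xW; rewrite zl ?scaler0 //.
    by rewrite cardsU1 xW.
  by exists y, (fun=> 0); split => // W; rewrite ky mul0mx addr0.
have [w wP] := choice (fun W => aug_cycle_lift W cz).
(* The lift [w] is arbitrary; taking homogeneous parts, on sets of size [l] only, still lifts
   [kosz z]. *)
pose z' W : 'rV[S]_(res_rank F p.+1) := if #|W| == l then
  \row_i hproj (q - #|W|%:Z - sh p.+1 i) (w W 0 i) else 0.
have z'E W : kosz z W = z' W *m d p.
  rewrite /z'; case: eqP => [Wl|/eqP Wl]; last by rewrite mul0mx (kosz_card zl).
  have hkz : total_degree q (sh p) (kosz z) by apply: kosz_total.
  apply/rowP => j; have hj := hkz W j.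
  rewrite -[LHS](hproj_id hj) wP !mxE hproj_sum; apply: eq_bigr => i _.
  rewrite mxE (hprojM _ _ (@res_diff_homog _ _ _ F p i j)); congr (hproj _ _ * _); ring.
have [||||y [x [yl hy yE]]] := IH p.+1 z'.
- by rewrite addnS.
- by move=> W /negPf Wl; rewrite /z' Wl.
- move=> W i; rewrite /z'; case: ifP => _; rewrite mxE; [exact: hproj_homog | exact: homog0].
- move=> W /=; rewrite -kosz_mulmx.
  by rewrite -(eq_kosz W z'E) kosz_kosz.
have kzy W : kosz (fun U => z U - y U *m d p) W = 0.
  rewrite kosz_sub z'E yE mulmxDl kosz_mulmx addrAC subrr add0r.
  by apply/res_exact; exists (x W).
have hzy : total_degree q (sh p) (fun U => z U - y U *m d p).
  move=> W j; rewrite mxE; apply: homogD; first exact: hz.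
  rewrite mxE; apply: homogN; exact: (total_mulmx (@res_diff_homog _ _ _ F p) hy).
have lzy : degree_card l.+1 (fun U => z U - y U *m d p).
  by move=> W Wl; rewrite zl // yl // mul0mx subr0.
have [|y' [hy' yl' ky']] := kosz_exact hk hzy lzy _ kzy.
  by move=> i; rewrite lzy ?cards0 // mxE mcoeff0.
by exists y', y; split => // W; rewrite ky' subrK.
Qed.

(** A cycle modulo [I] is lifted homogeneously to the free module of index 0, where [zigzag_down]
    splits it into a boundary and an element mapping into [I]. *)
Lemma no_generator_exact p q : no_generator q p -> koszul_exact p q.
Proof.
move=> ng z zl hz cz.
have lift W : exists v, I ((z W - v *m res_aug F) 0 0).
  by have [v hv] := res_aug_surj F (z W 0 0); exists v; rewrite !mxE in hv *.
have [v vP] := choice lift.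
pose z0 W : 'rV[S]_(res_rank F 0) := if #|W| == p then
  \row_i hproj (q - #|W|%:Z - sh 0 i) (v W 0 i) else 0.
have z0P W : I ((z W - z0 W *m res_aug F) 0 0).
  rewrite /z0; case: eqP => [Wp|/eqP Wp]; last by rewrite zl // mul0mx subr0 mxE.
  have := I_hproj (q - #|W|%:Z) (vP W); rewrite !mxE hprojD hprojN hproj_sum.
  rewrite hproj_id; last by have := hz W 0; rewrite subr0.
  congr (I (_ - _)); apply: eq_bigr => i _.
  by rewrite mxE (hprojM _ _ (@res_aug_homog _ _ _ F i)).
have lz0 : degree_card p z0 by move=> W /negPf Wp; rewrite /z0 Wp.
have hz0 : total_degree q (sh 0) z0.
  by move=> W i; rewrite /z0; case: ifP => _; rewrite mxE; [exact: hproj_homog | exact: homog0].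
have cz0 : aug_cycle z0.
  move=> W; rewrite -kosz_mulmx.
  have -> : kosz (fun U => z0 U *m res_aug F) W = kosz z W - kosz (fun U => z U - z0 U *m res_aug F) W.
    by rewrite kosz_sub subKr.
  rewrite mxE; apply: ID; first exact: cz.
  by rewrite mxE; apply: IN; apply: I_kosz.
have [|y [x [yl hy yE]]] := zigzag_down _ lz0 hz0 cz0; first by rewrite addn0.
exists (fun W => y W *m res_aug F); first exact: degree_card_mulmx.
move=> W; rewrite kosz_mulmx.
have -> : z W - kosz y W *m res_aug F = (z W - z0 W *m res_aug F) + x W *m d 0 *m res_aug F.
  by rewrite yE mulmxDl opprD addrA subrK.
rewrite mxE; apply: ID; first exact: z0P.
by apply/res_exact0; exists (x W).
Qed.

(** The basis vector of a generator of degree [q], placed at [set0], would be a Koszul boundary plus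
    an image of the differential. Neither has constant terms, the latter by minimality. *)
Lemma exact_no_generator p q : koszul_exact p q -> no_generator q p.
Proof.
move=> Kex i qi.
pose z W : 'rV[S]_(res_rank F p) := if W == set0 then \row_j (i == j)%:R else 0.
have zl : degree_card 0 z by move=> W; rewrite cards_eq0 /z => /negPf->.
have hz : total_degree q (sh p) z.
  move=> W j; rewrite /z; case: eqP => [->|_]; last by rewrite mxE; apply: homog0.
  rewrite mxE; case: eqP => [<-|_]; last exact: homog0.
  by rewrite qi cards0 subr0 subrr -mpolyC1; apply: homogC.
have kz W : kosz z W = 0.
  by rewrite /kosz /kos big1 // => x xW; rewrite zl ?scaler0 // cardsU1 xW.
have cz : aug_cycle z.
  by apply: aug_cycle_diff => W; exists 0; rewrite kz mul0mx.
rewrite -[p]addn0 in Kex.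
have [y [x zE]] := zigzag_up Kex zl hz cz.
have := congr1 (fun u : 'rV_ _ => (u 0 i)@_0%MM) (zE set0).
rewrite /z eqxx mxE eqxx /= mcoeff1 eqxx mxE mcoeffD diff_const addr0.
rewrite kosz_entry /koss raddf_sum big1 => [|u _]; first by move/eqP; rewrite oner_eq0.
rewrite /= mulrAC const_coefM mcoeffX mnm1_eq0 mulr0 //.
Qed.

Lemma bettiE p q : betti F p q = #|[pred i | sh p i == q]|.
Proof. by apply: eq_card => i; apply: asboolb. Qed.

Lemma betti_eq0 p q : betti F p q = 0%N <-> koszul_exact p q.
Proof.
rewrite bettiE; split=> [/card0_eq b0|/exact_no_generator ng].
  apply: no_generator_exact => i qi; have := b0 i.
  by rewrite !inE qi eqxx.
by apply: eq_card0 => i; rewrite !inE; apply/eqP; apply: ng.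
Qed.

(** All generators have degree 0, so [res_aug] has constant entries, nonzero by minimality. Two
    generators would satisfy a relation with nonzero constant coefficients, against minimality;
    without generators 1 would lie in [I]. *)
Lemma betti00 : ~ I 1 -> (forall q : int, q != 0 -> koszul_exact 0 q) -> betti F 0 0 = 1%N.
Proof.
move=> I1 ex.
have s0 i : sh 0 i = 0.
  by apply: contrapT => /eqP ne; apply: (exact_no_generator (ex _ ne) (erefl (sh 0 i))).
pose c i : k := (res_aug F i 0)@_0%MM.
have cE i : res_aug F i 0 = (c i)%:MP.
  have /homogP h := @res_aug_homog _ _ _ F i; apply/mpolyP => m; rewrite mcoeffC.
  have [->|m0] := eqVneq m 0%MM; first by rewrite mulr1.
  by rewrite mulr0 h // s0 eqz_nat mdeg_eq0.
have dE i : ((delta_mx 0 i : 'rV_(res_rank F 0)) *m res_aug F) 0 0 = res_aug F i 0.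
  rewrite mxE (bigD1 i) //= big1 ?addr0 => [|j /negPf ji]; first by rewrite mxE !eqxx mul1r.
  by rewrite mxE ji andbF mul0r.
have cn0 i : c i != 0.
  apply/eqP => ci.
  have : I (((delta_mx 0 i : 'rV[S]_(res_rank F 0)) *m res_aug F) 0 0) by rewrite dE cE ci mpolyC0.
  move/res_exact0 => [w /(congr1 (fun u : 'rV_ _ => (u 0 i)@_0%MM))].
  by rewrite diff_const mxE !eqxx mcoeff1 eqxx => /eqP; rewrite oner_eq0.
have uniq (i j : 'I_(res_rank F 0)) : i = j.
  have [//|ij] := eqVneq i j; exfalso.
  have : I ((((c j)%:MP *: (delta_mx 0 i : 'rV[S]_(res_rank F 0)) -
      (c i)%:MP *: delta_mx 0 j) *m res_aug F) 0 0).
    rewrite mulmxBl -!scalemxAl mxE [X in X + _]mxE [X in _ + X]mxE [X in _ - X]mxE !dE !cE.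
    by rewrite mulrC subrr.
  move/res_exact0 => [w /(congr1 (fun u : 'rV_ _ => (u 0 i)@_0%MM))].
  rewrite diff_const !mxE !eqxx (negPf ij) mulr0 mulr1 subr0 mcoeffC eqxx mulr1 => /eqP.
  by rewrite (negPf (cn0 j)).
have [v hv] := res_aug_surj F 1.
have [i _|no] := pickP (fun _ : 'I_(res_rank F 0) => true); last first.
  case: I1; move: hv; rewrite mxE big1 ?subr0 // => i _.
  by have := no i.
rewrite bettiE -(card1 i); apply: eq_card => j.
by rewrite !inE s0 (uniq j i) !eqxx.
Qed.

End Zigzag.

(** * Toric ideals *)

Section WeightSums.
Variables (k : fieldType) (N : nat) (pos : 'I_N -> pt).
Local Notation S := {mpoly k[N]}.
Implicit Types (e : int) (w : pt) (f g : S) (m : 'X_{1..N}).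

Definition mw m : pt := \sum_i pos i *+ m i.

Lemma mwD m1 m2 : mw (m1 + m2)%MM = mw m1 + mw m2.
Proof. by rewrite /mw -big_split; apply: eq_bigr => i _; rewrite mnmDE mulrnDr. Qed.

Lemma mw1 i : mw U_(i)%MM = pos i.
Proof.
rewrite /mw (bigD1 i) //= mnm1E eqxx mulr1n big1 ?addr0 // => j ji.
by rewrite mnm1E eq_sym (negPf ji).
Qed.

(* The sum of the coefficients of [f] over the monomials of degree [e] and weight [w]:
   the coefficient of the image of [f] in the semigroup algebra. *)
Definition cs e w f : k :=
  \sum_(m : 'X_{1..N < (absz e).+1} | ((mdeg m)%:Z == e) && (mw m == w)) f@_m.

Lemma csD e w f g : cs e w (f + g) = cs e w f + cs e w g.
Proof. by rewrite /cs -big_split; apply: eq_bigr => m _; rewrite mcoeffD. Qed.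

Lemma csZ e w c f : cs e w (c *: f) = c * cs e w f.
Proof. by rewrite /cs mulr_sumr; apply: eq_bigr => m _; rewrite mcoeffZ. Qed.

Lemma cs0 e w : cs e w 0 = 0.
Proof. by rewrite /cs big1 // => m _; rewrite mcoeff0. Qed.

Lemma csN e w f : cs e w (- f) = - cs e w f.
Proof. by rewrite -scaleN1r csZ mulN1r. Qed.

Lemma cs_sum e w (J : Type) (r : seq J) (P : pred J) (G : J -> S) :
  cs e w (\sum_(j <- r | P j) G j) = \sum_(j <- r | P j) cs e w (G j).
Proof. exact: (big_morph _ (csD e w) (cs0 e w)). Qed.

Lemma cs_X e w m : cs e w 'X_[m] = (((mdeg m)%:Z == e) && (mw m == w))%:R.
Proof.
have [/andP[/eqP em wm]|nm] := boolP (((mdeg m)%:Z == e) && (mw m == w)).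
  have lt : (mdeg m < (absz e).+1)%N by rewrite -em.
  rewrite /cs (bigD1 (BMultinom lt)) /=; last by rewrite em eqxx wm.
  rewrite mcoeffX eqxx big1 ?addr0 // => m' /andP[_ ne]; rewrite mcoeffX.
  by case: eqP => // E; case/eqP: ne; apply/val_inj.
rewrite /cs big1 // => m' P'; rewrite mcoeffX; case: eqP => // E.
by move: nm; rewrite E P'.
Qed.

Lemma csE e w f :
  cs e w f = \sum_(m <- msupp f | ((mdeg m)%:Z == e) && (mw m == w)) f@_m.
Proof.
rewrite {1}[f]mpolyE cs_sum [RHS]big_mkcond; apply: eq_bigr => m _.
by rewrite csZ cs_X; case: ifP => _; rewrite ?mulr1 ?mulr0.
Qed.

Lemma csMX e w m f : cs e w ('X_[m] * f) = cs (e - (mdeg m)%:Z) (w - mw m) f.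
Proof.
rewrite {1}[f]mpolyE mulr_sumr cs_sum [RHS]csE [RHS]big_mkcond; apply: eq_bigr => m' _.
rewrite -scalerAr csZ -mpolyXD cs_X mdegD mwD PoszD.
have -> : ((mdeg m)%:Z + (mdeg m')%:Z == e) = ((mdeg m')%:Z == e - (mdeg m)%:Z).
  by rewrite [RHS]eq_sym subr_eq eq_sym addrC.
have -> : (mw m + mw m' == w) = (mw m' == w - mw m).
  by rewrite [RHS]eq_sym subr_eq eq_sym addrC.
by case: ifP => _; rewrite ?mulr1 ?mulr0.
Qed.

Lemma cs_homog e e' w f : homogeneous_of_degree e f -> e' != e -> cs e' w f = 0.
Proof.
move=> /homogP h ne; rewrite /cs big1 // => m /andP[/eqP em _]; apply: h.
by rewrite em.
Qed.

Lemma cs_hproj e e' w f : cs e w (hproj e' f) = if e == e' then cs e w f else 0.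
Proof.
case: eqP => [<-|/eqP ne]; last exact: cs_homog (@hproj_homog _ _ e' f) ne.
by apply: eq_bigr => m /andP[/eqP em _]; rewrite mcoeff_hproj em eqxx.
Qed.

Lemma cs_neq0 e w f : cs e w f != 0 -> exists2 m, (mdeg m)%:Z = e & mw m = w.
Proof.
move=> h; apply: contrapT => H; case/eqP: h; rewrite /cs big1 // => m /andP[/eqP em /eqP wm].
by case: H; exists m.
Qed.

(** The kernel of the map to the semigroup algebra. Described by coefficient sums it splits by
    degree and weight at once, and no binomials have to be listed. *)
Definition binomial_ideal f := forall e w, cs e w f = 0.

Lemma bi0 : binomial_ideal 0. Proof. by move=> e w; apply: cs0. Qed.

Lemma biD f g : binomial_ideal f -> binomial_ideal g -> binomial_ideal (f + g).
Proof. by move=> hf hg e w; rewrite csD hf hg addr0. Qed.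

Lemma biM f g : binomial_ideal g -> binomial_ideal (f * g).
Proof.
move=> hg e w; rewrite [f]mpolyE mulr_suml cs_sum big1 // => m _.
by rewrite -scalerAl csZ csMX hg mulr0.
Qed.

Lemma bi_hproj e f : binomial_ideal f -> binomial_ideal (hproj e f).
Proof. by move=> h e' w; rewrite cs_hproj h; case: ifP. Qed.

Lemma bi_not1 : ~ binomial_ideal 1.
Proof.
move/(_ 0 (mw 0%MM))/eqP; rewrite -mpolyX0 cs_X mdeg0 !eqxx /=.
by rewrite oner_eq0.
Qed.

End WeightSums.

(** * Strands of the Koszul complex of the toric ring *)

Section Bridge.
Variables (k : fieldType) (N : nat) (pos : 'I_N -> pt) (V : seq pt).
Hypothesis posI : injective pos.
Hypothesis posV : perm_eq V [seq pos i | i <- enum 'I_N].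
Local Notation S := {mpoly k[N]}.
Local Notation mw := (mw pos).
Local Notation cs := (cs (k := k) pos).
Implicit Types (W : {set 'I_N}) (w : pt) (m : 'X_{1..N}).

Definition psum W : pt := \sum_(i in W) pos i.

Lemma psumU1 W x : x \notin W -> psum (x |: W) = pos x + psum W.
Proof. by move=> xW; rewrite /psum big_setU1. Qed.

Lemma lsum_pos (m : pt -> nat) g : lsum V m g = \sum_i (m (pos i))%:Z * g (pos i).
Proof. by rewrite /lsum (perm_big _ posV) big_map big_enum. Qed.

Lemma mw_fst m : (mw m).1 = \sum_i (m i)%:Z * (pos i).1.
Proof.
rewrite /mw (raddf_sum fst) /=; apply: eq_bigr => i _.
by rewrite (raddfMn fst) /= -mulr_natl natz.
Qed.

Lemma mw_snd m : (mw m).2 = \sum_i (m i)%:Z * (pos i).2.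
Proof.
rewrite /mw (raddf_sum snd) /=; apply: eq_bigr => i _.
by rewrite (raddfMn snd) /= -mulr_natl natz.
Qed.

Lemma psum_fst W : (psum W).1 = lsum V (cinc pos W) fst.
Proof.
rewrite lsum_pos /psum (raddf_sum fst) /= big_mkcond; apply: eq_bigr => i _.
by rewrite cinc_pos //; case: (i \in W); rewrite ?mul1r ?mul0r.
Qed.

Lemma psum_snd W : (psum W).2 = lsum V (cinc pos W) snd.
Proof.
rewrite lsum_pos /psum (raddf_sum snd) /= big_mkcond; apply: eq_bigr => i _.
by rewrite cinc_pos //; case: (i \in W); rewrite ?mul1r ?mul0r.
Qed.

Lemma cell_mon d w W : cell pos V d w W <->
  exists m, (mdeg m)%:Z = d%:Z - #|W|%:Z /\ mw m = w - psum W.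
Proof.
have uV : uniq V by rewrite (perm_uniq posV) map_inj_uniq // enum_uniq.
have mdegZ m : (mdeg m)%:Z = \sum_i (m i)%:Z * 1.
  by rewrite mdegE -natz natr_sum; apply: eq_bigr => i _; rewrite natz mulr1.
have cW : lsum V (cinc pos W) (fun=> 1) = #|W|%:Z.
  by rewrite -degE (deg_cinc posI posV).
split=> [/asboolP[m /repP]|[m [dm wm]]].
  rewrite !lsumD cW -psum_fst -psum_snd => -[h1 h2 h3].
  exists [multinom m (pos i) | i < N]; split.
    by rewrite mdegZ -h1 addrK lsum_pos; apply: eq_bigr => i _; rewrite mnmE.
  rewrite [LHS]surjective_pairing [RHS]surjective_pairing /= -h2 -h3 !addrK.
  by rewrite mw_fst mw_snd !lsum_pos; congr pair; apply: eq_bigr => i _; rewrite mnmE.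
apply/asboolP; pose mm p := (\sum_(i | pos i == p) m i)%N.
have mmE i : mm (pos i) = m i.
  by rewrite /mm (big_pred1 i) // => j; rewrite /= (inj_eq posI).
exists mm; apply/repP; rewrite !lsumD cW -psum_fst -psum_snd.
have E g : lsum V mm g = \sum_i (m i)%:Z * g (pos i).
  by rewrite lsum_pos; apply: eq_bigr => i _; rewrite mmE.
by rewrite !E -mdegZ -mw_fst -mw_snd dm wm /= !subrK.
Qed.

(* The strand of a Koszul chain in degree [d] and weight [w]; modulo the ideal all
   monomials of the same degree and weight agree, so it is a chain on cells. *)
Definition cell_coefs (d : nat) w (y : {set 'I_N} -> 'rV[S]_1) : {set 'I_N} -> k^o :=
  fun W => cs (d%:Z - #|W|%:Z) (w - psum W) (y W 0 0).

Lemma cs_sgn e w W x (f : S) : cs e w (sgn S W x * f) = sgn k W x * cs e w f.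
Proof.
have -> : sgn S W x = (sgn k W x)%:MP by rewrite /sgn rmorphXn rmorphN1.
by rewrite mul_mpolyC csZ.
Qed.

Lemma cell_coefs_kosz d w y W : cell_coefs d w (kosz y) W = bd (cell_coefs d w y) W.
Proof.
rewrite bdE /cell_coefs kosz_entry cs_sum; apply: eq_bigr => x xW.
rewrite -mulrA cs_sgn csMX mdeg1 mw1 cardsU1 xW psumU1 //=.
congr (_ * cs _ _ _); first by rewrite add1n intS; ring.
by rewrite opprD addrA addrAC.
Qed.

Lemma cell_coefs_on d w p y : degree_card p y -> on_cells (cell pos V d w) p (cell_coefs d w y).
Proof.
move=> yp W; apply: contraNeq => c0; apply/andP; split.
  by apply/cell_mon; have [m dm wm] := cs_neq0 c0; exists m.
by apply: contraNT c0 => Wp; rewrite /cell_coefs yp // mxE cs0.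
Qed.

Lemma cell_mon_exists d w W : exists m, cell pos V d w W ->
  (mdeg m)%:Z = d%:Z - #|W|%:Z /\ mw m = w - psum W.
Proof.
have [c|nc] := boolP (cell pos V d w W); last by exists 0%MM.
by have [m mP] := (cell_mon d w W).1 c; exists m.
Qed.

Definition cmon d w W := projT1 (cid (cell_mon_exists d w W)).

Lemma cmonP d w W : cell pos V d w W ->
  (mdeg (cmon d w W))%:Z = d%:Z - #|W|%:Z /\ mw (cmon d w W) = w - psum W.
Proof. exact: (projT2 (cid (cell_mon_exists d w W))). Qed.

Definition cell_lift d w (f : {set 'I_N} -> k^o) W : S := (f W : k) *: 'X_[cmon d w W].

Lemma cell_lift_homog d w p f W : on_cells (cell pos V d w) p f ->
  homogeneous_of_degree (d%:Z - #|W|%:Z) (cell_lift d w f W).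
Proof.
move=> fp; apply/homogP => m ne; rewrite /cell_lift mcoeffZ mcoeffX.
have [/andP[c _]|/fp->] := boolP (cell pos V d w W && (#|W| == p)); last by rewrite mul0r.
by case: eqP => [E|_]; rewrite ?mulr0 // -E (cmonP c).1 eqxx in ne *.
Qed.

Lemma cs_cell_lift d w w' p f W : on_cells (cell pos V d w) p f ->
  cs (d%:Z - #|W|%:Z) (w' - psum W) (cell_lift d w f W) = if w' == w then f W else 0.
Proof.
move=> fp; rewrite /cell_lift csZ cs_X.
have [/andP[c _]|/fp->] := boolP (cell pos V d w W && (#|W| == p)); last first.
  by rewrite mul0r; case: ifP.
have [-> ->] := cmonP c; rewrite eqxx /= (inj_eq (addIr _)) eq_sym.
by case: ifP; rewrite ?mulr1 ?mulr0.
Qed.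

Lemma degree_part d (y : {set 'I_N} -> 'rV[S]_1) W : total_degree d%:Z (fun=> 0) y ->
  homogeneous_of_degree (d%:Z - #|W|%:Z) (y W 0 0).
Proof. by move=> /(_ W 0); rewrite subr0. Qed.

Lemma binomial_part d (y : {set 'I_N} -> 'rV[S]_1) W : total_degree d%:Z (fun=> 0) y ->
  (forall w, cell_coefs d w y W = 0) -> binomial_ideal pos (y W 0 0).
Proof.
move=> hy cy e w; have [->|ne] := eqVneq e (d%:Z - #|W|%:Z).
  by have := cy (w + psum W); rewrite /cell_coefs addrK.
exact: cs_homog (degree_part hy) ne.
Qed.

Lemma total_degree_sub d (y z : {set 'I_N} -> 'rV[S]_1) : total_degree d%:Z (fun=> 0) y ->
  total_degree d%:Z (fun=> 0) z -> total_degree d%:Z (fun=> 0) (fun W => y W - z W).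
Proof.
by move=> hy hz W i; rewrite !mxE; apply: homogD; [apply: hy | apply: homogN; apply: hz].
Qed.

Lemma cell_coefs_sub d w (y z : {set 'I_N} -> 'rV[S]_1) W :
  cell_coefs d w (fun U => y U - z U) W = cell_coefs d w y W - cell_coefs d w z W.
Proof. by rewrite /cell_coefs !mxE csD csN. Qed.

Lemma exact_koszul d p : (forall w, exact_at k pos V d w p) ->
  koszul_exact (binomial_ideal pos : classical_sets.set S) p d%:Z.
Proof.
move=> ex z zp hz kz.
have cyc w : forall W, bd (cell_coefs d w z) W = 0.
  by move=> W; rewrite -cell_coefs_kosz; apply: kz.
have H w : exists g, on_cells (cell pos V d w) p.+1 g /\ forall W, bd g W = cell_coefs d w z W.
  by have [g g1 g2] := ex w _ (cell_coefs_on zp) (cyc w); exists g.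
have [g gP] := choice H.
(* Only finitely many weights occur in [z]. The chains found in their strands are lifted and added;
   the other strands of [z] are zero. *)
pose om := undup [seq mw m + psum W | W <- enum [set: {set 'I_N}], m <- msupp (z W 0 0)].
pose y W : 'rV[S]_1 := const_mx (\sum_(w <- om) cell_lift d w (g w) W).
have hy : total_degree d%:Z (fun=> 0) y.
  move=> W i; rewrite mxE subr0; apply: homog_sum => w _.
  exact: cell_lift_homog (gP w).1.
have cy w W : cell_coefs d w y W = if w \in om then g w W else 0.
  rewrite /cell_coefs mxE cs_sum (eq_bigr (fun w' => if w == w' then g w' W else 0)); last first.
    by move=> w' _; rewrite (cs_cell_lift _ _ (gP w').1).
  have [wo|wo] := boolP (w \in om).
    rewrite (bigD1_seq w) ?undup_uniq //= eqxx big1 ?addr0 // => w' /negPf ne.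
    by rewrite eq_sym ne.
  by rewrite big_seq big1 // => w' w'o; case: eqP => // E; rewrite E w'o in wo.
have cz w W : w \notin om -> cell_coefs d w z W = 0.
  move=> wo; rewrite /cell_coefs csE big_seq_cond big1 // => m /and3P[ms _ /eqP mE].
  case/negP: wo; rewrite mem_undup; apply/allpairsPdep; exists W, m.
  by rewrite mem_enum inE ms mE subrK.
exists y.
  move=> W Wp; apply/rowP => i; rewrite !mxE big1 // => w _.
  by rewrite /cell_lift (gP w).1 ?scale0r // negb_and Wp orbT.
move=> W; apply: (@binomial_part d (fun U => z U - kosz y U)).
  apply: total_degree_sub => //; exact: kosz_total.
move=> w; rewrite cell_coefs_sub cell_coefs_kosz; have [wo|wo] := boolP (w \in om).
  have -> : cell_coefs d w y = g w by apply/funext => U; rewrite cy wo.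
  by rewrite (gP w).2 subrr.
rewrite cz // (_ : bd _ W = 0) ?subrr //.
by apply: kos0 => U; rewrite cy (negPf wo).
Qed.

(** Giving each cell one monomial of its degree and weight turns [f] into a Koszul chain with [f] as
    its only nonzero strand. A chain bounding it modulo the ideal would bound [f] in that strand. *)
Lemma nonexact_koszul d p w (f : {set 'I_N} -> k^o) : on_cells (cell pos V d w) p f ->
  (forall W, bd f W = 0) ->
  ~ (exists2 g, on_cells (cell pos V d w) p.+1 g & forall W, bd g W = f W) ->
  ~ koszul_exact (binomial_ideal pos : classical_sets.set S) p d%:Z.
Proof.
move=> fp bf nex Kex.
pose z W : 'rV[S]_1 := const_mx (cell_lift d w f W).
have hz : total_degree d%:Z (fun=> 0) z.
  by move=> W i; rewrite mxE subr0; apply: cell_lift_homog fp.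
have zp : degree_card p z.
  by move=> W Wp; apply/rowP => i; rewrite !mxE /cell_lift fp ?scale0r // negb_and Wp orbT.
have cz w' W : cell_coefs d w' z W = if w' == w then f W else 0.
  by rewrite /cell_coefs mxE (cs_cell_lift _ _ fp).
have [|y yp yz] := Kex z zp hz.
  move=> W; apply: (@binomial_part d (kosz z)); first exact: kosz_total.
  move=> w'; rewrite cell_coefs_kosz; have [->|ne] := eqVneq w' w.
    by rewrite -[RHS](bf W); apply: eq_kos => U; rewrite cz eqxx.
  by apply: kos0 => U; rewrite cz (negPf ne).
apply: nex; exists (cell_coefs d w y); first exact: cell_coefs_on.
move=> W; apply/esym/eqP; rewrite -subr_eq0 -cell_coefs_kosz; apply/eqP.
have := yz W (d%:Z - #|W|%:Z) (w - psum W).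
by rewrite -/(cell_coefs d w (fun U => z U - kosz y U) W) cell_coefs_sub cz eqxx.
Qed.

Lemma koszul_exact_neg p (q : int) : q < p%:Z ->
  koszul_exact (binomial_ideal pos : classical_sets.set S) p q.
Proof.
move=> qp z zp hz _; have z0 W : z W = 0.
  have [Wp|/zp//] := eqVneq #|W| p.
  apply/rowP => i; rewrite mxE; apply: homog_neg (hz W i).
  by rewrite subr0 Wp subr_lt0.
exists (fun=> 0) => // W; rewrite z0 sub0r.
have -> : kosz (fun=> 0 : 'rV[S]_1) W = 0 by apply: kos0.
by rewrite oppr0 mxE; apply: bi0.
Qed.

End Bridge.

(** * Laurent polynomials vanishing on the torus *)

Section Laurent.
Variable k : fieldType.
Hypothesis hk : [pchar k] =i pred0.

Lemma nat_char0_inj : injective (fun n : nat => n%:R : k).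
Proof.
have h n : ((n%:R : k) == 0) = (n == 0%N) by apply: (pcharf0P _).1.
have key m n : (m <= n)%N -> m%:R = n%:R :> k -> m = n.
  by move=> le e; apply/eqP; rewrite eqn_leq le -subn_eq0 -h natrB // e subrr eqxx.
move=> m n e; case: (leqP m n) => [le|/ltnW le]; first exact: key.
by apply/esym/key.
Qed.

Lemma poly_vanish (p : {poly k}) : (forall t, t != 0 -> p.[t] = 0) -> p = 0.
Proof.
move=> h; apply: contrapT => /eqP p0.
pose rs := [seq (i.+1)%:R : k | i <- iota 0 (size p)].
have : (size rs < size p)%N.
  apply: max_poly_roots p0 _ _.
    apply/allP => _ /mapP[i _ ->]; rewrite /root h //.
    by rewrite -[X in _ != X]/(0%:R) (inj_eq nat_char0_inj).
  by rewrite map_inj_uniq ?iota_uniq // => i j /nat_char0_inj[].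
by rewrite size_map size_iota ltnn.
Qed.

Lemma laurent_vanish1 (J : eqType) (r : seq J) (c : J -> k) (e : J -> int) : uniq r ->
  {in r &, injective e} -> (forall t, t != 0 -> \sum_(j <- r) c j * t ^ e j = 0) ->
  {in r, forall j, c j = 0}.
Proof.
move=> ur einj h j jr.
(* Multiplication by [t ^ M] clears the negative exponents. *)
have [M hM] : exists M : nat, forall i, i \in r -> 0 <= e i + M%:Z.
  exists (\sum_(i <- r) absz (e i))%N => i ir.
  by rewrite (big_rem i) //= PoszD; lia.
pose p : {poly k} := \sum_(i <- r) c i *: 'X^(absz (e i + M%:Z)).
have p0 : p = 0.
  apply: poly_vanish => t t0; rewrite /p horner_sum.
  have := congr1 (fun x => t ^ M%:Z * x) (h t t0); rewrite mulr0 mulr_sumr => E.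
  rewrite -[RHS]E !big_seq; apply: eq_bigr => i ir.
  rewrite hornerZ hornerXn mulrCA -expfzDr // addrC; congr (_ * _).
  by rewrite exprnP gez0_abs // addrC hM.
have := congr1 (fun q : {poly k} => q`_(absz (e j + M%:Z))) p0.
rewrite coef0 /p coef_sum (bigD1_seq j) //= big_seq_cond big1 => [|i /andP[ir ij]].
  by rewrite addr0 coefZ coefXn eqxx mulr1.
rewrite coefZ coefXn; case: eqP => [E|_]; last by rewrite mulr0.
case/eqP: ij; apply: einj => //; apply: (addIr M%:Z).
by rewrite -(gez0_abs (hM i ir)) -(gez0_abs (hM j jr)) E.
Qed.

(** Substituting [a = t ^ l.1] and [b = t ^ l.2] for a separating form [l] keeps the monomials in
    [r] distinct and reduces to one variable. *)
Lemma laurent_vanish (r : seq pt) (c : pt -> k) : uniq r ->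
  (forall a b, a != 0 -> b != 0 -> \sum_(w <- r) c w * (a ^ w.1 * b ^ w.2) = 0) ->
  {in r, forall w, c w = 0}.
Proof.
move=> ur h; have [l linj] := separating_form r.
apply: (laurent_vanish1 (e := dot l)) => // t t0.
rewrite -[RHS](h (t ^ l.1) (t ^ l.2)) ?expfz_neq0 //; apply: eq_bigr => w _.
by rewrite !exprz_exp /dot expfzDr.
Qed.

End Laurent.

(** * The ideal of the closure of the torus image *)

Section ToricIdeal.
Variables (k : fieldType) (N : nat) (pos : 'I_N -> pt).
Hypothesis hk : [pchar k] =i pred0.
Hypothesis N0 : (0 < N)%N.
Local Notation S := {mpoly k[N]}.
Local Notation mw := (mw pos).

Definition torus_point (a b : k) : 'I_N -> k := fun i => a ^ (pos i).1 * b ^ (pos i).2.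

Lemma exprz_sum (a : k) (F : 'I_N -> int) : a != 0 -> \prod_i a ^ F i = a ^ (\sum_i F i).
Proof.
by move=> a0; rewrite (big_morph (fun z => a ^ z) (fun m n => expfzDr m n a0) (expr0z a)).
Qed.

Lemma torus_monomial a b (m : 'X_{1..N}) : a != 0 -> b != 0 ->
  \prod_i torus_point a b i ^+ m i = a ^ (mw m).1 * b ^ (mw m).2.
Proof.
move=> a0 b0; rewrite mw_fst mw_snd -!exprz_sum // -big_split; apply: eq_bigr => i _ /=.
by rewrite /torus_point exprMn !exprnP !exprz_exp [(pos i).1 * _]mulrC [(pos i).2 * _]mulrC.
Qed.

Lemma torus_eval (f : S) (d : nat) a b : homogeneous_of_degree d%:Z f -> a != 0 -> b != 0 ->
  f.@[torus_point a b] =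
  \sum_(w <- undup [seq mw m | m <- msupp f]) cs pos d%:Z w f * (a ^ w.1 * b ^ w.2).
Proof.
move=> hf a0 b0; rewrite mevalE.
under eq_bigr do rewrite torus_monomial //.
under [RHS]eq_bigr do rewrite csE mulr_suml.
rewrite [RHS](exchange_big_dep predT) //= !big_seq; apply: eq_bigr => m ms.
rewrite (hf m ms) eqxx /= big_mkcond (bigD1_seq (mw m)) ?undup_uniq //=; last first.
  by rewrite mem_undup map_f.
rewrite eqxx big1 ?addr0 // => w /negPf ne.
by rewrite eq_sym ne.
Qed.

Variable Y : classical_sets.set ('I_N -> k).
Hypothesis YP : forall x, Y x <-> exists a b : k, [/\ a != 0, b != 0 & x = torus_point a b].

(** For [f] of degree [d] the restriction to the torus is the Laurent polynomial with coefficients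
    [cs], which vanishes only if all of them do. *)
Lemma vanishing_binomial (d : nat) (f : S) : homogeneous_of_degree d%:Z f ->
  vanishes_on Y f <-> binomial_ideal pos f.
Proof.
move=> hf; split=> [fY e w|bf y /YP[a [b [a0 b0 ->]]]]; last first.
  by rewrite (torus_eval hf) // big1 // => w _; rewrite bf mul0r.
have [->|ne] := eqVneq e d%:Z; last exact: cs_homog hf ne.
have [wo|wo] := boolP (w \in undup [seq mw m | m <- msupp f]); last first.
  rewrite csE big_seq_cond big1 // => m /and3P[ms _ /eqP E].
  by case/negP: wo; rewrite mem_undup -E map_f.
have := @laurent_vanish k hk _ (fun w => cs pos d%:Z w f) (undup_uniq [seq mw m | m <- msupp f]).
apply=> // a b a0 b0; rewrite -(torus_eval hf) //; apply: fY; apply/YP.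
by exists a, b.
Qed.

Lemma homogeneous_dhomog (d : nat) (f : S) : f \is d.-homog <-> homogeneous_of_degree d%:Z f.
Proof.
split=> [/dhomogP h m ms|h]; first by rewrite (h m ms).
by apply/dhomogP => m /h[].
Qed.

Lemma closure_sub y : Y y -> zariski_closure Y y.
Proof.
move=> Yy; split=> [|d f _]; last exact.
have [a [b [a0 b0 ->]]] := (YP y).1 Yy.
by exists (Ordinal N0); rewrite mulf_neq0 // expfz_neq0.
Qed.

Lemma sum_hproj (f : S) : f = \sum_(d < msize f) hproj d%:Z f.
Proof.
apply/mpolyP => m; rewrite raddf_sum /=.
have [ms|ms] := boolP (m \in msupp f); last first.
  rewrite big1 => [|d _]; first by apply/eqP; rewrite mcoeff_eq0.
  by rewrite mcoeff_hproj; case: ifP => // _; apply/eqP; rewrite mcoeff_eq0.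
rewrite (bigD1 (Ordinal (msize_mdeg_lt ms))) //= mcoeff_hproj eqxx big1 ?addr0 //.
move=> d ne; rewrite mcoeff_hproj; case: eqP => // -[E].
by case/eqP: ne; apply/val_inj.
Qed.

Lemma toric_binomial f :
  homogeneous_ideal (zariski_closure Y) f <-> binomial_ideal pos f.
Proof.
split=> [[m [h [g [gP ->]]]]|bf].
  elim/big_ind: _ => [|u v|i _]; [exact: bi0 | exact: biD | apply: biM].
  have [[d hd] gv] := gP i; apply/(vanishing_binomial ((homogeneous_dhomog _ _).1 hd)).
  by move=> y /closure_sub/gv.
exists (msize f), (fun=> 1), (fun d => hproj d%:Z f); split=> [d|]; last first.
  by rewrite {1}[f]sum_hproj; apply: eq_bigr => d _; rewrite mul1r.
have hd := (homogeneous_dhomog d (hproj d%:Z f)).2 (@hproj_homog k N d%:Z f).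
split; first by exists d.
move=> y [_ hy]; apply: (hy d) => //.
apply/(vanishing_binomial (@hproj_homog k N d%:Z f)); exact: bi_hproj.
Qed.

End ToricIdeal.

(** * Lattice polygons *)

From mathcomp Require Import finmap classical_sets cardinality reals topology.
Import numFieldTopology.Exports.

Section Polygon.
Local Open Scope classical_set_scope.
Local Open Scope ring_scope.
Variable R : realType.
Local Notation lv := (@lattice_vec R).
Implicit Types (x y : 'rV[R]_2) (z p q : pt).

Lemma lv0 z : lv z 0 0 = z.1%:~R. Proof. by rewrite mxE. Qed.
Lemma lv1 z : lv z 0 1 = z.2%:~R. Proof. by rewrite mxE. Qed.

Lemma row2P x y : x 0 0 = y 0 0 -> x 0 1 = y 0 1 -> x = y.
Proof.
move=> h0 h1; apply/rowP => j; have [->//|->//] : j = 0 \/ j = 1.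
by case: j => -[|[|//]] h; [left|right]; apply/val_inj.
Qed.

Variable s : seq pt.
Let D := convex_hull (lv @` [set` s]).

Lemma hullP x : D x <-> exists t : 'I_(size s) -> R,
  [/\ forall i, 0 <= t i, \sum_i t i = 1 & x = \sum_i t i *: lv (nth (0, 0) s i)].
Proof.
split=> [[n [t [v [vA t0 t1 xE]]]]|[t [t0 t1 xE]]]; last first.
  exists (size s), t, (fun i => lv (nth (0, 0) s i)); split => // i.
  by exists (nth (0, 0) s i) => //=; rewrite mem_nth.
have idx i : exists j : 'I_(size s), v i = lv (nth (0, 0) s j).
  have [p ps <-] := vA i; have lt : (index p s < size s)%N by rewrite index_mem.
  by exists (Ordinal lt); rewrite /= nth_index.
have [g gP] := choice idx.
exists (fun j => \sum_(i | g i == j) t i); split.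
- by move=> j; apply: sumr_ge0.
- by rewrite -t1 [RHS](partition_big g predT).
rewrite xE (partition_big g predT) //=; apply: eq_bigr => j _.
by rewrite scaler_suml; apply: eq_bigr => i /eqP<-; rewrite gP.
Qed.

(** Membership of [x j] is asked only where [c j] is nonzero, so sums over a list can be treated
    after multiplying the weights by a membership indicator. *)
Lemma hull_convex (J : Type) (r : seq J) (c : J -> R) (x : J -> 'rV[R]_2) :
  (forall j, 0 <= c j) -> (forall j, c j != 0 -> D (x j)) -> \sum_(j <- r) c j = 1 ->
  D (\sum_(j <- r) c j *: x j).
Proof.
move=> c0 xD c1.
have H j : exists t : 'I_(size s) -> R, c j != 0 -> [/\ forall i, 0 <= t i, \sum_i t i = 1 &
    x j = \sum_i t i *: lv (nth (0, 0) s i)].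
  have [c0j|cj] := eqVneq (c j) 0; first by exists (fun=> 0) => /eqP.
  by have [t tP] := (hullP _).1 (xD j cj); exists t.
have [t tP] := choice H.
have ct0 j i : 0 <= c j * t j i.
  have [->|cj] := eqVneq (c j) 0; first by rewrite mul0r.
  by rewrite mulr_ge0 //; have [h _ _] := tP j cj.
apply/hullP; exists (fun i => \sum_(j <- r) c j * t j i); split.
- by move=> i; apply: sumr_ge0.
- rewrite exchange_big /= -c1; apply: eq_bigr => j _; rewrite -mulr_sumr.
  have [->|cj] := eqVneq (c j) 0; first by rewrite mul0r.
  by have [_ -> _] := tP j cj; rewrite mulr1.
under [RHS]eq_bigr do rewrite scaler_suml.
rewrite exchange_big /=; apply: eq_bigr => j _.
under [RHS]eq_bigr do rewrite -scalerA.
rewrite -scaler_sumr; have [->|cj] := eqVneq (c j) 0; first by rewrite !scale0r.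
by have [_ _ ->] := tP j cj.
Qed.

Lemma hull_s p : p \in s -> D (lv p).
Proof.
move=> ps; exists 1%N, (fun=> 1), (fun=> lv p); split; first by move=> _; exists p.
- by move=> _; apply: ler01.
- by rewrite big_ord_recl big_ord0 addr0.
- by rewrite big_ord_recl big_ord0 addr0 scale1r.
Qed.

Definition rdot (a : pt) x : R := a.1%:~R * x 0 0 + a.2%:~R * x 0 1.

Lemma rdot_lv a p : rdot a (lv p) = (dot a p)%:~R.
Proof. by rewrite /rdot lv0 lv1 /dot intrD !intrM. Qed.

Lemma rdot_sum a (J : Type) (r : seq J) (c : J -> R) (x : J -> 'rV[R]_2) :
  rdot a (\sum_(j <- r) c j *: x j) = \sum_(j <- r) c j * rdot a (x j).
Proof.
rewrite /rdot !summxE !mulr_sumr -big_split; apply: eq_bigr => j _.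
by rewrite !mxE /=; ring.
Qed.

Lemma hull_rdot_le a (M : int) x : (forall p, p \in s -> dot a p <= M) -> D x -> rdot a x <= M%:~R.
Proof.
move=> aM /hullP[t [t0 t1 ->]]; rewrite rdot_sum.
have -> : M%:~R = \sum_i t i * M%:~R :> R by rewrite -mulr_suml t1 mul1r.
by apply: ler_sum => i _; apply: ler_wpM2l => //; rewrite rdot_lv ler_int aM // mem_nth.
Qed.

Lemma hull_rdot_eq a (M : int) x : (forall p, p \in s -> dot a p = M) -> D x -> rdot a x = M%:~R.
Proof.
move=> aM /hullP[t [t0 t1 ->]]; rewrite rdot_sum.
have -> : M%:~R = \sum_i t i * M%:~R :> R by rewrite -mulr_suml t1 mul1r.
by apply: eq_bigr => i _; rewrite rdot_lv aM // mem_nth.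
Qed.

Lemma seq_bound (f : pt -> int) : exists B : int, forall p, p \in s -> f p <= B.
Proof.
elim: s => [|q r [B BP]]; first by exists 0.
exists (Num.max (f q) B) => p; rewrite inE le_max => /orP[/eqP->|/BP->]; first by rewrite lexx.
by rewrite orbT.
Qed.

Lemma lattice_points_finite : finite_set (lattice_points D).
Proof.
have [B1 H1] := seq_bound (dot (1, 0)); have [B2 H2] := seq_bound (dot (-1, 0)).
have [B3 H3] := seq_bound (dot (0, 1)); have [B4 H4] := seq_bound (dot (0, -1)).
pose rng (lo hi : int) := [seq (Posz i - lo : int) | i <- iota 0 (absz (hi + lo)).+1].
have rngP (lo hi u : int) : u <= hi -> - u <= lo -> u \in rng lo hi.
  move=> h1 h2; apply/mapP; exists (absz (u + lo)); last by lia.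
  by rewrite mem_iota; lia.
pose box := [seq (u, w) | u <- rng B2 B1, w <- rng B4 B3].
apply: (@sub_finite_set _ _ [set` box]); last exact: finite_seq.
move=> z Dz; suff : z \in box by [].
apply/allpairsPdep; exists z.1, z.2; split; rewrite -?surjective_pairing //; apply: rngP.
- by have := hull_rdot_le H1 Dz; rewrite rdot_lv ler_int /dot /=; lia.
- by have := hull_rdot_le H2 Dz; rewrite rdot_lv ler_int /dot /=; lia.
- by have := hull_rdot_le H3 Dz; rewrite rdot_lv ler_int /dot /=; lia.
- by have := hull_rdot_le H4 Dz; rewrite rdot_lv ler_int /dot /=; lia.
Qed.

Lemma lattice_fsetP z : (z \in lattice_fset D) = `[< D (lv z) >].
Proof.
rewrite /lattice_fset in_fset_set; last exact: lattice_points_finite.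
by apply/idP/asboolP; rewrite inE.
Qed.

Variable V : seq pt.
Hypothesis VD : forall z, z \in V <-> D (lv z).

Lemma polygon_saturated : saturated V.
Proof.
move=> M z m M0 /repP[r1 r2 r3]; apply/VD.
have Mn0 : (M%:R : R) != 0 by rewrite pnatr_eq0 -lt0n.
have -> : lv z = \sum_(p <- V) (((m p)%:R / M%:R) * (p \in V)%:R) *: lv p.
  have E f : \sum_(p <- V) (m p)%:R / M%:R * (p \in V)%:R * (f p)%:~R =
      ((lsum V m f)%:~R : R) / M%:R.
    rewrite /lsum (big_morph (intmul (1 : R)) (@intrD R) (mulr0z _)) mulr_suml !big_seq.
    by apply: eq_bigr => p ->; rewrite mulr1 intrM -pmulrn mulrAC.
  apply: row2P; rewrite summxE.
    rewrite (eq_bigr (fun p => (m p)%:R / M%:R * (p \in V)%:R * (p.1)%:~R)); last first.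
      by move=> p _; rewrite mxE lv0.
    by rewrite (E fst) r2 /= intrM -pmulrn mulfK // lv0.
  rewrite (eq_bigr (fun p => (m p)%:R / M%:R * (p \in V)%:R * (p.2)%:~R)); last first.
    by move=> p _; rewrite mxE lv1.
  by rewrite (E snd) r3 /= intrM -pmulrn mulfK // lv1.
apply: hull_convex => [p|p|].
- by rewrite mulr_ge0 // divr_ge0.
- have [/VD//|_] := boolP (p \in V); by rewrite mulr0 eqxx.
have : (lsum V m (fun=> 1))%:~R / (M%:R : R) = 1 by rewrite r1 -pmulrn divff.
apply: etrans; rewrite /lsum (big_morph (intmul (1 : R)) (@intrD R) (mulr0z _)) mulr_suml !big_seq.
by apply: eq_bigr => p ->; rewrite !mulr1 -pmulrn.
Qed.

Lemma sub_sV p : p \in s -> p \in V.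
Proof. by move=> ps; apply/VD/hull_s. Qed.

Lemma polygon_noncollinear : two_dimensional D -> noncollinear V.
Proof.
case=> x [y [z [Dx Dy Dz]]]; rewrite free_cons span_seq1 seq1_free => /andP[/negP yz zx].
apply: contrapT => col.
have col0 p q r : p \in V -> q \in V -> r \in V -> orient p q r = 0.
  move=> pV qV rV; apply/eqP; apply: contrapT => /negP ne.
  by apply: col; exists p, q, r.
have [a [a0 [M aM]]] : exists a : pt, a <> (0, 0) /\ exists M, forall p, p \in s -> dot a p = M.
  have [[p [q [pV qV pq]]]|H] := pselect (exists p q : pt, [/\ p \in V, q \in V & p != q]).
    exists (q.2 - p.2, - (q.1 - p.1)); split.
      move=> [/subr0_eq e2 /eqP]; rewrite oppr_eq0 => /eqP/subr0_eq e1.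
      by case/eqP: pq; rewrite [p]surjective_pairing [q]surjective_pairing e1 e2.
    exists (dot (q.2 - p.2, - (q.1 - p.1)) p) => r /sub_sV rV; apply/eqP.
    rewrite -subr_eq0 -oppr_eq0 -[X in _ == X](col0 p q r) //; apply/eqP.
    by rewrite /dot /orient /=; ring.
  (* Here [V] has at most one point, so any form is constant on [s]; for empty [s] the constant is
     arbitrary. *)
  exists (1, 0); split=> //; case: s sub_sV => [|p t] sub; first by exists 0.
  exists (dot (1, 0) p) => q qs; congr (dot _ _); apply/eqP; apply: contrapT => /negP ne.
  by apply: H; exists q, p; rewrite !sub ?mem_head.
have hx := hull_rdot_eq aM Dx; have hy := hull_rdot_eq aM Dy; have hz := hull_rdot_eq aM Dz.
have ky : a.1%:~R * (y - x) 0 0 + a.2%:~R * (y - x) 0 1 = 0 :> R.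
  have : rdot a y - rdot a x = 0 by rewrite hx hy subrr.
  by rewrite /rdot !mxE => <-; ring.
have kz : a.1%:~R * (z - x) 0 0 + a.2%:~R * (z - x) 0 1 = 0 :> R.
  have : rdot a z - rdot a x = 0 by rewrite hx hz subrr.
  by rewrite /rdot !mxE => <-; ring.
move: yz zx ky kz; move: (y - x) (z - x) => u w uw w0 ku kw.
have det0 : u 0 0 * w 0 1 = u 0 1 * w 0 0.
  have [a1|a2] : a.1 != 0 \/ a.2 != 0.
  - apply/orP; rewrite -negb_and; apply/negP => /andP[/eqP e1 /eqP e2].
    by apply: a0; rewrite [a]surjective_pairing e1 e2.
  - have a1' : (a.1%:~R : R) != 0 by rewrite intr_eq0.
    apply: (mulfI a1'); apply/eqP; rewrite -subr_eq0; apply/eqP.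
    transitivity ((a.1%:~R * u 0 0 + a.2%:~R * u 0 1) * w 0 1 -
      (a.1%:~R * w 0 0 + a.2%:~R * w 0 1) * u 0 1); first by ring.
    by rewrite ku kw !mul0r subrr.
  have a2' : (a.2%:~R : R) != 0 by rewrite intr_eq0.
  apply: (mulfI a2'); apply/eqP; rewrite -subr_eq0; apply/eqP.
  transitivity ((a.1%:~R * w 0 0 + a.2%:~R * w 0 1) * u 0 0 -
    (a.1%:~R * u 0 0 + a.2%:~R * u 0 1) * w 0 0); first by ring.
  by rewrite ku kw !mul0r subrr.
apply: uw; apply/vlineP; have [w00|w00] := eqVneq (w 0 0) 0; last first.
  exists (u 0 0 / w 0 0); apply: row2P; rewrite mxE; first by rewrite mulfVK.
  by rewrite mulrAC det0 mulfK.
have w01 : w 0 1 != 0.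
  by apply: contra w0 => /eqP w01; apply/eqP/row2P; rewrite mxE.
exists (u 0 1 / w 0 1); apply: row2P; rewrite mxE; last by rewrite mulfVK.
by rewrite mulrAC -det0 mulfK.
Qed.

(** A small step from [z] in the direction [a] stays in the polygon and increases the form [a], so
    [z] cannot maximise this form on [s]. *)
Lemma interior_unsupported z : (interior D) (lv z) -> unsupported V z.
Proof.
move=> /nbhs_ballP[e /= e0 eD] a a0; apply: contrapT => H.
have aM p : p \in s -> dot a p <= dot a z.
  by move=> /sub_sV pV; rewrite leNgt; apply/negP => lt; apply: H; exists p.
pose n : R := `|a.1%:~R| + `|a.2%:~R| + 1.
have n0 : 0 < n by rewrite ltr_wpDl // addr_ge0.
pose t := e / n; have t0 : 0 < t by rewrite divr_gt0.
pose u : 'rV[R]_2 := \row_j (if j == 0 then a.1%:~R else a.2%:~R).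
have bnd (b : R) : `|b| < n -> `|t * b| < e.
  move=> bn; rewrite normrM gtr0_norm // /t mulrAC ltr_pdivrMr // ltr_pM2l //.
have Dx : D (lv z + t *: u).
  apply: eD; split => // i j; rewrite /ball /= (ord1 i) !mxE opprD addrA subrr add0r normrN.
  apply: bnd; case: ifP => _; rewrite /n;
  by have := normr_ge0 (a.1%:~R : R); have := normr_ge0 (a.2%:~R : R); lra.
have := hull_rdot_le aM Dx.
have -> : rdot a (lv z + t *: u) = (dot a z)%:~R + t * (a.1%:~R ^+ 2 + a.2%:~R ^+ 2).
  by rewrite /rdot !mxE /= /dot intrD !intrM; ring.
rewrite gerDl pmulr_rle0 // => le0.
have [h1 h2] : (a.1%:~R : R) = 0 /\ (a.2%:~R : R) = 0.
  have s1 := sqr_ge0 (a.1%:~R : R); have s2 := sqr_ge0 (a.2%:~R : R).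
  by split; apply/eqP; rewrite -sqrf_eq0; apply/eqP; lra.
move/eqP: h1; move/eqP: h2; rewrite !intr_eq0 => /eqP h2 /eqP h1.
by apply: a0; rewrite [a]surjective_pairing h1 h2.
Qed.

(** A small displacement of [x] is a combination of [y1 - y0] and [y2 - y0]. It is absorbed by
    changing the weights at these three points, which are at least 1/M and so remain nonnegative. *)
Lemma witness_interior : uniq V -> interior_witness V -> exists z, (interior D) (lv z).
Proof.
move=> uV [x [y0 [y1 [y2 [M [m [M0 r oy [[xV y0V y1V y2V] [m0 m1 m2]]]]]]]]].
exists x.
have Mn0 : (M%:R : R) != 0 by rewrite pnatr_eq0 -lt0n.
have Mp : 0 < (M%:R : R) by rewrite ltr0n.
pose b1 : pt := (y1.1 - y0.1, y1.2 - y0.2); pose b2 : pt := (y2.1 - y0.1, y2.2 - y0.2).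
pose dl : R := (orient y0 y1 y2)%:~R.
have dl0 : dl != 0 by rewrite intr_eq0.
have dl1 : 1 <= `|dl| by rewrite /dl -intr_norm ler1z; lia.
pose L : R := `|b1.1%:~R| + `|b1.2%:~R| + `|b2.1%:~R| + `|b2.2%:~R| + 1.
have n1 := normr_ge0 (b1.1%:~R : R); have n2 := normr_ge0 (b1.2%:~R : R).
have n3 := normr_ge0 (b2.1%:~R : R); have n4 := normr_ge0 (b2.2%:~R : R).
have L0 : 0 < L by rewrite /L; lra.
(* Cramer's rule divides by [dl], of absolute value at least 1, so [al] and [be] are at most
   [e * L], half of 1/M; the weight at [y0] loses [al + be], at most 1/M. *)
pose e := (2 * M%:R * L)^-1.
have e0 : 0 < e by rewrite invr_gt0 !mulr_gt0.
apply/nbhs_ballP; exists e => //= y [_ yx].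
pose u0 := y 0 0 - lv x 0 0; pose u1 := y 0 1 - lv x 0 1.
have hu0 : `|u0| < e by have := yx 0 0; rewrite /ball /= distrC.
have hu1 : `|u1| < e by have := yx 0 1; rewrite /ball /= distrC.
pose al := (u0 * b2.2%:~R - u1 * b2.1%:~R) / dl.
pose be := (b1.1%:~R * u1 - b1.2%:~R * u0) / dl.
have bnd (p q v w : R) : `|v| + `|w| <= L -> `|p| < e -> `|q| < e ->
    `|(p * v - q * w) / dl| <= (2 * M%:R)^-1.
  move=> vw hp hq; rewrite normrM normfV.
  apply: (@le_trans _ _ `|p * v - q * w|).
    by rewrite ler_pdivrMr ?ler_peMr // (lt_le_trans ltr01).
  apply: le_trans (ler_normB _ _) _; rewrite !normrM.
  apply: (@le_trans _ _ (e * L)); last by rewrite /e invfM mulrVK // unitfE gt_eqF.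
  apply: le_trans (_ : e * (`|v| + `|w|) <= _); last by rewrite ler_pM2l.
  by rewrite mulrDr lerD // ler_wpM2r // ltW.
have hal : `|al| <= (2 * M%:R)^-1 by apply: bnd => //; rewrite /L; lra.
have hbe : `|be| <= (2 * M%:R)^-1.
  by rewrite /be [_ * u1]mulrC [_ * u0]mulrC; apply: bnd => //; rewrite /L; lra.
pose c p : R := (m p)%:R / M%:R + (if p == y1 then al else 0) + (if p == y2 then be else 0) -
  (if p == y0 then al + be else 0).
have y01 : y0 != y1 by apply: contraNneq oy => ->; rewrite /orient !subrr !mul0r.
have y02 : y0 != y2 by apply: contraNneq oy => ->; rewrite /orient !subrr !mulr0.
have y12 : y1 != y2 by apply: contraNneq oy => ->; rewrite /orient mulrC subrr.
have half : (2 * M%:R)^-1 + (2 * M%:R)^-1 = (M%:R : R)^-1.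
  by field.
have pos p : (0 < m p)%N -> (M%:R : R)^-1 <= (m p)%:R / M%:R.
  by move=> mp; rewrite ler_peMl ?invr_ge0 // ler1n.
have cge p : 0 <= c p.
  rewrite /c; move: hal hbe; rewrite !ler_norml => /andP[a1 a2] /andP[c1 c2].
  have h0 : 0 <= (m p)%:R / (M%:R : R) by rewrite divr_ge0.
  have P1 := pos _ m1; have P2 := pos _ m2; have P0 := pos _ m0.
  case: (eqVneq p y1) h0 => [->|_] h0.
    by rewrite (negPf y12) eq_sym (negPf y01); lra.
  case: (eqVneq p y2) h0 => [->|_] h0.
    by rewrite eq_sym (negPf y02); lra.
  case: (eqVneq p y0) h0 => [->|_] h0; lra.
pose c' p : R := c p * (p \in V)%:R.
have sumc f : \sum_(p <- V) c' p * f p =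
    (\sum_(p <- V) (m p)%:R * f p) / M%:R + al * f y1 + be * f y2 - (al + be) * f y0.
  have pick q (g : R) : q \in V -> \sum_(p <- V) (if p == q then g else 0) * f p = g * f q.
    move=> qV; rewrite (bigD1_seq q) //= eqxx big1 ?addr0 // => p /negPf->.
    by rewrite mul0r.
  rewrite -(pick y1 al) // -(pick y2 be) // -(pick y0 (al + be)) // mulr_suml -!big_split -sumrB /=.
  rewrite !big_seq; apply: eq_bigr => p pV; rewrite /c' pV mulr1 /c /=.
  by move: (if _ then al else 0) (if _ then be else 0) (if _ then al + be else 0) => A B C; ring.
have lsumR f : \sum_(p <- V) (m p)%:R * (f p)%:~R = (lsum V m f)%:~R :> R.
  rewrite /lsum (big_morph (intmul (1 : R)) (@intrD R) (mulr0z _)).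
  by apply: eq_bigr => p _; rewrite intrM -pmulrn.
case/repP: r => r1 r2 r3.
have -> : y = \sum_(p <- V) c' p *: lv p.
  have c1 : dl = b1.1%:~R * b2.2%:~R - b1.2%:~R * b2.1%:~R.
    by rewrite /dl /orient intrB !intrM.
  apply: row2P; rewrite summxE.
    rewrite (eq_bigr (fun p => c' p * (p.1)%:~R)); last by move=> p _; rewrite mxE lv0.
    rewrite sumc (lsumR fst) r2 /= intrM -pmulrn mulfK // /al /be.
    rewrite -[LHS](subrK (lv x 0 0)) -/u0 lv0.
    have -> : u0 = u0 * dl / dl by rewrite mulfK.
    by rewrite {1}c1 /b1 /b2 /= !intrB; field.
  rewrite (eq_bigr (fun p => c' p * (p.2)%:~R)); last by move=> p _; rewrite mxE lv1.
  rewrite sumc (lsumR snd) r3 /= intrM -pmulrn mulfK // /al /be.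
  rewrite -[LHS](subrK (lv x 0 1)) -/u1 lv1.
  have -> : u1 = u1 * dl / dl by rewrite mulfK.
  by rewrite {1}c1 /b1 /b2 /= !intrB; field.
apply: hull_convex => [p|p|].
- by rewrite /c' mulr_ge0.
- by rewrite /c'; have [/VD//|_] := boolP (p \in V); rewrite mulr0 eqxx.
have := sumc (fun=> 1); rewrite (lsumR (fun=> 1)) r1 -pmulrn divff // !mulr1 => E.
rewrite -[RHS](_ : 1 + al + be - (al + be) = 1); last by ring.
by rewrite -E; apply: eq_bigr => p _; rewrite mulr1.
Qed.

Lemma interior_hull_eq0 : interior_hull D = set0 <-> forall z, ~ (interior D) (lv z).
Proof.
split=> [h z zD|h].
  have : interior_hull D (lv z).
    exists 1%N, (fun=> 1), (fun=> lv z); split; first by move=> _; exists z.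
    - by move=> _; apply: ler01.
    - by rewrite big_ord_recl big_ord0 addr0.
    - by rewrite big_ord_recl big_ord0 addr0 scale1r.
  by rewrite h.
apply/seteqP; split=> // x [[|n] [t [v [vA _ t1 _]]]].
  by move: t1; rewrite big_ord0 => /eqP; rewrite eq_sym oner_eq0.
by have [z zD _] := vA ord0; case: (h z).
Qed.
End Polygon.

(** * Assembling the Betti table *)

Section Assembly.
Variables (R : realType) (k : fieldType) (s : seq pt).
Hypothesis hk : [pchar k] =i pred0.
Let D : set 'rV[R]_2 := convex_hull (@lattice_vec R @` [set` s]).
Hypothesis hD2 : two_dimensional D.
Local Notation N := (num_lattice_points D).
Local Notation pos := (@lattice_point R D).
Let V := [seq pos i | i <- enum 'I_N].

Lemma lattice_point_inj : injective pos.
Proof.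
move=> i j /eqP; rewrite /lattice_point nth_uniq ?fset_uniq //.
by move/eqP/val_inj.
Qed.

Lemma lattice_points_enum z : z \in V <-> D (lattice_vec R z).
Proof.
have <- : (z \in lattice_fset D) <-> D (lattice_vec R z).
  by rewrite lattice_fsetP; split=> /asboolP.
split=> [/mapP[i _ ->]|zD]; first exact: mem_nth.
have lt : (index z (lattice_fset D) < N)%N by rewrite index_mem.
apply/mapP; exists (Ordinal lt); first by rewrite mem_enum.
by rewrite /lattice_point /= nth_index.
Qed.

Lemma lattice_points_shelled : shelled V.
Proof.
apply: shelled_exists.
- by rewrite map_inj_uniq ?enum_uniq //; apply: lattice_point_inj.
- exact: (polygon_saturated lattice_points_enum).
- exact: (polygon_noncollinear lattice_points_enum).
Qed.

Lemma num_lattice_points_gt2 : (2 < N)%N.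
Proof.
have [p [q [r [pV qV rV pqr]]]] := polygon_noncollinear lattice_points_enum hD2.
have <- : size V = N by rewrite size_map size_enum_ord.
apply: (@uniq_leq_size _ [:: p; q; r]) => [|x]; last by rewrite !inE => /or3P[]/eqP->.
rewrite /= !inE negb_or !andbT; apply/andP; split; last first.
  by apply: contraNneq pqr => ->; rewrite /orient mulrC subrr.
by apply/andP; split; apply: contraNneq pqr => ->; rewrite /orient ?subrr ?mul0r ?mulr0 ?subrr.
Qed.

Lemma toric_idealE : toric_ideal k D = binomial_ideal pos.
Proof.
apply/funext => f; apply/propext.
by apply: toric_binomial => //; exact: ltn_trans num_lattice_points_gt2.
Qed.

Variable F : min_graded_free_resolution (toric_ideal k D).

Lemma toric_betti_eq0 p q :
  betti F p q = 0%N <-> koszul_exact (binomial_ideal pos : set {mpoly k[N]}) p q.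
Proof.
rewrite -toric_idealE; apply: betti_eq0 => //; rewrite toric_idealE.
- exact: bi0.
- exact: biD.
- exact: biM.
- exact: bi_hproj.
Qed.

Lemma toric_betti00 : (forall q : int, q != 0 -> betti F 0 q = 0%N) -> betti F 0 0 = 1%N.
Proof.
move=> h; apply: betti00 => //; rewrite toric_idealE.
- exact: bi0.
- exact: biD.
- exact: biM.
- exact: bi_not1.
- by move=> q /h/toric_betti_eq0.
Qed.

Lemma betti_vanishing p (q : int) :
  ~~ ((p == 0%N) && (q == 0)) -> ~~ [&& (1 <= p <= N - 3)%N & (q == 1) || (q == 2)] ->
  betti F p (p%:Z + q) = 0%N.
Proof.
move=> h0 h12; apply/toric_betti_eq0.
have [V' [fs [pe tri _ _]]] := lattice_points_shelled.
case: q h0 h12 => [n|n] h0 h12; last by apply: koszul_exact_neg; lia.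
rewrite -PoszD; apply: (exact_koszul lattice_point_inj pe) => w.
have [pN|pN] := ltnP (N - 3) p; first exact: (exact_large_p lattice_point_inj pe tri).
have [n3|n3] := ltnP 2 n.
  by apply: (exact_large_q lattice_point_inj pe tri); rewrite ltn_add2l.
have [p0|p0] := posnP p.
  by rewrite p0 in h0 *; apply: exact_p0 => //; [exact: lattice_point_inj | lia].
have [n0|n0] := posnP n.
  by rewrite n0 addn0; apply: exact_diag => //; exact: lattice_point_inj.
by move: h12; rewrite p0 pN /=; lia.
Qed.

Lemma row2_zero p : interior_hull D = set0 -> betti F p (p + 2)%N%:Z = 0%N.
Proof.
move=> /interior_hull_eq0 no; apply/toric_betti_eq0.
have [V' [fs [pe tri iw _]]] := lattice_points_shelled.
apply: (exact_koszul lattice_point_inj pe) => w.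
apply: (exact_row2 lattice_point_inj pe tri) => f ff f2.
have uV : uniq V by rewrite map_inj_uniq ?enum_uniq //; apply: lattice_point_inj.
have wit : interior_witness V by apply: iw_perm pe (iw _); exists f.
by have [z zD] := witness_interior lattice_points_enum uV wit; apply: (no z).
Qed.

(** The class of [nonexact_interior] would lie in homological degree 0 if N were 3, where positive
    degrees are exact. So N > 3, and the corner is an entry of the table. *)
Lemma row2_corner z : (interior D) (lattice_vec R z) ->
  (3 < N)%N /\ betti F (N - 3) (N - 1)%N%:Z <> 0%N.
Proof.
move=> zD.
have [V' [fs [pe tri _ un]]] := lattice_points_shelled.
have [|w [f [fp bf nex]]] := nonexact_interior k lattice_point_inj pe tri.
  apply: (un z).
    by rewrite (perm_mem pe); apply/lattice_points_enum; exact: (interior_subset zD).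
  move=> a /(interior_unsupported lattice_points_enum zD)[p pV lt].
  by exists p; rewrite // (perm_mem pe).
split.
  rewrite ltnNge; apply/negP => N3.
  have p0 : (N - 3 = 0)%N by lia.
  have d0 : (0 < N - 1)%N by have := num_lattice_points_gt2; lia.
  apply: nex; rewrite p0 in fp *.
  exact: (exact_p0 lattice_point_inj pe d0 fp bf).
move/toric_betti_eq0; exact: (nonexact_koszul lattice_point_inj pe fp bf nex).
Qed.

End Assembly.

Theorem lemma1p2 (R : realType) (k : fieldType) (hk : [pchar k] =i pred0)
    (D : set 'rV[R]_2) (hD : lattice_polygon D) (hD2 : two_dimensional D)
    (F : min_graded_free_resolution (toric_ideal k D)) :
  let N := num_lattice_points D in
  let b (l : nat) := betti F l (l.+1)%:Z in
  let c (l : nat) := betti F (N - 2 - l)%N (N - l)%N%:Z in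
  (forall (p : nat) (q : int), betti F p (p%:Z + q) = betti_table N b c p q) /\
  ((forall l : nat, (1 <= l <= N - 3)%N -> c l = 0%N) <->
   interior_hull D = set0).
Proof.
move=> N b c; have [s DE] := hD; subst D.
have van := betti_vanishing hk hD2 F.
split.
  move=> p q; rewrite /betti_table; case: ifP => [/andP[/eqP-> /eqP->]|/negbT pq].
    apply: toric_betti00 => // r r0.
    by have := van 0%N r; rewrite add0r; apply; rewrite ?(negPf r0).
  case: ifP => [pN|/negbT pN]; last by apply: van; rewrite // (negPf pN).
  case: eqP => [->|/eqP q1]; first by rewrite /b intS addrC.
  case: eqP => [->|/eqP q2]; last by apply: van; rewrite // negb_and negb_or q1 q2 orbT.
  rewrite /c; have -> : (N - 2 - (N - 2 - p) = p)%N by lia.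
  by have -> : (N - (N - 2 - p) = p + 2)%N by lia.
split=> [c0|no l lN].
  apply/interior_hull_eq0 => z zD.
  have [N4 ne] := row2_corner hk hD2 F zD.
  (* The index [l = 1] is the corner in column N - 3 and degree N - 1. *)
  apply: ne; have := c0 1%N; rewrite /c -subnDA; apply.
  by rewrite -/N in N4 *; lia.
rewrite /c; have -> : (N - l = N - 2 - l + 2)%N by lia.
exact: row2_zero.
Qed.
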